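(* Any Lebesgue integrable function $f:[a,b]\to\overline{\mathbb R}$ over $[a,b]$ is also distributionally integrable over $[a,b]$, and the integrals coincide: $(\mathfrak{dist})\int_a^bf(x)\,dx$ equals the Lebesgue integral of $f$ over $[a,b]$.
   Context: Distributions are real. Notation: $\overline{\mathbb R}=\mathbb R\cup\{-\infty,\infty\}$; $\mathcal E'[a,b]$ is the space of distributions on $\mathbb R$ with support contained in $[a,b]$; $\langle \mathsf g(x+ty),\phi(y)\rangle:=|t|^{-1}\langle \mathsf g(y),\phi((y-x)/t)\rangle$ for $t\ne0$. Point values. For $\mathsf g\in\mathcal D'(\mathbb R)$, the distributional (Łojasiewicz) point value $\mathsf g(x_0)$ exists and equals $\gamma\in\mathbb R$ if $\lim_{\varepsilon\to0}\langle \mathsf g(x_0+\varepsilon y),\phi(y)\rangle=\gamma\int_{-\infty}^\infty\phi(y)\,dy$ for every $\phi\in\mathcal D(\mathbb R)$. A Łojasiewicz distribution is one having a point value at every point of $\mathbb R$. Test classes. $\mathcal T_0$: functions $\phi\in C^\infty(\mathbb R)$, $\phi\ge0$, $\int\phi=1$, such that for some $\alpha<-1$, $\phi^{(m)}(x)=O(|x|^{\alpha-m})$ as $|x|\to\infty$ for all $m\ge0$. $\mathcal T_1$: those $\phi\in\mathcal T_0$ with $x\phi'(x)\le0$ for all $x$. For $\mathsf g\in\mathcal E'(\mathbb R)$, $\phi\in\mathcal T_0$: $\mathsf g^{+}_{\phi,0}(x)=\limsup_{t\to0^+}\langle \mathsf g(x+ty),\phi(y)\rangle$ and $\mathsf g^{-}_{\phi,0}(x)=\liminf_{t\to0^+}\langle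 \mathsf g(x+ty),\phi(y)\rangle$. Integral. Let $f:[a,b]\to\overline{\mathbb R}$. A major distributional pair $(\mathsf u,\mathsf U)$ for $f$ consists of $\mathsf u\in\mathcal E'[a,b]$ and a Łojasiewicz distribution $\mathsf U$ with $\mathsf U'=\mathsf u$, $\mathsf U(a)=0$, such that there exist a countable set $E$ and a Lebesgue null set $Z$ with $\mathsf u^-_{\phi,0}(x)\ge f(x)$ for all $x\in[a,b]\setminus Z$, $\phi\in\mathcal T_0$, and $\mathsf u^-_{\phi,0}(x)>-\infty$ for all $x\in[a,b]\setminus E$, $\phi\in\mathcal T_1$. A minor distributional pair $(\mathsf v,\mathsf V)$ for $f$ consists of $\mathsf v\in\mathcal E'[a,b]$ and a Łojasiewicz distribution $\mathsf V$ with $\mathsf V'=\mathsf v$, $\mathsf V(a)=0$, such that there exist a countable set $E$ and a null set $Z$ with $\mathsf v^+_{\phi,0}(x)\le f(x)$ for all $x\in[a,b]\setminus Z$, $\phi\in\mathcal T_0$, and $\mathsf v^+_{\phi,0}(x)<\infty$ for all $x\in[a,b]\setminus E$, $\phi\in\mathcal T_1$. The function $f$ is distributionally integrable over $[a,b]$ if it has both major and minor pairs and $\sup\mathsf V(b)=\inf\mathsf U(b)$ (sup over minor pairs, inf over major pairs); the common value is $(\mathfrak{dist})\int_a^bf(x)\,dx$. *)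

(* Defs.v *)
From HB Require Import structures.
From mathcomp Require Import all_boot all_order all_algebra.
From mathcomp Require Import all_classical all_reals all_analysis.

Set Implicit Arguments.
Unset Strict Implicit.
Unset Printing Implicit Defensive.
Import Order.TTheory GRing.Theory Num.Theory.
Import numFieldNormedType.Exports.

Local Open Scope ring_scope.
Local Open Scope classical_set_scope.

Section TestFunctions.
Context {R : realType}.
Implicit Types (phi : R -> R) (m : nat) (x : R).

Definition smooth phi := forall m x, derivable (phi^`(m)) x 1.

Definition fsupport phi : set R := closure [set x | phi x != 0].

(* The space D(R). *)
Definition test_function phi := smooth phi /\ compact (fsupport phi).

(* The filter of |x| tending to infinity. *)
Definition abs_infty : set_system R :=
  [set A | exists M : R, forall x, M < `|x| -> A x].

#[global] Instance abs_infty_filter : Filter abs_infty.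
Proof.
split=> [|P Q [M MP] [N NQ]|P Q PQ [M MP]]; first by exists 0.
- exists (Num.max M N) => x; rewrite gt_max => /andP[Mx Nx].
  by split; [exact: MP|exact: NQ].
- by exists M => x /MP /PQ.
Qed.

Canonical abs_infty_filter_on := FilterType abs_infty abs_infty_filter.

Definition T0 phi :=
  [/\ smooth phi, (forall x, 0 <= phi x),
      (\int[lebesgue_measure]_x (phi x)%:E = 1)%E &
      exists2 alpha : R, alpha < -1 & forall m,
        phi^`(m) =O_ abs_infty (fun x : R => `|x| `^ (alpha - m%:R))].

Definition T1 phi := T0 phi /\ forall x, x * derive1 phi x <= 0.

End TestFunctions.

Section Distributions.
Context {R : realType}.

(* A distribution is represented by a functional on all functions R -> R of
   which only the values on D(R) are meaningful. *)
Definition functional := (R -> R) -> R.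

Implicit Types (g U : functional) (phi chi : R -> R).

Definition test_linear g := forall (c : R) phi chi,
  test_function phi -> test_function chi ->
  g (fun x => c * phi x + chi x) = c * g phi + g chi.

(* Continuity on D(R): finite order on each compact set. *)
Definition test_continuous g := forall K : set R, compact K ->
  exists (N : nat) (C : R), forall phi,
    test_function phi -> fsupport phi `<=` K ->
    `|g phi| <= C * \sum_(m < N.+1) sup (range (fun x => `|derive1n m phi x|)).

Definition distribution g := test_linear g /\ test_continuous g.

Definition deriv_distr U : functional := fun phi => - U (derive1 phi).

Definition distr_eq g1 g2 := forall phi, test_function phi -> g1 phi = g2 phi.

(* x belongs to the support of g if g vanishes on no neighborhood of x. *)
Definition dsupport g : set R := [set x | forall V : set R, open V -> V x ->
  exists phi, [/\ test_function phi, fsupport phi `<=` V & g phi <> 0]].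

(* The space E'[a, b]. *)
Definition Eprime (a b : R) g := distribution g /\ dsupport g `<=` `[a, b].

(* The extension to smooth functions of a distribution g of compact support:
   <g, phi> = <g, chi phi> for every test function chi equal to 1 on a large
   enough compact set. *)
Definition smooth_ext g : functional := fun phi =>
  get [set v | exists2 K : set R, compact K &
    forall chi, test_function chi -> (forall x, K x -> chi x = 1) ->
      g (fun x => chi x * phi x) = v].

(* <g(x + t y), phi(y)>, for t != 0 *)
Definition rescale g (x t : R) phi : R :=
  `|t|^-1 * g (fun y => phi ((y - x) / t)).

Definition point_value g (x0 gamma : R) := forall phi, test_function phi ->
  rescale g x0 eps phi @[eps --> 0^'] -->
    gamma * (\int[lebesgue_measure]_y phi y).

Definition lojasiewicz g :=
  distribution g /\ forall x0, exists gamma, point_value g x0 gamma.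

(* Upper and lower radial phi-values, for g of compact support. *)
Definition upper_value g phi (x : R) : \bar R :=
  limf_esup (fun t : R => (rescale (smooth_ext g) x t phi)%:E) 0^'+.

Definition lower_value g phi (x : R) : \bar R :=
  limf_einf (fun t : R => (rescale (smooth_ext g) x t phi)%:E) 0^'+.

End Distributions.

Section Integral.
Context {R : realType}.
Variables (a b : R) (f : R -> \bar R).
Local Open Scope ereal_scope.

Definition lojasiewicz_primitive (u U : @functional R) :=
  [/\ Eprime a b u, lojasiewicz U, distr_eq (deriv_distr U) u &
      point_value U a 0].

Definition major_pair (u U : @functional R) :=
  lojasiewicz_primitive u U /\
  exists E Z : set R, [/\ countable E, lebesgue_measure.-negligible Z,
    (forall x phi, (`[a, b] `\` Z) x -> T0 phi -> f x <= lower_value u phi x) &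
    (forall x phi, (`[a, b] `\` E) x -> T1 phi -> -oo < lower_value u phi x)].

Definition minor_pair (v V : @functional R) :=
  lojasiewicz_primitive v V /\
  exists E Z : set R, [/\ countable E, lebesgue_measure.-negligible Z,
    (forall x phi, (`[a, b] `\` Z) x -> T0 phi -> upper_value v phi x <= f x) &
    (forall x phi, (`[a, b] `\` E) x -> T1 phi -> upper_value v phi x < +oo)].

Definition upper_dist_integral : \bar R := ereal_inf
  [set beta%:E | beta in
    [set beta | exists u U, major_pair u U /\ point_value U b beta]].

Definition lower_dist_integral : \bar R := ereal_sup
  [set beta%:E | beta in
    [set beta | exists v V, minor_pair v V /\ point_value V b beta]].

Definition dist_integrable :=
  [/\ exists u U, major_pair u U, exists v V, minor_pair v V &
      lower_dist_integral = upper_dist_integral].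

(* Meaningful when f is distributionally integrable. *)
Definition dist_integral : \bar R := upper_dist_integral.

End Integral.

(* Main.v *)
(* Both f and -f are compared with a Borel representative g of f, so only the
   upper integral matters. It is at most the Lebesgue integral because
   h = max(g, -M), being bounded below, yields a major pair (h, primitive of h):
   at a Lebesgue point of h the lower value of h is at least h.

   Conversely, let (u, U) be a major pair and add to U the primitive W_0 of
   -min(g, M) + psi + e, where psi >= 0 has small integral and its means tend to
   +oo on the null set of exceptional points. The lower values of W = U + W_0 for
   the kernel [hat] are then positive off a countable set, and it remains to see
   that such a W is increasing, which gives the bound on U(b).

   Monotonicity: at every point the existence of the value of W bounds its means
   along [bump] nearby (gliding hump). On the open set omega where these means are
   locally uniformly bounded, W is a bounded function w, and F = int w satisfies
   F' = w; if w(p) > w(q) for some p < q, then for almost every slope lam between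
   them F - lam id has a maximum off the countable set, where the derivative in t
   of the mean of F along [bump], a positive multiple of t <W', hat>, forces these
   means to exceed F. So the values of W increase on each component of omega. By
   Baire's theorem the means are uniformly bounded on a portion of the complement
   of omega, hence, by monotonicity on the gaps, on a whole interval meeting it,
   so that this complement is empty. *)
Require Import Defs.
From HB Require Import structures.
From mathcomp Require Import all_boot all_order all_algebra.
From mathcomp Require Import all_classical all_reals all_analysis.
From mathcomp Require Import measurable_realfun ring lra.

Import Order.TTheory GRing.Theory Num.Theory.
Import numFieldNormedType.Exports.

Local Open Scope ring_scope.
Local Open Scope classical_set_scope.

(** * Smooth functions and kernels *)

(** Positivity of a lower value is only a statement about a lower limit, at points off a countable
    set, for a distribution that is not known to be a function. Passing to a primitive F repairs
    this: where the means of W are bounded, F has the value of W as derivative at every point, not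
    just almost everywhere, so F can be tested at a maximum. The countable set is avoided because W
    takes only countably many values on it, while an interior maximum of F - lam id occurs where W
    has the value lam. The two kernels are tied together for this test: the derivative in t of the
    mean of F(c + t y) against [bump] is the mean of W against y bump(y), and [hat] is, up to a
    positive factor, the antiderivative of - y bump(y). A point value gives convergence for one test
    function at a time. The gliding hump makes it uniform over shifts of the kernel by at most its
    scale, and such shifts are what the Baire step consumes: a mean centred near a point of the
    closed set is a shifted mean at that point. On the exceptional null set only finiteness of the
    lower values is known, off a countable set; this is why the means of psi must diverge there. *)

Section SmoothFunctions.
Context {R : realType}.
Implicit Types (f g : R -> R) (m : nat) (x : R).

Lemma is_deriveP f x d : is_derive x (1 : R) f d -> derivable f x 1 /\ f^`() x = d.
Proof. by move=> [fx fd]; split; [exact: fx|rewrite derive1E]. Qed.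

Lemma derivable_is_derive1 f x : derivable f x 1 -> is_derive x (1 : R) f (f^`() x).
Proof. by move=> fx; split; [exact: fx|rewrite derive1E]. Qed.

Lemma derive_fcomp f g x a b : is_derive (g x) (1 : R) f a ->
  is_derive x (1 : R) g b -> is_derive x (1 : R) (fun y => f (g y)) (a * b).
Proof. by move=> df dg; exact: (is_derive1_comp df dg). Qed.

Lemma derive_fM f g x a b : is_derive x (1 : R) f a -> is_derive x (1 : R) g b ->
  is_derive x (1 : R) (fun y => f y * g y) (f x * b + g x * a).
Proof. by move=> df dg; exact: (is_deriveM df dg). Qed.

Lemma derive_fD f g x a b : is_derive x (1 : R) f a -> is_derive x (1 : R) g b ->
  is_derive x (1 : R) (fun y => f y + g y) (a + b).
Proof. by move=> df dg; exact: (is_deriveD df dg). Qed.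

Lemma derive_fN f x a : is_derive x (1 : R) f a ->
  is_derive x (1 : R) (fun y => - f y) (- a).
Proof. by move=> df; exact: (is_deriveN df). Qed.

Lemma derive_fZ f x a c : is_derive x (1 : R) f a ->
  is_derive x (1 : R) (fun y => c * f y) (c * a).
Proof. by move=> df; exact: (is_deriveZ c df). Qed.

(** Smoothness and all the derivatives come out together once a candidate sequence is at hand;
    dilations, series and convolutions are all differentiated in this way. *)
Lemma smooth_seq (D : nat -> R -> R) :
  (forall m x, is_derive x (1 : R) (D m) (D m.+1 x)) ->
  smooth (D 0%N) /\ forall m, (D 0%N)^`(m) = D m.
Proof.
move=> DD; have E m : (D 0%N)^`(m) = D m.
  elim: m => [|m IH]; first by rewrite derive1n0.
  by rewrite derive1nS IH; apply/funext => x; case: (is_deriveP _ _ _ (DD m x)).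
by split=> // m x; rewrite E; case: (DD m x).
Qed.

Lemma smooth_is_derive f m x : smooth f -> is_derive x (1 : R) f^`(m) (f^`(m.+1) x).
Proof. by move=> sf; rewrite derive1nS; exact/derivable_is_derive1/sf. Qed.

(** Differentiability peeled from the inside: [f] first, then the same condition on its derivative.
    Product, chain and quotient rules then go by induction on [m]. *)
Fixpoint ders m f : Prop :=
  (forall x, derivable f x 1) /\ if m is m'.+1 then ders m' f^`() else True.

Lemma smooth_ders f : smooth f <-> forall m, ders m f.
Proof.
split=> [sf m|sf m].
  elim: m f sf => [|m IH] f sf; first by split=> // x; have := sf 0%N x; rewrite derive1n0.
  split=> [x|]; first by have := sf 0%N x; rewrite derive1n0.
  by apply: IH => k x; rewrite -derive1Sn.
elim: m f {sf}(sf m) => [|m IH] f [df dsf] x; first by rewrite derive1n0.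
by rewrite derive1Sn; apply: IH.
Qed.

Lemma ders_weak m f : ders m.+1 f -> ders m f.
Proof.
elim: m f => [|m IH] f [df dsf]; first by split.
by split; [exact: df|exact: IH].
Qed.

Lemma dersD m f g : ders m f -> ders m g -> ders m (fun x => f x + g x).
Proof.
have D f' g' x : derivable f' x 1 -> derivable g' x 1 ->
    derivable (fun x : R => f' x + g' x : R) x 1.
  by move=> df dg; exact: (derivableD df dg).
elim: m f g => [|m IH] f g [df sf] [dg sg].
  by split=> [x|//]; apply: D; [exact: df|exact: dg].
split=> [x|]; first by apply: D; [exact: df|exact: dg].
rewrite (_ : derive1 _ = fun x => derive1 f x + derive1 g x); first exact: IH.
apply/funext => x.
by have := is_deriveD (derivable_is_derive1 _ _ (df x)) (derivable_is_derive1 _ _ (dg x)) => /is_deriveP[].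
Qed.

Lemma dersM m f g : ders m f -> ders m g -> ders m (fun x => f x * g x).
Proof.
elim: m f g => [|m IH] f g df dg.
  by split=> [x|//]; apply: derivableM; [case: df|case: dg].
have [df0 df1] := df; have [dg0 dg1] := dg.
split=> [x|]; first exact: derivableM.
rewrite (_ : derive1 _ = fun x => f x * derive1 g x + g x * derive1 f x).
  by apply: dersD; apply: IH => //; exact: ders_weak.
apply/funext => x.
by have := is_deriveM (derivable_is_derive1 _ _ (df0 x)) (derivable_is_derive1 _ _ (dg0 x)) => /is_deriveP[].
Qed.

Lemma ders_cst m (c : R) : ders m (cst c).
Proof.
elim: m c => [|m IH] c; split=> //.
rewrite (_ : derive1 _ = cst (0 : R))//; apply/funext => x.
by have [] := is_deriveP _ _ _ (is_derive_cst c x 1).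
Qed.

Lemma ders_comp m f g : ders m f -> ders m g -> ders m (f \o g).
Proof.
elim: m f g => [|m IH] f g df dg.
  split=> // x; have [{}df _] := df; have [{}dg _] := dg.
  by have [] := is_derive1_comp (derivable_is_derive1 _ _ (df (g x)))
    (derivable_is_derive1 _ _ (dg x)).
have [df0 df1] := df; have [dg0 dg1] := dg.
have H x := is_deriveP _ _ _ (is_derive1_comp (derivable_is_derive1 _ _ (df0 (g x)))
    (derivable_is_derive1 _ _ (dg0 x))).
split=> [x|]; first by have [] := H x.
rewrite (_ : derive1 _ = fun x => (derive1 f \o g) x * derive1 g x).
  by apply: dersM => //; apply: IH => //; exact: ders_weak.
by apply/funext => x; have [] := H x.
Qed.

Lemma dersV m f : (forall x, f x != 0) -> ders m f -> ders m (fun x => (f x)^-1).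
Proof.
move=> f0; elim: m => [|m IH] df.
  by split=> // x; apply: derivableV => //; case: df.
have [df0 df1] := df.
have H x := is_deriveP _ _ _ (is_deriveV (f0 x) (derivable_is_derive1 _ _ (df0 x))).
split=> [x|]; first by have [] := H x.
rewrite (_ : derive1 _ = fun x => (- 1 * derive1 f x) * ((f x)^-1 * (f x)^-1)).
  apply: dersM; first by apply: dersM => //; exact: ders_cst.
  by apply: dersM; apply: IH; exact: ders_weak.
apply/funext => x; have [_ ->] := H x.
by rewrite /GRing.scale/= expr2; field.
Qed.

Lemma smoothD f g : smooth f -> smooth g -> smooth (fun x => f x + g x).
Proof. by move=> /smooth_ders sf /smooth_ders sg; apply/smooth_ders => m; exact: dersD. Qed.

Lemma smoothM f g : smooth f -> smooth g -> smooth (fun x => f x * g x).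
Proof. by move=> /smooth_ders sf /smooth_ders sg; apply/smooth_ders => m; exact: dersM. Qed.

Lemma smooth_comp f g : smooth f -> smooth g -> smooth (f \o g).
Proof. by move=> /smooth_ders sf /smooth_ders sg; apply/smooth_ders => m; exact: ders_comp. Qed.

Lemma smoothV f : (forall x, f x != 0) -> smooth f -> smooth (fun x => (f x)^-1).
Proof. by move=> f0 /smooth_ders sf; apply/smooth_ders => m; exact: dersV. Qed.

Lemma smooth_cst (c : R) : smooth (cst c).
Proof. by apply/smooth_ders => m; exact: ders_cst. Qed.

Lemma smooth_id : smooth (@id R).
Proof.
apply/smooth_ders => -[|m]; split=> //.
rewrite (_ : derive1 _ = cst (1 : R)); first exact: ders_cst.
by apply/funext => x; have [] := is_deriveP _ _ _ (is_derive_id x (1 : R)).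
Qed.

Lemma smooth_derive1 f : smooth f -> smooth f^`().
Proof. by move=> sf m x; rewrite -derive1Sn; exact: sf. Qed.

Lemma smooth_continuous f : smooth f -> continuous f.
Proof.
move=> sf x; apply/differentiable_continuous/derivable1_diffP.
by have := sf 0%N x; rewrite derive1n0.
Qed.

End SmoothFunctions.

(** * Flat functions and smooth cutoffs *)

Section ExpBump.
Context {R : realType}.
Implicit Types (P : {poly R}) (x u : R).

(** The polynomial is a parameter because the functions P(1/x) exp(-1/x) are stable under
    differentiation: [P] becomes X^2 (P - P'). *)
Definition exp_inv P x : R := if 0 < x then P.[x^-1] * expR (- x^-1) else 0.

(** Since exp u is the n-th power of exp (u / n), it is enough that exp (u / n) >= u / n. *)
Lemma monomial_expR (n : nat) u : 0 <= u -> u ^+ n * expR (- u) <= (n%:R ^+ n).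
Proof.
move=> u0; case: n => [|n]; first by rewrite !expr0 mul1r -expR0 ler_expR oppr_le0.
rewrite expRN ler_pdivrMr ?expR_gt0//.
have -> : expR u = expR (u / n.+1%:R) ^+ n.+1.
  by rewrite -expRM_natr divfK.
rewrite -exprMn; apply: lerXn2r; rewrite ?nnegrE ?mulr_ge0 ?expR_ge0//.
rewrite mulrC -ler_pdivrMr//.
by apply: (le_trans _ (expR_ge1Dx _)); rewrite lerDr.
Qed.

Lemma poly_expR_bounded P : exists C, forall u, 0 <= u -> `|P.[u]| * expR (- u) <= C.
Proof.
exists (\sum_(i < size P) `|P`_i| * (i%:R ^+ i)) => u u0.
rewrite horner_coef.
apply: (@le_trans _ _ ((\sum_(i < size P) `|P`_i * u ^+ i|) * expR (- u))).
  by rewrite ler_wpM2r ?expR_ge0// ler_norm_sum.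
rewrite mulr_suml; apply: ler_sum => i _.
rewrite normrM -mulrA ler_wpM2l//.
by rewrite ger0_norm ?exprn_ge0//; exact: monomial_expR.
Qed.

(** This is the boundedness of u^2 P(u) exp(-u) at u = 1/x; the square makes the difference quotient
    at 0 tend to 0. *)
Lemma exp_inv_small P : exists C, forall x, `|exp_inv P x| <= C * x ^+ 2.
Proof.
have [C HC] := poly_expR_bounded (P * 'X^2).
have C0 : 0 <= C by apply: le_trans (HC 0 (lexx _)); rewrite mulr_ge0 ?expR_ge0.
exists C => x; rewrite /exp_inv; case: ifPn => x0; last first.
  by rewrite normr0 mulr_ge0// sqr_ge0.
have := HC x^-1; rewrite invr_ge0 => /(_ (ltW x0)).
rewrite hornerM hornerXn [`|_ * expR _|]normrM (ger0_norm (expR_ge0 _)) => H.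
rewrite -ler_pdivrMr ?exprn_gt0//; apply: le_trans H.
rewrite normrM (ger0_norm (_ : 0 <= x^-1 ^+ 2)) ?exprVn ?invr_ge0 ?exprn_ge0 ?(ltW x0)//.
by rewrite [leRHS]mulrAC.
Qed.

Lemma is_derive_exp_inv P x :
  is_derive x (1 : R) (exp_inv P) (exp_inv ('X^2 * (P - P^`())) x).
Proof.
have [x0|x0|->] := ltgtP x 0.
- rewrite {2}/exp_inv ltNge (ltW x0)/=.
  apply: (@near_eq_is_derive _ _ _ (cst (0 : R))).
  near=> y; rewrite /exp_inv ifF//; apply/negbTE; rewrite -leNgt ltW//.
  by near: y; exact: lt_nbhsl.
- rewrite {2}/exp_inv x0.
  apply: (@near_eq_is_derive R R R (fun y : R => P.[y^-1] * expR (- y^-1) : R)).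
    near=> y; rewrite /exp_inv ifT//.
    by near: y; exact: lt_nbhsr.
  have xn0 : x != 0 by rewrite gt_eqF.
  have dV : is_derive x (1 : R) (fun y : R => y^-1) (- x ^- 2).
    have := @is_deriveV R id x 1 1 xn0 _; rewrite /GRing.scale/= mulr1; exact.
  have d1 := derive_fcomp (horner P) (fun y : R => y^-1) x _ _ (is_derive_poly P x^-1) dV.
  have d2 := derive_fcomp expR (fun y : R => - y^-1) x _ _ (is_derive_expR (- x^-1)) (derive_fN _ _ _ dV).
  have := derive_fM _ _ _ _ _ d1 d2.
  move=> /is_derive_eq; apply.
  rewrite hornerM hornerXn hornerD hornerN opprK exprVn.
  by field.
- rewrite {2}/exp_inv ltxx.
  have [C HC] := exp_inv_small P.
  have C0 : 0 <= C by have := HC 1; rewrite expr1n mulr1; exact: le_trans.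
  have H : (fun h : R => h^-1 *: (exp_inv P (h + 0) - exp_inv P 0)) @ 0^' --> (0 : R).
    apply/cvgr0Pnorm_le => e e0; near=> h.
    rewrite addr0 {2}/exp_inv ltxx subr0 /GRing.scale/= normrM normfV.
    have h0 : 0 < `|h| by rewrite normr_gt0; near: h; exact: nbhs_dnbhs_neq.
    rewrite mulrC ler_pdivrMr//; apply: (le_trans (HC h)).
    rewrite -real_normK ?num_real// expr2 mulrA ler_pM2r//.
    have : `|h| <= e / (C + 1).
      near: h; apply: dnbhs0_le; apply: divr_gt0 => //; exact: ltr_wpDl.
    rewrite ler_pdivlMr ?ltr_wpDl// mulrDr mulr1 => /(le_trans _); apply.
    by rewrite mulrC lerDl.
  have D : derivable (exp_inv P) 0 1.
    apply/cvg_ex; exists 0; under eq_fun do rewrite scaler1; exact: H.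
  split=> //; rewrite -derive1E /derive1; exact/cvg_lim.
Unshelve. all: by end_near. Qed.

Lemma smooth_exp_inv P : smooth (exp_inv P).
Proof.
pose Q (m : nat) := iter m (fun P : {poly R} => 'X^2 * (P - P^`())) P.
have [] // := smooth_seq (fun m => exp_inv (Q m)).
by move=> m x; exact: is_derive_exp_inv.
Qed.

Lemma exp_inv1_ge0 x : 0 <= exp_inv 1 x.
Proof. by rewrite /exp_inv hornerE mul1r; case: ifP => // _; exact: expR_ge0. Qed.

Lemma exp_inv1_gt0 x : 0 < x -> 0 < exp_inv 1 x.
Proof. by rewrite /exp_inv hornerE mul1r => ->; exact: expR_gt0. Qed.

Lemma exp_inv_le0 P x : x <= 0 -> exp_inv P x = 0.
Proof. by rewrite /exp_inv ltNge => ->. Qed.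

Lemma exp_invX2_ge0 x : 0 <= exp_inv 'X^2 x.
Proof.
by rewrite /exp_inv hornerXn; case: ifP => // _; rewrite mulr_ge0 ?expR_ge0 ?sqr_ge0.
Qed.

Lemma exp_invX2_gt0 x : 0 < x -> 0 < exp_inv 'X^2 x.
Proof.
by rewrite /exp_inv hornerXn => x0; rewrite x0 mulr_gt0 ?expR_gt0// exprn_gt0// invr_gt0.
Qed.

(** A quotient e(u) / (e(u) + e(v)) with u + v = 1: one of the two arguments is positive, so the
    denominator never vanishes. *)
Definition plateau (r x : R) : R :=
  exp_inv 1 (r + 1 - x * x) / (exp_inv 1 (r + 1 - x * x) + exp_inv 1 (x * x - r)).

Lemma smooth_plateau r : smooth (plateau r).
Proof.
have sq : smooth (fun x : R => x * x) by apply: smoothM; exact: smooth_id.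
have s1 : smooth (fun x : R => exp_inv 1 (r + 1 - x * x)).
  apply: (smooth_comp (exp_inv 1) (fun x : R => r + 1 - x * x)); first exact: smooth_exp_inv.
  apply: (smoothD (cst (r + 1)) (fun x => - (x * x))); first exact: smooth_cst.
  rewrite (_ : (fun x : R => - _) = fun x => - 1 * (x * x)); last by apply/funext=> x; rewrite mulN1r.
  exact: (smoothM (cst (- 1)) _ (smooth_cst _) sq).
have s2 : smooth (fun x : R => exp_inv 1 (x * x - r)).
  apply: (smooth_comp (exp_inv 1) (fun x : R => x * x - r)); first exact: smooth_exp_inv.
  exact: (smoothD _ (cst (- r)) sq (smooth_cst _)).
apply: (smoothM _ _ s1); apply: smoothV; last exact: (smoothD _ _ s1 s2).
move=> x; rewrite gt_eqF//.
have [h|h] := ltP 0 (r + 1 - x * x).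
  by rewrite ltr_pwDl ?exp_inv1_gt0 ?exp_inv1_ge0.
by rewrite ltr_pwDr ?exp_inv1_ge0// exp_inv1_gt0//; lra.
Qed.

Lemma plateau_eq1 r x : x * x <= r -> plateau r x = 1.
Proof.
move=> h; rewrite /plateau (exp_inv_le0 _ (x * x - r)) ?subr_le0// addr0 divff// gt_eqF//.
by apply: exp_inv1_gt0; lra.
Qed.

Lemma plateau_eq0 r x : r + 1 <= x * x -> plateau r x = 0.
Proof. by move=> h; rewrite /plateau exp_inv_le0 ?mul0r// subr_le0. Qed.

Lemma plateau_itv r x : 0 <= plateau r x <= 1.
Proof.
have a := exp_inv1_ge0 (r + 1 - x * x); have b := exp_inv1_ge0 (x * x - r).
rewrite /plateau divr_ge0 ?addr_ge0//=.
have [->|n0] := eqVneq (exp_inv 1 (r + 1 - x * x) + exp_inv 1 (x * x - r)) 0.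
  by rewrite invr0 mulr0.
by rewrite ler_pdivrMr ?mul1r ?lerDl// lt_neqAle eq_sym n0 addr_ge0.
Qed.

End ExpBump.

Notation mu := (@lebesgue_measure _).
Notation Lebesgue_integrable f := (lebesgue_measure.-integrable setT (EFin \o f)).

(** * Test functions, their derivatives and dilations *)

Section TestFunctions.
Context {R : realType}.
Implicit Types (f g phi chi : R -> R) (m : nat) (r s t x : R).

(** Bounded support expressed by vanishing, which passes to derivatives, dilations and convolutions
    without taking closures. *)
Definition csupp r f := forall x, r < `|x| -> f x = 0.

Definition dil chi x t := fun z : R => chi ((z - x) / t).

Lemma test_csupp phi : test_function phi -> exists2 r, 0 < r & csupp r phi.
Proof.
move=> [_ /compact_bounded[M [Mr HM]]].
exists (Num.max 1 (M + 1)); first by rewrite lt_max ltr01.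
move=> x; rewrite gt_max => /andP[_ Mx]; apply: contraTeq Mx => p0.
rewrite -leNgt; apply: (HM (M + 1)); first by rewrite ltrDl.
exact: subset_closure.
Qed.

Lemma csupp_fsupport r phi : csupp r phi -> fsupport phi `<=` `[- r, r].
Proof.
move=> cf; rewrite /fsupport closureE => x; apply.
split; first exact: itv_closed.
move=> y /= py; rewrite in_itv/= -ler_norml leNgt.
by apply: contra py => /cf ->.
Qed.

Lemma csupp_test r phi : smooth phi -> csupp r phi -> test_function phi.
Proof.
move=> sf cf; split; first exact: sf.
apply: (@subclosed_compact _ _ `[- r, r]); [exact: closed_closure|exact: segment_compact|].
exact: csupp_fsupport.
Qed.

Lemma test_smooth phi : test_function phi -> smooth phi.
Proof. by case. Qed.

Lemma csupp_derive1 r phi : csupp r phi -> csupp r (derive1 phi).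
Proof.
move=> cf x rx.
have H : is_derive x (1 : R) phi 0.
  apply: (@near_eq_is_derive R R R (cst (0 : R))).
  near=> y; rewrite cf//; near: y.
  have : nbhs `|x| [set u : R | r < u] by exact: lt_nbhsr.
  exact: norm_continuous.
by have [_ ->] := is_deriveP _ _ _ H.
Unshelve. all: by end_near. Qed.

Lemma csupp_derive1n r phi m : csupp r phi -> csupp r (derive1n m phi).
Proof.
move=> cf; elim: m => [|m IH]; first by rewrite derive1n0.
by rewrite derive1nS; exact: csupp_derive1.
Qed.

Lemma test_derive1 phi : test_function phi -> test_function (derive1 phi).
Proof.
move=> tf; have [r _ cf] := test_csupp _ tf.
by apply: (csupp_test r); [exact/smooth_derive1/test_smooth|exact: csupp_derive1].
Qed.

Lemma test_derive1n phi m : test_function phi -> test_function (derive1n m phi).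
Proof.
move=> tf; elim: m => [|m IH]; first by rewrite derive1n0.
by rewrite derive1nS; exact: test_derive1.
Qed.

Lemma test_continuous_fun phi : test_function phi -> continuous phi.
Proof. by move=> /test_smooth/smooth_continuous. Qed.

Lemma csupp_bounded r f : continuous f -> csupp r f -> exists M, forall x, `|f x| <= M.
Proof.
move=> ctf cf.
have /compact_bounded[M [_ HM]] : compact (f @` `[- r, r]).
  apply: continuous_compact; last exact: segment_compact.
  exact: continuous_subspaceT.
exists (`|M| + 1) => x.
have [rx|rx] := ltP r `|x|; first by rewrite cf// normr0.
apply: (HM (`|M| + 1)); first by rewrite (le_lt_trans (ler_norm _))// ltrDl.
by exists x => //=; rewrite in_itv/= -ler_norml.
Qed.

Lemma test_bounded phi : test_function phi -> exists2 M, 0 <= M & forall x, `|phi x| <= M.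
Proof.
move=> tf; have [r _ cf] := test_csupp _ tf.
have [M HM] := csupp_bounded _ _ (test_continuous_fun _ tf) cf.
by exists M => //; apply: le_trans (HM 0).
Qed.

Lemma test_bounded_upto phi (n : nat) : test_function phi ->
  exists2 M, 0 <= M & forall m x, (m <= n)%N -> `|phi^`(m) x| <= M.
Proof.
move=> tf; elim: n => [|n [M M0 HM]].
  have [M M0 HM] := test_bounded _ tf; exists M => // m x.
  by rewrite leqn0 => /eqP ->; rewrite derive1n0.
have [M' M'0 HM'] := test_bounded _ (test_derive1n _ n.+1 tf).
exists (Num.max M M') => [|m x]; first by rewrite le_max M0.
rewrite leq_eqVlt => /predU1P[->|mn]; first by rewrite le_max HM' orbT.
by rewrite le_max HM.
Qed.

Lemma derive1_lipschitz f (M : R) : (forall x, derivable f x 1) ->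
  (forall x, `|derive1 f x| <= M) -> forall x y, `|f x - f y| <= M * `|x - y|.
Proof.
move=> df HM x y; wlog xy : x y / y < x.
  move=> H; have [h|h|->] := ltgtP x y; last by rewrite !subrr normr0 mulr0.
    by rewrite distrC [X in _ <= _ * X]distrC; exact: H.
  exact: H.
have [||c _ ->] := @MVT R f (derive1 f) y x xy.
- by move=> z _; exact: derivable_is_derive1.
- apply: continuous_subspaceT => z.
  exact/differentiable_continuous/derivable1_diffP.
- by rewrite normrM ler_wpM2r.
Qed.

Lemma smooth_affine x t : smooth (fun z : R => (z - x) / t).
Proof.
have a : smooth (fun z : R => z - x) := smoothD id (cst (- x)) smooth_id (smooth_cst _).
exact: (smoothM _ (cst t^-1) a (smooth_cst _)).
Qed.

Lemma smooth_dil chi x t : smooth chi -> smooth (dil chi x t).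
Proof. by move=> sc; exact: (smooth_comp chi _ sc (smooth_affine x t)). Qed.

Lemma derive_affine x t z : is_derive z (1 : R) (fun z : R => (z - x) / t) t^-1.
Proof.
have h : is_derive z (1 : R) (fun z : R => z - x) 1.
  have := derive_fD id (cst (- x)) z 1 0 (is_derive_id z (1 : R)) (is_derive_cst (- x) z (1 : R)).
  by rewrite addr0.
have -> : (fun z : R => (z - x) / t) = (fun z => t^-1 * (z - x)).
  by apply/funext => y; rewrite mulrC.
by have := derive_fZ _ _ _ t^-1 h; rewrite mulr1.
Qed.

Lemma derive1n_dil chi x t m z : smooth chi ->
  derive1n m (dil chi x t) z = t^-1 ^+ m * dil (derive1n m chi) x t z.
Proof.
move=> sc.
have [|_ E] := smooth_seq (fun m z => t^-1 ^+ m * dil (derive1n m chi) x t z).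
  move=> k y.
  have := derive_fZ _ _ _ (t^-1 ^+ k) (derive_fcomp (derive1n k chi) (fun z : R => (z - x) / t) y _ _
    (smooth_is_derive _ k _ sc) (derive_affine x t y)).
  by move=> /is_derive_eq; apply; rewrite exprS /dil; ring.
have <- := congr1 (fun h => h z) (E m); congr (derive1n m _ z).
by apply/funext => y; rewrite expr0 mul1r derive1n0.
Qed.

Lemma csupp_dil r chi x t : t != 0 -> csupp r chi -> csupp (`|x| + r * `|t|) (dil chi x t).
Proof.
move=> t0 cf z h; rewrite /dil cf// normrM normfV ltr_pdivlMr ?normr_gt0//.
by have := ler_normB z x; have := lerB_dist z x; lra.
Qed.

Lemma test_dil chi x t : t != 0 -> test_function chi -> test_function (dil chi x t).
Proof.
move=> t0 tc; have [r _ cr] := test_csupp _ tc.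
by apply: (csupp_test (`|x| + r * `|t|)); [exact/smooth_dil/test_smooth|exact: csupp_dil].
Qed.

Lemma test_shift chi s : test_function chi -> test_function (fun y => chi (y - s)).
Proof.
move=> tc; have := test_dil _ s _ (oner_neq0 R) tc; rewrite /dil.
by under eq_fun do rewrite divr1.
Qed.

Lemma dil_shift chi s x t : t != 0 -> dil (fun y => chi (y - s)) x t = dil chi (x + s * t) t.
Proof. by move=> t0; apply/funext => z; rewrite /dil; congr chi; field. Qed.

Lemma testD phi chi : test_function phi -> test_function chi ->
  test_function (fun x => phi x + chi x).
Proof.
move=> tf tg; have [r _ cr] := test_csupp _ tf; have [s _ cs] := test_csupp _ tg.
apply: (csupp_test (Num.max r s)).
  exact: (smoothD _ _ (test_smooth _ tf) (test_smooth _ tg)).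
by move=> x; rewrite gt_max => /andP[rx sx]; rewrite cr// cs// addr0.
Qed.

Lemma test_mul f phi : smooth f -> test_function phi -> test_function (fun x => f x * phi x).
Proof.
move=> sf tf; have [r _ cr] := test_csupp _ tf; apply: (csupp_test r).
  exact: (smoothM _ _ sf (test_smooth _ tf)).
by move=> x rx; rewrite cr// mulr0.
Qed.

Lemma testZ c phi : test_function phi -> test_function (fun x => c * phi x).
Proof. exact: (test_mul (cst c) _ (smooth_cst c)). Qed.

Lemma test0 : test_function (cst (0 : R)).
Proof. by apply: (csupp_test 0); first exact: smooth_cst. Qed.

Lemma test_plateau r : test_function (plateau r).
Proof.
apply: (csupp_test (`|r| + 1)); first exact: smooth_plateau.
move=> x rx; apply: plateau_eq0.
have h1 : 1 <= `|x| by apply: ltW; apply: le_lt_trans rx; rewrite lerDr.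
have : `|x| * 1 <= `|x| * `|x| by rewrite ler_wpM2l.
have -> : x * x = `|x| * `|x| by rewrite -normrM ger0_norm// -expr2 sqr_ge0.
by have := ler_norm r; lra.
Qed.

End TestFunctions.

(** * Lebesgue integrals and affine changes of variable *)

Section Integrals.
Context {R : realType}.
Implicit Types (f g phi chi : R -> R) (m : nat) (r s t x : R).

Lemma continuous_mfun f : continuous f -> measurable_fun setT f.
Proof. exact: continuous_measurable_fun. Qed.

Lemma integrable_csupp r f M : measurable_fun setT f -> (forall x, `|f x| <= M) ->
  csupp r f -> Lebesgue_integrable f.
Proof.
move=> mf Mf cf.
have := @integrable_indic_itv R (- r) r true false.
move=> /(@integrableZl _ _ _ _ _ measurableT M).
apply: le_integrable => //; first exact/measurable_EFinP.
move=> x _ /=; rewrite lee_fin normrM [X in _ * X]ger0_norm ?indic_ge0//.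
have [rx|rx] := ltP r `|x|; first by rewrite cf// normr0 mulr_ge0// indic_ge0.
rewrite indicE mem_set/=; last by rewrite in_itv/= -ler_norml.
by rewrite mulr1 (le_trans (Mf x))// ler_norm.
Qed.

Lemma test_integrable phi : test_function phi -> Lebesgue_integrable phi.
Proof.
move=> tf; have [r _ cr] := test_csupp _ tf; have [M _ HM] := test_bounded _ tf.
exact: (integrable_csupp r _ M (continuous_mfun _ (test_continuous_fun _ tf)) HM cr).
Qed.

Lemma integrable_mfun f : Lebesgue_integrable f -> measurable_fun setT f.
Proof. by move=> /integrableP[/measurable_EFinP]. Qed.

Lemma integrable_bdd_mul f g M : Lebesgue_integrable f -> measurable_fun setT g ->
  (forall x, `|g x| <= M) -> Lebesgue_integrable (fun x => f x * g x).
Proof.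
move=> fi mg Mg.
have := @integrableZl _ _ _ _ _ measurableT M _ fi.
apply: le_integrable => //.
  apply/measurable_EFinP; exact: measurable_funM (integrable_mfun _ fi) mg.
move=> x _ /=; rewrite lee_fin !normrM mulrC ler_wpM2r//.
by rewrite (le_trans (Mg x))// ler_norm.
Qed.

Lemma integrable_cmul c f : Lebesgue_integrable f -> Lebesgue_integrable (fun x => c * f x).
Proof. exact: integrableZl. Qed.

Lemma integrable_add f g : Lebesgue_integrable f -> Lebesgue_integrable g ->
  Lebesgue_integrable (fun x => f x + g x).
Proof. exact: integrableD. Qed.

Lemma integrable_sub f g : Lebesgue_integrable f -> Lebesgue_integrable g ->
  Lebesgue_integrable (fun x => f x - g x).
Proof. exact: integrableB. Qed.

Lemma measurable_affine x t : measurable_fun setT (fun y : R => (y - x) / t).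
Proof. by apply: continuous_mfun; exact/smooth_continuous/smooth_affine. Qed.

Lemma affine_preimage_itv x t (c d : R) : 0 < t ->
  (fun y : R => (y - x) / t) @^-1` `]c, d] = `](t * c + x), (t * d + x)].
Proof.
move=> t0; apply/seteqP; split=> y/=; rewrite !in_itv/= ltr_pdivlMr// ler_pdivrMr//.
  by move=> /andP[h1 h2]; apply/andP; split; lra.
by move=> /andP[h1 h2]; apply/andP; split; lra.
Qed.

Lemma affine_preimage_itvN x t (c d : R) : t < 0 ->
  (fun y : R => (y - x) / t) @^-1` `]c, d] = `[(t * d + x), (t * c + x)[.
Proof.
move=> t0; apply/seteqP; split=> y/=; rewrite !in_itv/= ltr_ndivlMr// ler_ndivrMr//.
  by move=> /andP[h1 h2]; apply/andP; split; lra.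
by move=> /andP[h1 h2]; apply/andP; split; lra.
Qed.

(** By uniqueness of Lebesgue measure: the image measure divided by |t| has the right value on the
    intervals ]c, d]. Their preimages are open on the left or on the right according to the sign of
    [t], whence the two preceding lemmas. *)
Lemma lebesgue_measure_affine x t (A : set R) : t != 0 -> measurable A ->
  pushforward lebesgue_measure (fun y : R => (y - x) / t : measurableTypeR R) A =
  (`|t|%:E * lebesgue_measure A)%E.
Proof.
move=> t0 mA.
have nt0 : 0 < `|t| by rewrite normr_gt0.
have ma := measurable_affine x t.
pose nu : {measure set (measurableTypeR R) -> \bar R} :=
  mscale (NngNum (ltW (divr_gt0 ltr01 nt0)))
  (pushforward lebesgue_measure (fun y : R => (y - x) / t : measurableTypeR R)).
have H : forall X, ocitv X -> lebesgue_measure X = nu ma X.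
  move=> _ [[c d]/= cd <-].
  rewrite /nu /mscale/= /pushforward lebesgue_measure_itv/= lte_fin.
  have [tp|tn] := ltP 0 t.
    rewrite affine_preimage_itv// lebesgue_measure_itv/= lte_fin ltrD2r ltr_pM2l//.
    case: ifPn => h; rewrite ?mule0// -!EFinB -EFinM; congr EFin.
    by rewrite gtr0_norm//; field.
  have {}tn : t < 0 by rewrite lt_neqAle t0.
  rewrite affine_preimage_itvN// lebesgue_measure_itv/= lte_fin ltrD2r ltr_nM2l//.
  case: ifPn => h; rewrite ?mule0// -!EFinB -EFinM; congr EFin.
  by rewrite ltr0_norm//; field.
rewrite (lebesgue_measure_unique H)// /nu /mscale/= muleA -EFinM.
by rewrite mulrCA mulfV ?gt_eqF// mulr1 mul1e.
Qed.

Lemma ge0_integral_affine x t (f : R -> \bar R) : t != 0 ->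
  measurable_fun setT f -> (forall y, 0 <= f y)%E ->
  (\int[mu]_y f ((y - x) / t)%R =
   `|t|%:E * \int[mu]_y f y)%E.
Proof.
move=> t0 mf f0.
have ma : measurable_fun setT (fun y : measurableTypeR R => (y - x) / t : measurableTypeR R).
  exact: measurable_affine.
have := @ge0_integral_pushforward _ _ _ _ R _ ma lebesgue_measure setT f measurableT mf (fun y _ => f0 y).
rewrite preimage_setT => <-.
pose nu := mscale (NngNum (normr_ge0 t)) (@lebesgue_measure R).
rewrite (@eq_measure_integral _ _ _ _ nu).
  by rewrite ge0_integral_mscale.
by move=> A mA _; exact: (lebesgue_measure_affine x _ _ t0 mA).
Qed.

Lemma integrable_affine f x t : t != 0 -> Lebesgue_integrable f ->
  Lebesgue_integrable (dil f x t).
Proof.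
move=> t0 /integrableP[mf fi]; apply/integrableP; split.
  apply/measurable_EFinP; apply: measurableT_comp; last exact: measurable_affine.
  exact/measurable_EFinP.
rewrite (@ge0_integral_affine x t (fun y => `|(EFin \o f) y|)%E t0)//.
  by rewrite lte_mul_pinfty// lee_fin.
exact: measurableT_comp.
Qed.

Lemma Rintegral_affine f x t : t != 0 -> Lebesgue_integrable f ->
  \int[mu]_y dil f x t y = `|t| * \int[mu]_y f y.
Proof.
move=> t0 fi; have fi' := integrable_affine _ x _ t0 fi.
have mf : measurable_fun setT (EFin \o f) := measurable_int _ fi.
rewrite /Rintegral integralE [in RHS]integralE.
have P : (\int[mu]_y (fun y => (dil f x t y)%:E)^\+ y = `|t|%:E * \int[mu]_y (fun y => (f y)%:E)^\+ y)%E.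
  rewrite -(ge0_integral_affine x t ((EFin \o f)^\+)%E t0 (measurable_funepos mf) (funepos_ge0 _)).
  by apply: eq_integral => y _; rewrite !funeposE.
have N : (\int[mu]_y (fun y => (dil f x t y)%:E)^\- y = `|t|%:E * \int[mu]_y (fun y => (f y)%:E)^\- y)%E.
  rewrite -(ge0_integral_affine x t ((EFin \o f)^\-)%E t0 (measurable_funeneg mf) (funeneg_ge0 _)).
  by apply: eq_integral => y _; rewrite !funenegE.
rewrite P N.
have fp := integrable_pos_fin_num measurableT fi.
have fn := integrable_neg_fin_num measurableT fi.
by move: fp fn => /fineK <- /fineK <-; rewrite -!EFinM -!EFinB /= mulrBr.
Qed.

End Integrals.

(** * The kernels [bump] and [hat] *)

Section Kernels.
Context {R : realType}.
Implicit Types (x y : R).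

Lemma Rintegral_gt0 (f : R -> R) : test_function f -> (forall x, 0 <= f x) -> 0 < f 0 ->
  0 < \int[mu]_x f x.
Proof.
move=> tf f0 fp.
have [e /= e0 He] : \forall e \near 0^'+, forall x, `|x| < e -> f 0 / 2 < f x.
  have : \forall y \near (0 : R), f 0 / 2 < f y.
    have : nbhs (f 0) [set u : R | f 0 / 2 < u] by apply: lt_nbhsr; lra.
    exact: (test_continuous_fun _ tf 0).
  move=> [d /= d0 Hd]; exists d => //= e /=; rewrite sub0r normrN => ed ep x xe.
  apply: Hd => /=; rewrite sub0r normrN; apply: lt_trans xe _.
  by rewrite (le_lt_trans (ler_norm _)).
have {}He : forall x, `|x| < e / 2 -> f 0 / 2 < f x.
  apply: He; last by rewrite divr_gt0.
  by rewrite /= sub0r normrN gtr0_norm ?divr_gt0//; lra.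
pose A : set R := `[0, e / 4].
apply: (@lt_le_trans _ _ (\int[mu]_x (f 0 / 2 * \1_A x))).
  rewrite RintegralZl//; last exact: integrable_indic_itv.
  rewrite /Rintegral integral_indic//; last exact: measurable_itv.
  have mA : lebesgue_measure A = (e / 4)%:E.
    by rewrite /A lebesgue_measure_itv/= lte_fin ifT ?sube0//; lra.
  rewrite (_ : fine _ = e / 4); first by rewrite !mulr_gt0//; lra.
  by rewrite -[RHS]/(fine (e / 4)%:E) -mA; congr (fine (_ _)); exact: setIT.
apply: le_Rintegral => //.
- by apply: integrable_cmul; exact: integrable_indic_itv.
- exact: test_integrable.
- move=> x _; rewrite indicE; case: (boolP (x \in A)) => xA/=; last by rewrite mulr0.
  move: xA; rewrite inE /A/= in_itv/= => /andP[x0 xe].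
  by rewrite mulr1 ltW// He// ger0_norm//; lra.
Qed.

Let sq x := 1 - x * x.

Lemma smooth_sq : smooth sq.
Proof.
have s2 : smooth (fun x : R => x * x) := smoothM id id smooth_id smooth_id.
apply: (smoothD (cst 1) (fun x => - (x * x)) (smooth_cst _)).
rewrite (_ : (fun x : R => - _) = fun x => cst (- 1) x * (x * x)); last by apply/funext=> x; rewrite mulN1r.
exact: (smoothM (cst (- 1)) _ (smooth_cst _) s2).
Qed.

Lemma test_exp_inv_sq (P : {poly R}) : test_function (fun x => exp_inv P (sq x)).
Proof.
apply: (csupp_test 1); first exact: (smooth_comp (exp_inv P) sq (smooth_exp_inv P) smooth_sq).
move=> x x1; apply: exp_inv_le0; rewrite /sq subr_le0.
have -> : x * x = `|x| * `|x| by rewrite -normrM ger0_norm// -expr2 sqr_ge0.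
by rewrite ltW// mulr_egt1.
Qed.

Lemma csupp_exp_inv_sq (P : {poly R}) : csupp 1 (fun x => exp_inv P (sq x)).
Proof.
move=> x x1; apply: exp_inv_le0; rewrite /sq subr_le0.
have -> : x * x = `|x| * `|x| by rewrite -normrM ger0_norm// -expr2 sqr_ge0.
by rewrite ltW// mulr_egt1.
Qed.

(** The polynomial X^2 is forced: it is what [is_derive_exp_inv] makes of the constant 1, so the
    derivative of [hat0] is -2 y times [bump0]. *)
Let bump0 x := exp_inv 'X^2 (sq x).
Let hat0 x := exp_inv 1 (sq x).
Let Ibump := \int[@lebesgue_measure R]_x bump0 x.
Let Ihat := \int[@lebesgue_measure R]_x hat0 x.

(* [hat] is the kernel in [T1] that tests the lower values, and [bump] the even
   kernel with [hat^`() y = - hat_slope * (y * bump y)]. *)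
Definition bump x := Ibump^-1 * bump0 x.
Definition hat x := Ihat^-1 * hat0 x.
Definition hat_slope := 2 * Ibump / Ihat.

Let Ibump_gt0 : 0 < Ibump.
Proof.
apply: Rintegral_gt0; first exact: test_exp_inv_sq.
  by move=> x; exact: exp_invX2_ge0.
by apply: exp_invX2_gt0; rewrite /sq; lra.
Qed.

Let Ihat_gt0 : 0 < Ihat.
Proof.
apply: Rintegral_gt0; first exact: test_exp_inv_sq.
  by move=> x; exact: exp_inv1_ge0.
by apply: exp_inv1_gt0; rewrite /sq; lra.
Qed.

Lemma hat_slope_gt0 : 0 < hat_slope.
Proof. by rewrite divr_gt0// mulr_gt0. Qed.

Lemma test_bump : test_function bump.
Proof. exact: (testZ _ _ (test_exp_inv_sq _)). Qed.

Lemma test_hat : test_function hat.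
Proof. exact: (testZ _ _ (test_exp_inv_sq _)). Qed.

Lemma csupp_bump : csupp 1 bump.
Proof. by move=> x /(csupp_exp_inv_sq 'X^2); rewrite /bump /bump0 => ->; rewrite mulr0. Qed.

Lemma csupp_hat : csupp 1 hat.
Proof. by move=> x /(csupp_exp_inv_sq 1); rewrite /hat /hat0 => ->; rewrite mulr0. Qed.

Lemma bump_ge0 x : 0 <= bump x.
Proof. by rewrite mulr_ge0 ?invr_ge0 ?(ltW Ibump_gt0)// exp_invX2_ge0. Qed.

Lemma hat_ge0 x : 0 <= hat x.
Proof. by rewrite mulr_ge0 ?invr_ge0 ?(ltW Ihat_gt0)// exp_inv1_ge0. Qed.

Lemma bump_even x : bump (- x) = bump x.
Proof. by rewrite /bump /bump0 /sq mulrNN. Qed.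

Lemma Rintegral_bump : \int[mu]_x bump x = 1.
Proof.
rewrite /bump RintegralZl//; last exact/test_integrable/test_exp_inv_sq.
by rewrite mulVf// gt_eqF.
Qed.

Lemma Rintegral_hat : \int[mu]_x hat x = 1.
Proof.
rewrite /hat RintegralZl//; last exact/test_integrable/test_exp_inv_sq.
by rewrite mulVf// gt_eqF.
Qed.

Lemma derive1_hat y : derive1 hat y = - hat_slope * (y * bump y).
Proof.
have dsq : is_derive y (1 : R) sq (- 2 * y).
  have := derive_fD (cst 1) _ y _ _ (is_derive_cst (1 : R) y (1 : R))
    (derive_fN _ _ _ (derive_fM id id y _ _ (is_derive_id y (1 : R)) (is_derive_id y (1 : R)))).
  by move=> /is_derive_eq; apply; rewrite /=; ring.
have de := is_derive_exp_inv 1 (sq y).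
have := derive_fZ _ _ _ Ihat^-1 (derive_fcomp (exp_inv 1) sq y _ _ de dsq).
move=> /is_deriveP[_ ->].
rewrite -[1%R in LHS]/(1%:P) derivC subr0 mulr1 /hat_slope /bump /bump0.
by field; rewrite !gt_eqF.
Qed.

Lemma T1_hat : T1 hat.
Proof.
split; last first.
  move=> x; rewrite derive1_hat mulNr mulrN oppr_le0.
  rewrite (_ : _ * _ = hat_slope * (x * x) * bump x); last by ring.
  by rewrite mulr_ge0 ?bump_ge0// mulr_ge0 ?(ltW hat_slope_gt0)// -expr2 sqr_ge0.
split; [exact/test_smooth/test_hat|exact: hat_ge0| |].
  rewrite -[LHS]fineK; first by congr EFin; exact: Rintegral_hat.
  exact: (integrable_fin_num measurableT (test_integrable _ test_hat)).
(* All derivatives of [hat] vanish for |x| > 1, so any exponent below -1 serves. *)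
exists (- 2); first by lra.
move=> m; apply/eqO_exP; exists 1 => //; exists 1 => x x1 /=.
by rewrite (csupp_derive1n _ _ m csupp_hat)// normr0 mulr_ge0.
Qed.

Lemma Rintegral_dil_bump x t : t != 0 -> \int[mu]_y dil bump x t y = `|t|.
Proof.
move=> t0; rewrite Rintegral_affine ?Rintegral_bump ?mulr1//.
exact: (test_integrable _ test_bump).
Qed.

End Kernels.

Lemma rescaleE {R : realType} (W : @functional R) x t chi :
  rescale W x t chi = `|t|^-1 * W (dil chi x t).
Proof. by []. Qed.

(** * Uniform boundedness of the means of a distribution *)

Section DistributionBasics.
Context {R : realType}.
Variable W : @functional R.
Hypothesis linW : test_linear W.
Hypothesis contW : test_continuous W.
Implicit Types (phi chi : R -> R) (x y s t r : R) (m n : nat).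

Lemma distr0 : W (cst 0) = 0.
Proof.
have := linW 1 (cst 0) (cst 0) test0 test0; rewrite mul1r.
rewrite (_ : (fun _ => _) = cst 0); last by apply/funext => x; rewrite mulr0 addr0.
by move=> h; have : W (cst 0) - W (cst 0) = W (cst 0); [rewrite {1}h addrK|rewrite subrr].
Qed.

Lemma distrD phi chi : test_function phi -> test_function chi ->
  W (fun x => phi x + chi x) = W phi + W chi.
Proof.
move=> tf tc; have := linW 1 _ _ tf tc; rewrite mul1r => <-.
by congr W; apply/funext => x; rewrite mul1r.
Qed.

Lemma distrZ c phi : test_function phi -> W (fun x => c * phi x) = c * W phi.
Proof.
move=> tf; have := linW c _ _ tf test0; rewrite distr0 addr0 => <-.
by congr W; apply/funext => x; rewrite addr0.
Qed.

Lemma distrB phi chi : test_function phi -> test_function chi ->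
  W (fun x => phi x - chi x) = W phi - W chi.
Proof.
move=> tf tc; rewrite -mulN1r -distrZ// -distrD//; last exact: testZ.
by congr W; apply/funext => x; rewrite mulN1r.
Qed.

Lemma testB phi chi : test_function phi -> test_function chi ->
  test_function (fun x => phi x - chi x).
Proof.
move=> tf tc; rewrite (_ : (fun _ => _) = fun x => phi x + (- 1) * chi x).
  by apply: testD => //; exact: testZ.
by apply/funext => x; rewrite mulN1r.
Qed.

Lemma derive1nB m phi chi x : smooth phi -> smooth chi ->
  derive1n m (fun x => phi x - chi x) x = derive1n m phi x - derive1n m chi x.
Proof.
move=> sf sc; have [|_ E] := smooth_seq (fun m x => derive1n m phi x - derive1n m chi x).
  move=> k y; exact: (derive_fD _ _ y _ _ (smooth_is_derive _ k y sf)
    (derive_fN _ _ _ (smooth_is_derive _ k y sc))).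
have <- := congr1 (fun h => h x) (E m); congr (derive1n m _ x).
Qed.

Lemma derive1nZ m c phi x : smooth phi ->
  derive1n m (fun x => c * phi x) x = c * derive1n m phi x.
Proof.
move=> sf; have [|_ E] := smooth_seq (fun m x => c * derive1n m phi x).
  move=> k y; exact: (derive_fZ _ y _ c (smooth_is_derive _ k y sf)).
exact: (congr1 (fun h => h x) (E m)).
Qed.

Lemma derive1n_shift m phi s x : smooth phi ->
  derive1n m (fun y => phi (y - s)) x = derive1n m phi (x - s).
Proof.
move=> sf; have -> : (fun y => phi (y - s)) = dil phi s 1.
  by apply/funext => y; rewrite /dil divr1.
by rewrite derive1n_dil// invr1 expr1n mul1r /dil divr1.
Qed.

(** The sum of suprema in [test_continuous] is traded for one bound [B] on finitely many
    derivatives, so later estimates are pointwise. *)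
Lemma distr_bound r : exists (N : nat) (C : R), 0 <= C /\
  forall chi, smooth chi -> csupp r chi ->
  forall B, (forall m x, (m <= N)%N -> `|derive1n m chi x| <= B) -> `|W chi| <= C * B.
Proof.
have [N [C HC]] := contW `[- r, r] (@segment_compact _ _ _).
exists N, (`|C| * N.+1%:R); split=> [|chi sc cc B HB]; first by rewrite mulr_ge0.
have := HC chi (csupp_test _ _ sc cc) (csupp_fsupport _ _ cc).
move=> /le_trans; apply; apply: (@le_trans _ _ (`|C| * \sum_(m < N.+1) B)).
  apply: (@le_trans _ _ (`|C| * \sum_(m < N.+1) sup (range (fun x => `|derive1n m chi x|)))).
    apply: ler_wpM2r; last exact: ler_norm.
    apply: sumr_ge0 => i _; apply: (@le_trans _ _ `|derive1n i chi 0|) => //.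
    apply: ub_le_sup; last by exists 0.
    by exists B => _ [x _ <-]; exact/HB/ltnSE/ltn_ord.
  rewrite ler_wpM2l//; apply: ler_sum => i _.
  by apply: ge_sup => [|_ [x _ <-]]; [exists `|derive1n i chi 0|, 0|exact/HB/ltnSE/ltn_ord].
by rewrite sumr_const card_ord -[B *+ _]mulr_natl mulrA.
Qed.

(** By the mean value theorem, the derivatives of a difference of two translates cost one derivative
    more than the order [N] of [W]. *)
Lemma distr_dil_lipschitz chi t (r0 : R) : t != 0 -> test_function chi ->
  exists K, 0 <= K /\ forall x y, `|x| <= r0 -> `|y| <= r0 ->
  `|W (dil chi x t) - W (dil chi y t)| <= K * `|x - y|.
Proof.
move=> t0 tc; have [r rp cr] := test_csupp _ tc.
have [N [C [C0 HC]]] := distr_bound (r0 + r * `|t|).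
have [M M0 HM] := test_bounded_upto _ N.+1 tc.
(* The m-th derivative of a dilation carries |t|^-m, and the mean value theorem one more factor; 1 +
   |t^-1| dominates all these powers at once. *)
pose K := M * (1 + `|t^-1|) ^+ N.+1; exists (C * K); split.
  by rewrite mulr_ge0// mulr_ge0// exprn_ge0// addr_ge0.
move=> x y xr yr; have tx := test_dil _ x _ t0 tc; have ty := test_dil _ y _ t0 tc.
rewrite -distrB// -mulrA; apply: HC.
- exact: (test_smooth _ (testB _ _ tx ty)).
- move=> z hz; rewrite (csupp_dil _ _ _ _ t0 cr)// ?(csupp_dil _ _ _ _ t0 cr)// ?subrr//.
    by apply: le_lt_trans hz; rewrite lerD2r.
  by apply: le_lt_trans hz; rewrite lerD2r.
move=> m z mN; rewrite derive1nB; [|exact: test_smooth..].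
rewrite !derive1n_dil; [|exact: test_smooth..].
rewrite -mulrBr normrM normrX.
have H : `|dil (derive1n m chi) x t z - dil (derive1n m chi) y t z| <= M * (`|x - y| * `|t^-1|).
  have df w : derivable (derive1n m chi) w 1 by case: tc => + _; exact.
  have Mf w : `|derive1 (derive1n m chi) w| <= M by rewrite -derive1nS; exact: HM.
  apply: le_trans (derive1_lipschitz _ _ df Mf _ _) _.
  rewrite (_ : (z - x) / t - (z - y) / t = (y - x) / t); last by ring.
  by rewrite normrM distrC.
apply: (@le_trans _ _ (`|t^-1| ^+ m * (M * (`|x - y| * `|t^-1|)))).
  by rewrite ler_wpM2l// exprn_ge0.
rewrite [leLHS](_ : _ = M * `|t^-1| ^+ m.+1 * `|x - y|); last by rewrite exprS; ring.
rewrite ler_wpM2r// ler_wpM2l//.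
apply: (@le_trans _ _ ((1 + `|t^-1|) ^+ m.+1)).
  by apply: lerXn2r; rewrite ?nnegrE ?addr_ge0// lerDr.
by apply: ler_weXn2l => //; rewrite lerDl.
Qed.

Lemma distr_dil_continuous chi t : t != 0 -> test_function chi ->
  continuous (fun x => W (dil chi x t)).
Proof.
move=> t0 tc x; have [K [K0 HK]] := distr_dil_lipschitz _ _ (`|x| + 1) t0 tc.
apply/cvgrPdist_le => /= e e0; near=> y.
apply: le_trans (HK x y _ _) _; first by rewrite lerDl.
  have : `|x - y| <= 1 by near: y; apply: cvgr_dist_le => //; exact: cvg_id.
  have := ler_normB x (x - y); rewrite opprB addrC subrK; lra.
have : `|x - y| <= e / (K + 1).
  near: y; apply: cvgr_dist_le; [exact: cvg_id|by rewrite divr_gt0// ltr_wpDl].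
rewrite ler_pdivlMr ?ltr_wpDl// mulrDr mulr1 => /(le_trans _); apply.
by rewrite mulrC lerDl.
Unshelve. all: by end_near. Qed.

End DistributionBasics.

(** * Series of test functions with geometric coefficients *)

Section GeometricSeries.
Context {R : realType}.
Implicit Types (f : R -> R) (a u : nat -> R) (x : R) (m n : nat).

(** Replaces limit arguments: derivatives of series and of convolutions are all read off a quadratic
    Taylor bound. *)
Lemma is_derive_quadratic f x d K :
  (forall h, `|f (x + h) - f x - h * d| <= K * `|h| ^+ 2) -> is_derive x (1 : R) f d.
Proof.
move=> HK.
have K0 : 0 <= K by have := HK 1; rewrite normr1 expr1n mulr1; exact: le_trans.
have H : (fun h : R => h^-1 *: (f (h + x) - f x)) @ 0^' --> d.
  apply/cvgrPdist_le => e e0; near=> h.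
  have h0 : h != 0 by near: h; exact: nbhs_dnbhs_neq.
  have -> : d - h^-1 *: (f (h + x) - f x) = - (h^-1 * (f (x + h) - f x - h * d)).
    by rewrite /GRing.scale/= [h + x]addrC; field.
  rewrite normrN normrM normfV mulrC ler_pdivrMr ?normr_gt0//.
  apply: le_trans (HK h) _; rewrite expr2 mulrA ler_wpM2r//.
  have : `|h| <= e / (K + 1).
    by near: h; apply: dnbhs0_le; apply: divr_gt0 => //; exact: ltr_wpDl.
  rewrite ler_pdivlMr ?ltr_wpDl// mulrDr mulr1 => /(le_trans _); apply.
  by rewrite mulrC lerDl.
have D : derivable f x 1.
  by apply/cvg_ex; exists d; under eq_fun do rewrite scaler1; exact: H.
by split=> //; rewrite -derive1E /derive1; exact/cvg_lim.
Unshelve. all: by end_near. Qed.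

Lemma derive1_taylor f (M : R) : (forall x, derivable f x 1) ->
  (forall x, derivable (derive1 f) x 1) -> (forall x, `|derive1 (derive1 f) x| <= M) ->
  forall x h, `|f (x + h) - f x - h * derive1 f x| <= M * `|h| ^+ 2.
Proof.
move=> df ddf HM x h.
pose g y := f y - y * derive1 f x.
have dg y : is_derive y (1 : R) g (derive1 f y - derive1 f x).
  have := derive_fD _ _ y _ _ (derivable_is_derive1 _ _ (df y))
    (derive_fN _ _ _ (derive_fZ id y 1 (derive1 f x) (is_derive_id y (1 : R)))).
  rewrite mulr1; congr (is_derive _ _ _ _).
  by apply/funext => z; rewrite /g mulrC.
have -> : f (x + h) - f x - h * derive1 f x = g (x + h) - g x by rewrite /g; ring.
have cg : continuous g.
  by move=> y; apply/differentiable_continuous/derivable1_diffP; case: (dg y).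
have B y : `|derive1 f y - derive1 f x| <= M * `|y - x|.
  exact: derive1_lipschitz.
have M0 : 0 <= M := le_trans (normr_ge0 _) (HM 0).
have cgw (p q : R) : {within `[p, q], continuous g} by exact: continuous_subspaceT.
have dgw (p q y : R) (_ : y \in `]p, q[%R) := dg y.
have [h0|h0] := leP 0 h.
  have xh : x <= x + h by rewrite lerDl.
  have [c cI E] := MVT_segment xh (dgw _ _) (cgw _ _).
  move: cI; rewrite in_itv/= => /andP[c1 c2].
  rewrite E [x + h]addrC addrK normrM expr2 mulrA ler_wpM2r//.
  apply: le_trans (B c) _; rewrite ler_wpM2l// ger0_norm ?subr_ge0// ger0_norm//.
  by rewrite lerBlDl.
have xh : x + h <= x by rewrite gerDl ltW.
have [c cI E] := MVT_segment xh (dgw _ _) (cgw _ _).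
move: cI; rewrite in_itv/= => /andP[c1 c2].
rewrite distrC E opprD addrA subrr sub0r normrM normrN expr2 mulrA ler_wpM2r//.
apply: le_trans (B c) _; rewrite ler_wpM2l// ler0_norm ?subr_le0// ler0_norm ?(ltW h0)//; lra.
Qed.

(** With ratio 1/3, the terms after the n-th weigh at most half of 3^-n. This is what prevents later
    humps from cancelling the n-th one. *)
Lemma geometric3_tail (a u : nat -> R) (M : R) (n N : nat) :
  (forall i, `|a i| <= 3^-1 ^+ i) -> (forall i, (n <= i)%N -> `|u i| <= M) -> 0 <= M ->
  `|\sum_(n <= i < N) a i * u i| <= M * (3 / 2 * 3^-1 ^+ n).
Proof.
move=> ha hu M0.
(* The exact finite geometric sum, so that the induction closes; [maxn] makes the bound 0 on an
   empty range. *)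
have H : `|\sum_(n <= i < N) a i * u i| <= M * (3 / 2 * (3^-1 ^+ n - 3^-1 ^+ (maxn n N))).
  elim: N => [|N IH].
    by rewrite big_geq// normr0 maxn0 subrr !mulr0.
  have [nN|nN] := leqP n N; last first.
    by rewrite big_geq// normr0 (maxn_idPl nN) subrr !mulr0.
  rewrite big_nat_recr//=; apply: le_trans (ler_normD _ _) _.
  move: IH; rewrite (maxn_idPr nN) (maxn_idPr (leqW nN)) => IH.
  have : `|a N * u N| <= M * 3^-1 ^+ N.
    by rewrite normrM mulrC ler_pM//; exact: hu.
  rewrite exprS; move=> h; set p := 3^-1 ^+ N in IH h *; set q := 3^-1 ^+ n in IH *.
  apply: le_trans (lerD IH h) _; lra.
apply: le_trans H _; rewrite ler_wpM2l// ler_wpM2l//.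
by rewrite lerBlDr lerDl exprn_ge0.
Qed.

Lemma geometric3_cvg (a u : nat -> R) (M : R) :
  (forall i, `|a i| <= 3^-1 ^+ i) -> (forall i, `|u i| <= M) ->
  cvg (series (fun i => a i * u i) @ \oo).
Proof.
move=> ha hu; have M0 : 0 <= M := le_trans (normr_ge0 _) (hu 0%N).
apply: normed_cvg; apply: (@series_le_cvg _ _ (geometric M 3^-1)).
- by move=> i; exact: normr_ge0.
- by move=> i; rewrite /geometric/= mulr_ge0// exprn_ge0.
- by move=> i; rewrite /geometric/= normrM mulrC ler_pM.
- by apply: is_cvg_geometric_series; rewrite ger0_norm//; lra.
Qed.

Definition series_lim a u : R := limn (series (fun i => a i * u i)).

Lemma series_lim_tail a u M n : (forall i, `|a i| <= 3^-1 ^+ i) -> (forall i, `|u i| <= M) ->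
  `|series_lim a u - \sum_(0 <= i < n) a i * u i| <= M * (3 / 2 * 3^-1 ^+ n).
Proof.
move=> ha hu; have M0 : 0 <= M := le_trans (normr_ge0 _) (hu 0%N).
have cv := geometric3_cvg _ _ _ ha hu.
have : (`|series (fun i => a i * u i) N - \sum_(0 <= i < n) a i * u i|) @[N --> \oo] -->
   `|series_lim a u - \sum_(0 <= i < n) a i * u i|.
  by apply: cvg_norm; apply: cvgB; [exact: cv|exact: cvg_cst].
move=> /cvgr_to_le; apply.
near=> N; have nN : (n <= N)%N by near: N; exact: nbhs_infty_ge.
rewrite /series/= (big_cat_nat (leq0n n) nN)/= addrAC subrr add0r.
by apply: geometric3_tail.
Unshelve. all: by end_near. Qed.

Lemma series_limB a u v M N : (forall i, `|a i| <= 3^-1 ^+ i) ->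
  (forall i, `|u i| <= M) -> (forall i, `|v i| <= N) ->
  series_lim a (fun i => u i - v i) = series_lim a u - series_lim a v.
Proof.
move=> ha hu hv; apply/cvg_lim => //.
rewrite (_ : series _ = fun n => series (fun i => a i * u i) n - series (fun i => a i * v i) n).
  by apply: cvgB; [exact: geometric3_cvg hu|exact: geometric3_cvg hv].
by apply/funext => n; rewrite /series/= -sumrB; apply: eq_bigr => i _; rewrite mulrBr.
Qed.

Lemma series_limZ a u M h : (forall i, `|a i| <= 3^-1 ^+ i) -> (forall i, `|u i| <= M) ->
  series_lim a (fun i => h * u i) = h * series_lim a u.
Proof.
move=> ha hu; apply/cvg_lim => //.
rewrite (_ : series _ = fun n => h * series (fun i => a i * u i) n).
  by apply: cvgMr; exact: geometric3_cvg hu.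
by apply/funext => n; rewrite /series/= mulr_sumr; apply: eq_bigr => i _; rewrite mulrCA.
Qed.

Variables (psi : nat -> R -> R) (a : nat -> R) (r : R) (M : nat -> R).
Hypothesis spsi : forall i, smooth (psi i).
Hypothesis cpsi : forall i, csupp r (psi i).
Hypothesis Mpsi : forall m i x, `|derive1n m (psi i) x| <= M m.
Hypothesis ha : forall i, `|a i| <= 3^-1 ^+ i.

Definition series_fun x := series_lim a (fun i => psi i x).

(** Termwise differentiation: the Taylor remainders of the terms are at most M (m + 2) h^2 uniformly
    in [i], and the summable coefficients pass this quadratic bound to the sum. *)
Lemma derive1n_series_fun : smooth series_fun /\
  forall m, derive1n m series_fun = fun x => series_lim a (fun i => derive1n m (psi i) x).
Proof.
have [m x|sS E] := smooth_seq (fun m x => series_lim a (fun i => derive1n m (psi i) x)); last first.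
  by split; [exact: sS|exact: E].
apply: (is_derive_quadratic _ _ _ (M m.+2 * (3 / 2 * 3^-1 ^+ 0))) => h.
have Bh i : `|h * derive1n m.+1 (psi i) x| <= `|h| * M m.+1 by rewrite normrM ler_wpM2l.
have B2 i : `|derive1n m (psi i) (x + h) - derive1n m (psi i) x| <= M m + M m.
  by apply: le_trans (ler_normB _ _) _; exact: lerD.
rewrite -(series_limZ _ _ (M m.+1))// -(series_limB _ _ _ (M m) (M m))// -(series_limB _ _ _ _ _ ha B2 Bh).
rewrite mulrAC; set v := fun i => _.
have /(series_lim_tail a v _ 0 ha) : forall i, `|v i| <= M m.+2 * `|h| ^+ 2.
  move=> i; rewrite /v derive1nS; apply: derive1_taylor => y.
  - exact: spsi.
  - by rewrite -derive1nS; exact: spsi.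
  - by rewrite -!derive1nS.
by rewrite big_geq// subr0.
Qed.

Lemma csupp_series_fun : csupp r series_fun.
Proof.
move=> x rx; rewrite /series_fun /series_lim.
rewrite (_ : series _ = cst 0); first exact: lim_cst.
by apply/funext => n; rewrite /series/= big1// => i _; rewrite cpsi// mulr0.
Qed.

Lemma derive1n_partial_sum n :
  smooth (fun x => \sum_(0 <= i < n) a i * psi i x) /\
  forall m, derive1n m (fun x => \sum_(0 <= i < n) a i * psi i x) =
     fun x => \sum_(0 <= i < n) a i * derive1n m (psi i) x.
Proof.
have [m x|sS E] := smooth_seq (fun m x => \sum_(0 <= i < n) a i * derive1n m (psi i) x); last first.
  by split; [exact: sS|exact: E].
elim: n => [|n IH].
  rewrite big_geq//; under eq_fun do rewrite big_geq//.
  exact: (is_derive_cst (0 : R) x (1 : R)).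
rewrite big_nat_recr//=; under eq_fun do rewrite big_nat_recr//=.
exact: (derive_fD _ _ x _ _ IH (derive_fZ _ _ _ (a n) (smooth_is_derive _ m x (spsi n)))).
Qed.

Lemma test_partial_sum n : test_function (fun x => \sum_(0 <= i < n) a i * psi i x).
Proof.
apply: (csupp_test r); first by case: (derive1n_partial_sum n).
by move=> x rx; rewrite big1// => i _; rewrite cpsi// mulr0.
Qed.

Lemma test_series_fun : test_function series_fun.
Proof. by apply: (csupp_test r); [case: derive1n_series_fun|exact: csupp_series_fun]. Qed.

(** The partial sums converge with all their derivatives, supports staying in a fixed interval, so
    the finite order of [W] applies. *)
Lemma distr_series_fun (W : @functional R) : test_linear W -> test_continuous W ->
  W (fun x => \sum_(0 <= i < n) a i * psi i x) @[n --> \oo] --> W series_fun.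
Proof.
move=> linW contW; have [N [C [C0 HC]]] := distr_bound _ contW r.
pose B := \sum_(m < N.+1) M m.
have M0 m : 0 <= M m := le_trans (normr_ge0 _) (Mpsi m 0%N 0).
have B0 : 0 <= B by exact: sumr_ge0.
have key n : `|W series_fun - W (fun x => \sum_(0 <= i < n) a i * psi i x)| <=
    C * (B * (3 / 2 * 3^-1 ^+ n)).
  have [sS ES] := derive1n_series_fun; have [sn En] := derive1n_partial_sum n.
  rewrite -distrB//; [|exact: test_series_fun|exact: test_partial_sum].
  apply: HC => [|x rx|m x mN].
  - exact: (test_smooth _ (testB _ _ test_series_fun (test_partial_sum n))).
  - rewrite csupp_series_fun// big1 ?subrr// => i _; rewrite cpsi// mulr0//.
  - rewrite derive1nB// ES En; apply: le_trans (series_lim_tail _ _ _ _ ha (fun i => Mpsi m i x)) _.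
    rewrite ler_wpM2r ?mulr_ge0 ?exprn_ge0//.
    rewrite /B (bigD1 (Ordinal (mN : (m < N.+1)%N)))//= lerDl.
    exact: sumr_ge0.
have cg : C * (B * (3 / 2 * 3^-1 ^+ n)) @[n --> \oo] --> (0 : R).
  rewrite -(mulr0 C); apply: cvgMr; rewrite -(mulr0 B); apply: cvgMr.
  rewrite -(mulr0 (3 / 2)); apply: cvgMr; apply: cvg_expr.
  by rewrite ger0_norm//; lra.
apply/cvgrPdist_le => e e0; near=> n; apply: le_trans (key n) _.
apply: le_trans (ler_norm _) _.
by near: n; move/cvgr0Pnorm_le : cg; exact.
Unshelve. all: by end_near. Qed.

End GeometricSeries.

(** * The gliding hump *)

Section UniformBoundedness.
Context {R : realType}.
Variable W : @functional R.
Hypothesis linW : test_linear W.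
Hypothesis contW : test_continuous W.
Implicit Types (phi chi : R -> R) (x y s t r : R) (m n : nat).

Let T x t chi := W (dil chi x t).

(* Gliding hump: if the averages along [chi (. - s)] were unbounded, a rapidly
   converging signed sum of such translates would be a test function along which
   [W] has no point value at [x]. *)
Lemma rescale_shift_bounded chi x gamma : test_function chi -> point_value W x gamma ->
  exists n : nat, forall s t, 0 < t -> t * n.+1%:R < 1 -> `|s| <= 1 ->
    `|rescale W (x + s * t) t chi| <= n%:R.
Proof.
move=> tc pv; apply: contrapT => /forallNP H.
pose A s t : R := `|rescale W (x + s * t) t chi|.
(* At the offending scale a shift of maximal mean is taken, by compactness of [-1, 1]; maximality
   later bounds the contribution of all other humps at this scale. *)
have {}H n : exists st : R * R, [/\ 0 < st.2, st.2 * n.+1%:R < 1, `|st.1| <= 1,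
    n%:R < A st.1 st.2 & forall s, `|s| <= 1 -> A s st.2 <= A st.1 st.2].
  have /existsNP[s /existsNP[t /not_implyP[t0 /not_implyP[tn /not_implyP[s1 /negP]]]]] := H n.
  rewrite -ltNge => hn.
  have cA : continuous (fun s => A s t).
    move=> u; apply: cvg_norm; apply: cvgMr.
    have cl : continuous (fun s : R => x + s * t).
      by move=> v; apply: cvgD; [exact: cvg_cst|apply: cvgMl; exact: cvg_id].
    have tn0 : t != 0 by rewrite gt_eqF.
    exact: (continuous_comp (cl u) (distr_dil_continuous _ linW contW chi t tn0 tc (x + u * t))).
  have [|c cI HcI] := @EVT_max R (fun s => A s t) (-1) 1 _ (continuous_subspaceT cA).
    by lra.
  exists (c, t); split=> //=.
  - by move: cI; rewrite in_itv/= -ler_norml.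
  - by apply: lt_le_trans hn _; apply: HcI; rewrite in_itv/= -ler_norml.
  - by move=> u u1; apply: HcI; rewrite in_itv/= -ler_norml.
(* Means above 9^n against coefficients 3^-n: what survives grows like 3^n. *)
have [st Hst] : {st : nat -> R * R & forall n, let k := (9 ^ n)%N in
   [/\ 0 < (st n).2, (st n).2 * k.+1%:R < 1, `|(st n).1| <= 1,
    k%:R < A (st n).1 (st n).2 & forall s, `|s| <= 1 -> A s (st n).2 <= A (st n).1 (st n).2]}.
  exists (fun n => sval (cid (H (9 ^ n)%N))) => n /=.
  by case: cid.
pose psi n := fun y => chi (y - (st n).1).
pose q n := (3^-1 : R) ^+ n.
have q0 n : 0 < q n by rewrite exprn_gt0// invr_gt0.
pose L n phi := rescale W x (st n).2 phi.
have t0 n : 0 < (st n).2 by case: (Hst n).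
have tn0 n : (st n).2 != 0 by rewrite gt_eqF.
have LE n s : L n (fun y => chi (y - s)) = rescale W (x + s * (st n).2) (st n).2 chi.
  by rewrite /L !rescaleE dil_shift.
have tpsi n : test_function (psi n) by exact: test_shift.
(* Of |u + v| and |u - v| at least one is >= |v|; the sign is chosen so that adding the n-th hump
   leaves a mean at least as large as that of the hump itself. *)
pose sgn n phi : R := if `|L n (fun y => phi y + q n * psi n y)| < q n * `|L n (psi n)|
  then -1 else 1.
(* The partial sums come first and the coefficients [a] after them, since each sign depends on the
   sum built so far. *)
pose p := fix p n : R -> R := if n is n'.+1 then
  fun y => p n' y + sgn n' (p n') * q n' * psi n' y else cst 0.
pose a n := sgn n (p n) * q n.
have pE n : p n = fun y => \sum_(0 <= i < n) a i * psi i y.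
  elim: n => [|n IH]; apply/funext => y; first by rewrite big_geq.
  by rewrite big_nat_recr//=; congr (_ + _); rewrite IH.
have ha i : `|a i| <= 3^-1 ^+ i.
  rewrite /a normrM /sgn; case: ifP => _; rewrite ?normrN1 ?normr1 mul1r ger0_norm//; exact: ltW (q0 i).
have [r0 r00 cr0] := test_csupp _ tc.
have cpsi i : csupp (r0 + 1) (psi i).
  move=> y hy; rewrite /psi cr0//; have [_ _ s1 _ _] := Hst i.
  by have := lerB_dist y (st i).1; lra.
have Mex m : {M : R | forall y, `|derive1n m chi y| <= M}.
  by apply: cid; have [M _ HM] := test_bounded _ (test_derive1n _ m tc); exists M.
have dpsi m i y : derive1n m (psi i) y = derive1n m chi (y - (st i).1).
  by rewrite derive1n_shift//; exact: test_smooth.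
pose M m := sval (Mex m).
have Mpsi m i y : `|derive1n m (psi i) y| <= M m.
  by rewrite dpsi /M; case: (Mex m).
have spsi i : smooth (psi i) := test_smooth _ (tpsi i).
have tS := test_series_fun psi a (r0 + 1) M spsi cpsi Mpsi ha.
have tp n : test_function (p n) by rewrite pE; exact: (test_partial_sum psi a (r0 + 1)).
set S := series_fun psi a in tS.
have LD n phi f c : test_function phi -> test_function f ->
    L n (fun y => phi y + c * f y) = L n phi + c * L n f.
  move=> h1 h2; rewrite /L !rescaleE.
  have -> : dil (fun y => phi y + c * f y) x (st n).2 = fun z => dil phi x (st n).2 z + c * dil f x (st n).2 z by [].
  rewrite distrD//; [|exact: test_dil|by apply: testZ; exact: test_dil].
  by rewrite distrZ//; [ring|exact: test_dil].
have big n : q n * `|L n (psi n)| <= `|L n (p n.+1)|.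
  rewrite /= -[fun y => _]/(fun y => p n y + (sgn n (p n) * q n) * psi n y) LD//.
  rewrite /sgn; case: ifPn; rewrite LD//; last by rewrite mul1r -leNgt.
  move=> h; rewrite mulN1r mulNr.
  set u := L n (p n) in h *; set v := q n * L n (psi n) in h *.
  have qv : q n * `|L n (psi n)| = `|v| by rewrite [RHS]normrM (ger0_norm (ltW (q0 n))).
  rewrite qv in h *.
  have : `|v + v| <= `|u + v| + `|u - v|.
    have -> : v + v = (u + v) - (u - v) by ring.
    exact: ler_normB.
  by rewrite -mulr2n normrMn mulr2n; lra.
have cvLp n : L n (p N) @[N --> \oo] --> L n S.
  under eq_fun do rewrite /L rescaleE; rewrite /L rescaleE; apply: cvgMr.
  have cc i : csupp (`|x| + (r0 + 1) * `|(st n).2|) (dil (psi i) x (st n).2) by exact: csupp_dil.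
  have MM m i y : `|derive1n m (dil (psi i) x (st n).2) y| <= `|(st n).2^-1| ^+ m * M m.
    by rewrite derive1n_dil// normrM normrX ler_wpM2l//; exact: Mpsi.
  have := distr_series_fun _ a _ _ (fun i => smooth_dil _ x (st n).2 (spsi i)) cc MM ha W linW contW.
  rewrite (_ : series_fun _ _ = dil S x (st n).2)//.
  apply: cvg_trans; apply: near_eq_cvg; near=> N.
  by congr W; apply/funext => y; rewrite /dil pE.
(* By the maximality of the n-th shift, every later hump has at scale [n] a mean no larger than that
   of [psi n], so the geometric tail costs at most half of the gain. *)
have tail n N : (n.+1 <= N)%N -> `|L n (p N) - L n (p n.+1)| <= q n / 2 * `|L n (psi n)|.
  move=> nN.
  have E : L n (p N) - L n (p n.+1) = \sum_(n.+1 <= i < N) a i * L n (psi i).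
    elim: N nN => // N IH; rewrite ltnS leq_eqVlt => /predU1P[<-|nN].
      by rewrite subrr big_geq.
    rewrite big_nat_recr//= -IH//= -[fun y => _]/(fun y => p N y + a N * psi N y) LD//.
    by rewrite addrAC.
  rewrite E; apply: le_trans (geometric3_tail _ _ `|L n (psi n)| _ _ ha _ (normr_ge0 _)) _.
    move=> i _; have [_ _ _ _ HA] := Hst n; rewrite /psi !LE; apply: HA.
    by case: (Hst i).
  by rewrite exprS /q; lra.
have lower n : q n / 2 * `|L n (psi n)| <= `|L n S|.
  have h : `|L n S - L n (p n.+1)| <= q n / 2 * `|L n (psi n)|.
    have : `|L n (p N) - L n (p n.+1)| @[N --> \oo] --> `|L n S - L n (p n.+1)|.
      by apply: cvg_norm; apply: cvgB; [exact: cvLp|exact: cvg_cst].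
    move=> /cvgr_to_le; apply.
    by exists n.+1 => // N /= nN; exact: tail.
  have := big n; have := lerB_dist (L n (p n.+1)) (L n S); rewrite distrC; lra.
have unb n : 3 ^+ n / 2 <= `|L n S|.
  apply: le_trans (lower n); have [_ _ _ + _] := Hst n.
  rewrite /A -LE -/(psi n) => /ltW h.
  apply: (@le_trans _ _ (q n / 2 * 9 ^+ n)).
    rewrite /q -[9]/((3 * 3)%:R) natrM exprMn mulrA mulrAC -[X in _ <= X * _]mulrA.
    by rewrite mulrAC -exprMn mulVf// expr1n mul1r mulrC.
  by rewrite ler_pM2l ?divr_gt0//; apply: le_trans h; rewrite -natrX.
(* The scales are below 1/(9^n + 1) and tend to 0, so the point value would bound the means of [S]
   that were just seen to grow like 3^n. *)
have := pv _ tS; set l := gamma * _ => /cvgr_norm_le /(_ (`|l| + 1)).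
rewrite ltrDl => /(_ ltr01)[d /= d0 Hd].
near \oo => n.
have : `|L n S| <= `|l| + 1.
  apply: Hd; last exact: tn0.
  rewrite /= sub0r normrN gtr0_norm//.
  have [_ + _ _ _] := Hst n; rewrite -ltr_pdivlMr// => /lt_le_trans; apply.
  rewrite mul1r; apply: (@le_trans _ _ n.+1%:R^-1).
    by rewrite lef_pV2 ?posrE// ler_nat ltnS ltnW// ltn_expl.
  by near: n; have := near_infty_natSinv_lt (PosNum d0); apply: filterS => n /ltW.
rewrite leNgt => /negP; apply.
apply: lt_le_trans (unb n); rewrite ltr_pdivlMr//.
have : (`|l| + 1) * 2 < n%:R by near: n; exact: nbhs_infty_gtr.
move=> /lt_le_trans; apply; rewrite -natrX ler_nat ltnW// ltn_expl//.
Unshelve. all: by end_near. Qed.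

End UniformBoundedness.

(** * Distributions with bounded means *)

Section Convolution.
Context {R : realType}.
Implicit Types (f k phi chi : R -> R) (x y z s t r : R) (m n : nat).

Definition conv k phi z := \int[mu]_s (k s * phi (z - s)).

Lemma Rintegral_cst0 : \int[@lebesgue_measure R]_s cst 0 s = 0 :> R.
Proof. by rewrite /Rintegral integral0. Qed.

Lemma reflect_mfun phi z : continuous phi -> measurable_fun setT (fun s => phi (z - s)).
Proof.
move=> cphi; apply: continuous_mfun => s.
have cl : {for s, continuous (fun s : R => z - s)}.
  by apply: cvgB; [exact: cvg_cst|exact: cvg_id].
exact: (continuous_comp cl (cphi (z - s))).
Qed.

Lemma integrable_conv k phi z : Lebesgue_integrable k -> test_function phi ->
  Lebesgue_integrable (fun s => k s * phi (z - s)).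
Proof.
move=> ik tp; have [M _ HM] := test_bounded _ tp.
apply: (integrable_bdd_mul k (fun s => phi (z - s)) M ik) => //.
exact: (reflect_mfun _ _ (test_continuous_fun _ tp)).
Qed.

Lemma is_derive_conv k phi z : Lebesgue_integrable k -> test_function phi ->
  is_derive z (1 : R) (conv k phi) (conv k (derive1 phi) z).
Proof.
move=> ik tp.
have tp1 := test_derive1 _ tp.
have [M M0 HM] := test_bounded _ (test_derive1n _ 2 tp).
apply: (is_derive_quadratic _ _ _ (M * \int[mu]_s `|k s|)) => h.
pose g s := phi (z + h - s) - phi (z - s) - h * derive1 phi (z - s).
have E : conv k phi (z + h) - conv k phi z - h * conv k (derive1 phi) z =
    \int[mu]_s (k s * g s).
  have i1 := integrable_conv _ _ (z + h) ik tp; have i2 := integrable_conv _ _ z ik tp.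
  have i3 := integrable_conv _ _ z ik tp1.
  rewrite /conv -RintegralZl// -(RintegralB measurableT i1 i2).
  rewrite -(RintegralB measurableT (integrable_sub _ _ i1 i2) (integrable_cmul h _ i3)).
  by apply: eq_Rintegral => s _; rewrite /g; ring.
have gM s : `|g s| <= M * `|h| ^+ 2.
  have := derive1_taylor phi M _ _ _ (z - s) h.
  rewrite (_ : z - s + h = z + h - s); last by ring.
  apply.
  - by move=> y; have := test_smooth _ tp 0%N y; rewrite derive1n0.
  - by move=> y; have := test_smooth _ tp 1%N y; rewrite derive1n1.
  - by move=> y; have := HM y; rewrite derive1nS derive1n1.
have ikg : Lebesgue_integrable (fun s => k s * g s).
  apply: (integrable_bdd_mul _ _ _ ik _ gM).
  have mp u : measurable_fun setT (fun s => phi (u - s)) := reflect_mfun _ _ (test_continuous_fun _ tp).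
  apply: measurable_funB; first exact: measurable_funB (mp _) (mp _).
  apply: measurable_funM => //; exact: (reflect_mfun _ _ (test_continuous_fun _ tp1)).
have ink : Lebesgue_integrable (fun s => `|k s|) by exact: integrable_norm.
rewrite E; apply: le_trans (le_normr_Rintegral measurableT ikg) _.
rewrite mulrAC -RintegralZl//; apply: le_Rintegral => //.
- exact: (integrable_norm ikg).
- exact: (integrable_cmul _ _ ink).
- by move=> s _; rewrite normrM mulrC ler_wpM2r.
Qed.

Lemma derive1n_conv k phi : Lebesgue_integrable k -> test_function phi ->
  smooth (conv k phi) /\ forall m, derive1n m (conv k phi) = conv k (derive1n m phi).
Proof.
move=> ik tp.
have [m z|sS E] := smooth_seq (fun m => conv k (derive1n m phi)); last by split; [exact: sS|exact: E].
by rewrite derive1nS; apply: is_derive_conv => //; exact: test_derive1n.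
Qed.

Lemma csupp_conv k phi r s : csupp r k -> csupp s phi -> csupp (r + s) (conv k phi).
Proof.
move=> ck cp z hz; rewrite /conv (_ : (fun _ => _) = cst 0); first exact: Rintegral_cst0.
apply/funext => y; have [ry|yr] := ltP r `|y|; first by rewrite ck// mul0r.
by rewrite cp ?mulr0//; have := lerB_dist z y; lra.
Qed.

Lemma test_conv k phi r : Lebesgue_integrable k -> csupp r k -> test_function phi ->
  test_function (conv k phi).
Proof.
move=> ik ck tp; have [s _ cs] := test_csupp _ tp.
apply: (csupp_test (r + s)); last exact: csupp_conv.
by case: (derive1n_conv _ _ ik tp).
Qed.

(** The substitution of z - s for s, that is, the affine change of variable with factor -1. *)
Lemma convC chi phi : test_function chi -> test_function phi -> conv chi phi = conv phi chi.
Proof.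
move=> tc tp; apply/funext => z; rewrite /conv.
have ig : Lebesgue_integrable (fun s => phi s * chi (z - s)).
  by apply: integrable_conv => //; exact: test_integrable.
have N1 : (- 1 : R) != 0 by rewrite oppr_eq0 oner_eq0.
have := Rintegral_affine _ z _ N1 ig; rewrite normrN1 mul1r => <-.
apply: eq_Rintegral => s _; rewrite /dil invrN invr1 mulrN1 opprB mulrC.
by congr (_ * chi _); ring.
Qed.

Lemma indic_nneg (A : set R) s : 0 <= (\1_A s : R).
Proof. by rewrite indicE ler0n. Qed.

Lemma Rintegral_indic_itv (y y' : R) : y <= y' ->
  \int[mu]_s (\1_(`]y, y'] : set R) s) = y' - y.
Proof.
move=> yy; rewrite /Rintegral integral_indic//.
have E : lebesgue_measure (`]y, y'] : set R) = (y' - y)%:E.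
  rewrite lebesgue_measure_itv/= lte_fin; case: ltgtP yy => //= -> _.
  by rewrite subrr.
by rewrite -[RHS]/(fine (y' - y)%:E) -E; congr (fine (_ _)); exact: setIT.
Qed.

(** Freezes an integrand on a short interval; when [L] is a multiple of the length, the error is
    quadratic in the length. *)
Lemma osc_bound f c L (y y' : R) : measurable_fun setT f -> y <= y' -> 0 <= L ->
  (forall s, y < s <= y' -> `|f s - c| <= L) ->
  `|\int[mu]_s (f s * \1_(`]y, y'] : set R) s) - c * (y' - y)| <= L * (y' - y).
Proof.
move=> mf yy L0 Hf; pose J : set R := `]y, y'].
have iJ : Lebesgue_integrable (\1_J : R -> R) by exact: integrable_indic_itv.
have mJ : measurable_fun setT (\1_J : R -> R) := integrable_mfun _ iJ.
have D s : `|(f s - c) * \1_J s| <= L * \1_J s.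
  rewrite normrM (ger0_norm (indic_nneg _ _)) indicE; case: (boolP (s \in J)) => sJ.
    by rewrite !mulr1; apply: Hf; move: sJ; rewrite inE /J/= in_itv.
  by rewrite !mulr0.
have idf : Lebesgue_integrable (fun s => (f s - c) * \1_J s).
  have := integrable_cmul L _ iJ; apply: le_integrable => //.
    apply/measurable_EFinP; apply: measurable_funM => //; exact: measurable_funB.
  move=> s _; rewrite /= lee_fin; apply: le_trans (D s) _; exact: ler_norm.
have -> : \int[mu]_s (f s * \1_J s) =
  \int[mu]_s ((f s - c) * \1_J s) + c * (y' - y).
  rewrite -(Rintegral_indic_itv _ _ yy) -RintegralZl// -RintegralD//.
    by apply: eq_Rintegral => s _; ring.
  exact: integrable_cmul.
rewrite addrK; apply: le_trans (le_normr_Rintegral measurableT idf) _.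
rewrite -(Rintegral_indic_itv _ _ yy) -RintegralZl//; apply: le_Rintegral => //.
- exact: (integrable_norm idf).
- exact: (integrable_cmul _ _ iJ).
Qed.

End Convolution.

(** * A distribution applied to a convolution *)

Section DistributionConvolution.
Context {R : realType}.
Variable W : @functional R.
Hypothesis linW : test_linear W.
Hypothesis contW : test_continuous W.
Implicit Types (f k phi chi : R -> R) (x y z s t r : R) (m n : nat).

(** Increments of second order force a zero derivative. Two quantities depending on an upper limit
    can thus be compared through their increments. *)
Lemma const_of_quadratic f K : (forall x y, x <= y -> `|f y - f x| <= K * (y - x) ^+ 2) ->
  forall x y, f x = f y.
Proof.
move=> H x y; apply: is_derive_0_is_cst => z.
apply: (is_derive_quadratic _ _ _ K) => h; rewrite mulr0 subr0.
have [h0|h0] := leP 0 h.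
  have := H z (z + h); rewrite lerDl addrAC subrr add0r => /(_ h0).
  by rewrite (ger0_norm h0).
have := H (z + h) z; rewrite gerDl opprD addrA subrr sub0r distrC => /(_ (ltW h0)).
by rewrite (ltr0_norm h0).
Qed.

Lemma clamp_lipschitz (c x y : R) : 0 <= c -> x <= y ->
  0 <= Num.max (- c) (Num.min y c) - Num.max (- c) (Num.min x c) <= y - x.
Proof.
move=> c0 xy; have [yc|cy] := leP y c.
  rewrite (min_l (le_trans xy yc)).
  have [h|h] := leP (- c) y; have [h'|h'] := leP (- c) x; apply/andP; split; lra.
have [xc|cx] := leP x c.
  by rewrite (max_r (_ : - c <= c)); [have [h|h] := leP (- c) x; apply/andP; split; lra|lra].
by rewrite subrr lexx subr_ge0.
Qed.

Let shift phi s := fun z : R => phi (z - s).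

Let shiftE phi s : shift phi s = dil phi s 1.
Proof. by apply/funext => z; rewrite /dil divr1. Qed.

Lemma shift_lipschitz phi (r0 : R) : test_function phi -> exists2 K, 0 <= K &
  forall x y, `|x| <= r0 -> `|y| <= r0 ->
    `|W (fun z => phi (z - x)) - W (fun z => phi (z - y))| <= K * `|x - y|.
Proof.
move=> tp; have [K [K0 HK]] := distr_dil_lipschitz _ linW contW _ 1 r0 (oner_neq0 R) tp.
by exists K => // x y hx hy; rewrite -!/(shift _ _) !shiftE; exact: HK.
Qed.

Lemma shift_mfun phi : test_function phi -> continuous (fun s => W (fun z => phi (z - s))).
Proof.
move=> tp; rewrite (_ : (fun s => _) = fun s => W (dil phi s 1)).
  exact: distr_dil_continuous _ linW contW _ _ (oner_neq0 R) tp.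
by apply/funext => s; rewrite -shiftE.
Qed.

(** Both sides are cut at a moving upper limit. Over ]u, v] each of them grows by (v - u) chi(u)
    W(phi(. - u)) up to O((v - u)^2), so their difference [D] is constant, and at the left end both
    are 0. *)
Lemma distr_conv chi phi : test_function chi -> test_function phi ->
  W (conv chi phi) = \int[mu]_s (chi s * W (fun z => phi (z - s))).
Proof.
move=> tc tp.
have [r1 r10 cr1] := test_csupp _ tc; have [r2 r20 cr2] := test_csupp _ tp.
pose rho := r1 + 1.
have rho0 : 0 <= rho by rewrite /rho; lra.
have [N [C [C0 HC]]] := distr_bound W contW (rho + r2).
have [Mc Mc0 HMc] := test_bounded_upto _ 1 tc.
have [Mp Mp0 HMp] := test_bounded_upto _ N.+1 tp.
have [Kg Kg0 HKg] := shift_lipschitz phi rho tp.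
have lipc x y : `|chi x - chi y| <= Mc * `|x - y|.
  apply: derive1_lipschitz => u; first by have := test_smooth _ tc 0%N u; rewrite derive1n0.
  by rewrite -derive1n1; exact: HMc.
have lipp m x y : (m <= N)%N -> `|derive1n m phi x - derive1n m phi y| <= Mp * `|x - y|.
  move=> mN; apply: derive1_lipschitz => u; first exact: (test_smooth _ tp m).
  by rewrite -derive1nS; exact: HMp.
pose g s := chi s * W (fun z => phi (z - s)).
have cg : continuous g.
  move=> s; apply: cvgM; [exact: test_continuous_fun tc s|exact: shift_mfun tp s].
have csg : csupp r1 g by move=> s rs; rewrite /g cr1// mul0r.
have [Mg HMg] := csupp_bounded _ _ cg csg.
have ig : Lebesgue_integrable g := integrable_csupp _ _ _ (continuous_mfun _ cg) HMg csg.
have [B HB] : exists B, forall s, `|s| <= rho -> `|W (fun z => phi (z - s))| <= B.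
  exists (`|W (fun z => phi (z - 0))| + Kg * rho) => s sr.
  have := HKg s 0 sr; rewrite normr0 subr0 => /(_ rho0).
  have := ler_normD (W (fun z => phi (z - 0))) (W (fun z => phi (z - s)) - W (fun z => phi (z - 0))).
  rewrite addrC subrK => h1 h2; apply: le_trans h1 _; rewrite lerD2l; apply: le_trans h2 _.
  by rewrite ler_wpM2l.
have B0 : 0 <= B by apply: le_trans (HB 0 _) => //; rewrite normr0.
pose J y : set R := `](- rho), y].
have iJ y : Lebesgue_integrable (\1_(J y) : R -> R) by exact: integrable_indic_itv.
have mJ y : measurable_fun setT (\1_(J y) : R -> R) := integrable_mfun _ (iJ y).
have bJ (A : set R) s : `|\1_A s : R| <= 1 by rewrite ger0_norm ?indic_nneg// indicE; case: (_ \in _).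
have ic := test_integrable _ tc.
have ick y : Lebesgue_integrable (fun s => chi s * \1_(J y) s) := integrable_bdd_mul _ _ 1 ic (mJ y) (bJ _).
(* The quadratic estimate is wanted on the whole line, but its constants hold on [-rho, rho];
   clamping the limit is 1-Lipschitz and keeps it there. *)
pose clamp y := Num.max (- rho) (Num.min y rho).
have clampE y : - rho <= clamp y <= rho.
  by rewrite le_max lexx/= ge_max; apply/andP; split; [lra|rewrite ge_min lexx orbT].
have clamp_mono y y' : y <= y' -> 0 <= clamp y' - clamp y <= y' - y := clamp_lipschitz _ y y' rho0.
pose D y := W (conv (fun s => chi s * \1_(J (clamp y)) s) phi) -
  \int[mu]_s (g s * \1_(J (clamp y)) s).
pose K := C * (Mc * Mp + Mc * Mp) + (Mc * B + Mc * Kg).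
have HD y y' : y <= y' -> `|D y' - D y| <= K * (y' - y) ^+ 2.
  move=> yy'; have /andP[c1 c2] := clamp_mono _ _ yy'.
  have /andP[a1 a2] := clampE y; have /andP[b1 b2] := clampE y'.
  set u := clamp y in c1 c2 a1 a2 *; set v := clamp y' in c1 c2 b1 b2 *.
  have uv : u <= v by lra.
  have K0 : 0 <= K by rewrite /K !addr_ge0// !mulr_ge0// addr_ge0// mulr_ge0.
  apply: (@le_trans _ _ (K * (v - u) ^+ 2)); last first.
    by rewrite ler_wpM2l//; apply: lerXn2r; rewrite ?nnegrE//; lra.
  have nu : `|u| <= rho by rewrite ler_norml a1.
  have JJ s : (\1_(J v) s : R) - \1_(J u) s = \1_(`]u, v] : set R) s.
    rewrite !indicE /J; do 3 (rewrite mem_setE/= in_itv/=).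
    have [su|us] := leP s u.
      by rewrite (le_trans su uv) andbT subrr.
    rewrite (le_lt_trans a1 us)/= subr0; by [].
  have su s : u < s <= v -> `|s| <= rho.
    by move=> /andP[h1 h2]; rewrite ler_norml; apply/andP; split; lra.
  have tu : test_function (fun z => phi (z - u)) by exact: test_shift.
  (* The common first-order term, frozen at the left end [u], is subtracted from both increments. *)
  have -> : D y' - D y =
      (W (conv (fun s => chi s * \1_(`]u, v] : set R) s) phi) - (v - u) * chi u * W (fun z => phi (z - u))) -
      (\int[mu]_s (g s * \1_(`]u, v] : set R) s) - g u * (v - u)).
    have -> : conv (fun s => chi s * \1_(`]u, v] : set R) s) phi =
        fun z => conv (fun s => chi s * \1_(J v) s) phi z - conv (fun s => chi s * \1_(J u) s) phi z.
      apply/funext => z; rewrite /conv -RintegralB//; [|exact: integrable_conv..].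
      by apply: eq_Rintegral => s _; rewrite -JJ; ring.
    have tck w : test_function (conv (fun s => chi s * \1_(J w) s) phi).
      by apply: (test_conv _ _ r1) => // s rs; rewrite cr1// mul0r.
    rewrite distrB//.
    have -> : \int[mu]_s (g s * \1_(`]u, v] : set R) s) =
        \int[mu]_s (g s * \1_(J v) s) - \int[mu]_s (g s * \1_(J u) s).
      have igJ w : Lebesgue_integrable (fun s => g s * \1_(J w) s) := integrable_bdd_mul _ _ 1 ig (mJ w) (bJ _).
      rewrite -RintegralB//.
      by apply: eq_Rintegral => s _; rewrite -JJ; ring.
    by rewrite /D -/u -/v /g; ring.
  apply: le_trans (ler_normB _ _) _; rewrite /K [leRHS]mulrDl; apply: lerD.
    have icuv : Lebesgue_integrable (fun s => chi s * \1_(`]u, v] : set R) s).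
      by apply: (integrable_bdd_mul _ _ 1 ic) => //; exact/integrable_mfun/integrable_indic_itv.
    have cuv : csupp r1 (fun s => chi s * \1_(`]u, v] : set R) s).
      by move=> s rs; rewrite cr1// mul0r.
    have tcuv := test_conv _ _ _ icuv cuv tp.
    have tu' : test_function (fun z => (v - u) * chi u * phi (z - u)) by exact: testZ.
    rewrite -distrZ// -distrB// -mulrA; apply: HC.
    - exact: (test_smooth _ (testB _ _ tcuv tu')).
    - move=> z hz; rewrite (csupp_conv _ _ _ _ cuv cr2); last by rewrite /rho in hz; lra.
      rewrite sub0r cr2 ?mulr0 ?oppr0//; have := lerB_dist z u; lra.
    move=> m z mN; rewrite derive1nB; [|exact: test_smooth..].
    rewrite (derive1n_conv _ _ icuv tp).2.
    have -> : derive1n m (fun z => (v - u) * chi u * phi (z - u)) z =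
        (v - u) * chi u * derive1n m phi (z - u).
      by rewrite derive1nZ ?derive1n_shift; [|exact: test_smooth..].
    have -> : conv (fun s => chi s * \1_(`]u, v] : set R) s) (derive1n m phi) z =
       \int[mu]_s ((chi s * derive1n m phi (z - s)) * \1_(`]u, v] : set R) s).
      by apply: eq_Rintegral => s _; rewrite mulrAC.
    rewrite [(v - u) * _ * _](_ : _ = chi u * derive1n m phi (z - u) * (v - u)); last by ring.
    rewrite [leRHS](_ : _ = (Mc * Mp + Mc * Mp) * (v - u) * (v - u)); last by ring.
    apply: (osc_bound (fun s => chi s * derive1n m phi (z - s))) => //.
    - apply: measurable_funM; first exact: (continuous_mfun _ (test_continuous_fun _ tc)).
      exact: (reflect_mfun _ _ (test_continuous_fun _ (test_derive1n _ m tp))).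
    - by rewrite mulr_ge0// addr_ge0// mulr_ge0.
    move=> s /andP[h1 h2].
    have -> : chi s * derive1n m phi (z - s) - chi u * derive1n m phi (z - u) =
      (chi s - chi u) * derive1n m phi (z - s) + chi u * (derive1n m phi (z - s) - derive1n m phi (z - u)) by ring.
    have suv : `|s - u| <= v - u by rewrite ger0_norm; lra.
    apply: le_trans (ler_normD _ _) _; rewrite [leRHS]mulrDl !normrM; apply: lerD.
      rewrite mulrAC; apply: ler_pM => //; last by apply: HMp; exact: leqW.
      by apply: le_trans (lipc _ _) _; rewrite ler_wpM2l.
    rewrite -mulrA; apply: ler_pM => //; first by have := HMc 0%N u; rewrite derive1n0; exact.
    apply: le_trans (lipp _ _ _ mN) _; rewrite ler_wpM2l//.
    by rewrite (_ : z - s - (z - u) = - (s - u)) ?normrN//; ring.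
  rewrite [leRHS](_ : _ = (Mc * B + Mc * Kg) * (v - u) * (v - u)); last by ring.
  apply: osc_bound => //; first exact: continuous_mfun.
    by rewrite mulr_ge0// addr_ge0// mulr_ge0.
  move=> s suv; have sr := su _ suv; have /andP[h1 h2] := suv.
  rewrite /g (_ : _ - _ = (chi s - chi u) * W (fun z => phi (z - s)) +
    chi u * (W (fun z => phi (z - s)) - W (fun z => phi (z - u)))); last by ring.
  have suv' : `|s - u| <= v - u by rewrite ger0_norm; lra.
  apply: le_trans (ler_normD _ _) _; rewrite [leRHS]mulrDl !normrM; apply: lerD.
    rewrite mulrAC; apply: ler_pM => //; last exact: HB.
    by apply: le_trans (lipc _ _) _; rewrite ler_wpM2l.
  rewrite -mulrA; apply: ler_pM => //; first by have := HMc 0%N u; rewrite derive1n0; exact.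
  by apply: le_trans (HKg _ _ sr nu) _; rewrite ler_wpM2l.
have := const_of_quadratic _ _ HD (- rho) rho; rewrite /D.
have -> : clamp (- rho) = - rho by rewrite /clamp min_l ?maxxx//; lra.
have -> : clamp rho = rho by rewrite /clamp minxx max_r//; lra.
have J0 s : (\1_(J (- rho)) s : R) = 0.
  by rewrite indicE /J set_itvoc0 ?in_set0.
have J1 f s : csupp r1 f -> f s * \1_(J rho) s = f s.
  move=> cf; have [rs|sr] := ltP r1 `|s|; first by rewrite cf// mul0r.
  rewrite indicE mem_set ?mulr1// /J/= in_itv/=; move: sr; rewrite ler_norml /rho => /andP[h1 h2].
  by apply/andP; split; lra.
have -> : conv (fun s => chi s * \1_(J (- rho)) s) phi = cst 0.
  apply/funext => z; rewrite /conv (_ : (fun _ => _) = cst 0); first exact: Rintegral_cst0.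
  by apply/funext => s; rewrite J0 mulr0 mul0r.
rewrite distr0// (_ : (fun s => g s * _) = cst 0); last by apply/funext => s; rewrite J0 mulr0.
rewrite Rintegral_cst0 subrr.
under eq_Rintegral do rewrite J1//.
have -> : (fun s => chi s * \1_(J rho) s) = chi by apply/funext => s; rewrite J1.
by move=> /esym/subr0_eq.
Qed.

End DistributionConvolution.

(** * Recovery of a distribution from its means and values *)

Section Mollification.
Context {R : realType}.
Variable W : @functional R.
Hypothesis linW : test_linear W.
Hypothesis contW : test_continuous W.
Implicit Types (f phi chi : R -> R) (x y z s t r : R) (m n : nat).

Let mollifier t := fun z : R => t^-1 * dil bump 0 t z.

Let test_mollifier t : t != 0 -> test_function (mollifier t).
Proof. by move=> t0; apply: testZ; apply: test_dil => //; exact: test_bump. Qed.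

Lemma mollify_error f M t z : 0 < t -> test_function f -> (forall x, `|derive1 f x| <= M) ->
  `|conv (mollifier t) f z - f z| <= M * t.
Proof.
move=> t0 tf HM; have tn0 : t != 0 by rewrite gt_eqF.
have tm := test_mollifier _ tn0; have im := test_integrable _ tm.
have I1 : \int[mu]_s mollifier t s = 1.
  rewrite /mollifier RintegralZl//; last exact/test_integrable/test_dil/test_bump.
  by rewrite Rintegral_dil_bump// gtr0_norm// mulVf.
have m0 s : 0 <= mollifier t s by rewrite mulr_ge0 ?bump_ge0// invr_ge0 ltW.
have ic := integrable_conv _ _ z im tf.
have iz : Lebesgue_integrable (fun s => f z * mollifier t s) by exact: integrable_cmul.
have -> : conv (mollifier t) f z - f z =
    \int[mu]_s (mollifier t s * f (z - s) - f z * mollifier t s).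
  by rewrite RintegralB// RintegralZl// I1 mulr1.
have is_ := integrable_sub _ _ ic iz.
apply: le_trans (le_normr_Rintegral measurableT is_) _.
rewrite -[leRHS]mulr1 -I1 -RintegralZl//; apply: le_Rintegral => //.
- exact: (integrable_norm is_).
- exact: (integrable_cmul _ _ im).
move=> s _; rewrite [f z * _]mulrC -mulrBr normrM (ger0_norm (m0 s)) mulrC.
have [st|ts] := leP `|s| t.
  rewrite ler_wpM2r//; apply: (@le_trans _ _ (M * `|s|)); last first.
    by rewrite ler_wpM2l//; apply: le_trans (HM 0).
  have := derive1_lipschitz f M _ HM (z - s) z; rewrite addrAC subrr sub0r normrN; apply.
  by move=> x; have := test_smooth _ tf 0%N x; rewrite derive1n0.
rewrite {1 2}/mollifier /dil csupp_bump ?mulr0//.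
by rewrite subr0 normrM normfV (gtr0_norm t0) ltr_pdivlMr// mul1r.
Qed.

(** By [distr_conv] the integral is [W] applied to the convolution of [chi] with the mollifier of
    scale [t], and these convolutions tend to [chi] with each derivative at rate [t]. *)
Lemma distr_mollify chi : test_function chi ->
  \int[mu]_s (chi s * rescale W s t bump) @[t --> 0^'+] --> W chi.
Proof.
move=> tc; have [r r0 cr] := test_csupp _ tc.
have [N [C [C0 HC]]] := distr_bound W contW (r + 1).
have [M M0 HM] := test_bounded_upto _ N.+1 tc.
apply/cvgrPdist_le => e e0; near=> t.
have t0 : 0 < t by near: t; exact: nbhs_right_gt.
have t1 : t <= 1 by near: t; exact: nbhs_right_le.
have tn0 : t != 0 by rewrite gt_eqF.
have tm := test_mollifier _ tn0; have im := test_integrable _ tm.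
have -> : \int[mu]_s (chi s * rescale W s t bump) = W (conv chi (mollifier t)).
  rewrite distr_conv//; apply: eq_Rintegral => s _; congr (_ * _).
  rewrite rescaleE gtr0_norm// -distrZ//; last exact/test_dil/test_bump.
  by congr W; apply/funext => z; rewrite /mollifier /dil subr0.
(* Exchanged so that derivatives fall on [chi], whose bounds do not depend on [t]. *)
rewrite convC//.
have cm : csupp t (mollifier t).
  move=> z; rewrite /mollifier /dil subr0 => hz.
  by rewrite csupp_bump ?mulr0// normrM normfV (gtr0_norm t0) ltr_pdivlMr// mul1r.
have tcm : test_function (conv (mollifier t) chi) := test_conv _ _ _ im cm tc.
rewrite distrC -distrB//.
apply: (@le_trans _ _ (C * (M * t))).
  apply: HC.
  - exact: (test_smooth _ (testB _ _ tcm tc)).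
  - move=> z hz; rewrite (csupp_conv _ _ _ _ cm cr); last by apply: le_lt_trans hz; rewrite addrC lerD2l.
    by rewrite cr ?subrr//; apply: le_lt_trans hz; rewrite lerDl.
  move=> m z mN; rewrite derive1nB; [|exact: test_smooth..].
  rewrite (derive1n_conv _ _ im tc).2; apply: mollify_error => //; first exact: test_derive1n.
  by move=> x; rewrite -derive1nS; exact: HM.
have : t <= e / (C * M + 1).
  by near: t; apply: nbhs_right_le; rewrite divr_gt0// ltr_wpDl// mulr_ge0.
rewrite ler_pdivlMr ?ltr_wpDl ?mulr_ge0// mulrDr mulr1 => /(le_trans _); apply.
by rewrite mulrA mulrC lerDl ltW.
Unshelve. all: by end_near. Qed.

Variable V : R -> R.
Hypothesis pvV : forall x, point_value W x (V x).

Lemma rescale_bump_cvg x : rescale W x t bump @[t --> 0^'] --> V x.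
Proof. by have := pvV x bump test_bump; rewrite Rintegral_bump mulr1. Qed.

Lemma rescale_bump_cvg_seq x : rescale W x n.+1%:R^-1 bump @[n --> \oo] --> V x.
Proof.
have H := rescale_bump_cvg x.
have K : (n.+1%:R^-1 : R) @[n --> \oo] --> 0^'.
  move=> A [d /= d0 Hd]; suff: \forall n \near \oo, A (n.+1%:R^-1) by [].
  near=> n; apply: Hd => /=; last by rewrite invr_eq0 pnatr_eq0.
  rewrite sub0r normrN ger0_norm//.
  by near: n; exact: (near_infty_natSinv_lt (PosNum d0)).
exact: (@cvg_comp _ _ _ (fun n => n.+1%:R^-1 : R) (fun t => rescale W x t bump) _ _ _ K H).
Unshelve. all: by end_near. Qed.

Lemma rescale_mfun t : t != 0 -> measurable_fun setT (fun x => rescale W x t bump).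
Proof.
move=> t0; apply: continuous_mfun => x; apply: cvgMr.
exact: (distr_dil_continuous W linW contW bump t t0 test_bump x).
Qed.

Lemma value_mfun : measurable_fun setT V.
Proof.
apply: (@measurable_fun_cvg _ _ _ _ (fun n x => rescale W x n.+1%:R^-1 bump)).
- by move=> n; apply: rescale_mfun; rewrite invr_eq0 pnatr_eq0.
- by move=> x _; exact: rescale_bump_cvg_seq.
Qed.

Lemma value_bounded x (t0 N : R) : 0 < t0 ->
  (forall t, 0 < t < t0 -> `|rescale W x t bump| <= N) -> `|V x| <= N.
Proof.
move=> t00 HN.
have : `|rescale W x n.+1%:R^-1 bump| @[n --> \oo] --> `|V x|.
  by apply: cvg_norm; exact: rescale_bump_cvg_seq.
move=> /cvgr_to_le; apply; near=> n; apply: HN; rewrite invr_gt0 ltr0Sn/=.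
by near: n; exact: (near_infty_natSinv_lt (PosNum t00)).
Unshelve. all: by end_near. Qed.

(** The integrals of [chi] against the means have two limits: [W chi] by mollification, and the
    integral of chi V by dominated convergence. *)
Lemma distr_value_integral chi (t0 N : R) : test_function chi -> 0 < t0 ->
  (forall x t, chi x != 0 -> 0 < t < t0 -> `|rescale W x t bump| <= N) ->
  Lebesgue_integrable (fun x => chi x * V x) /\
  W chi = \int[mu]_x (chi x * V x).
Proof.
move=> tc t00 HN.
(* All scales 1/(n + 1 + k) lie below [t0], so [N] dominates from the first term on. *)
have [k kt0] : exists k : nat, forall n, (n.+1 + k)%:R^-1 < t0.
  have [k _ Hk] := near_infty_natSinv_lt (PosNum t00).
  by exists k => n; rewrite addSn; apply: Hk; rewrite /= leq_addl.
pose g n x : R := chi x * rescale W x (n.+1 + k)%:R^-1 bump.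
have mchi : measurable_fun setT chi := continuous_mfun _ (test_continuous_fun _ tc).
have [||| | |I _ L] := @dominated_convergence _ _ R lebesgue_measure setT measurableT
  (fun n x => (g n x)%:E) (fun x => (chi x * V x)%:E) (fun x => (N * `|chi x|)%:E).
- move=> n; apply/measurable_EFinP; apply: measurable_funM => //.
  by apply: rescale_mfun; rewrite invr_eq0 pnatr_eq0.
- by apply/measurable_EFinP; apply: measurable_funM => //; exact: value_mfun.
- apply: aeW => x _; apply: cvg_EFin; first exact: nearW.
  apply: cvgMr.
  have := rescale_bump_cvg_seq x; rewrite -(cvg_shiftn k) => H.
  by apply: cvg_trans H; apply: near_eq_cvg; near=> n; rewrite addSn.
- exact: (integrable_cmul _ _ (integrable_norm (test_integrable _ tc))).
- apply: aeW => x n _; rewrite /= lee_fin /g normrM mulrC.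
  have [->|cn0] := eqVneq (chi x) 0; first by rewrite normr0 !mulr0.
  by rewrite ler_wpM2r// HN// invr_gt0 kt0 ltr0n.
split=> //.
have K : ((n.+1 + k)%:R^-1 : R) @[n --> \oo] --> 0^'+.
  move=> A [d /= d0 Hd]; suff: \forall n \near \oo, A ((n.+1 + k)%:R^-1) by [].
  near=> n; apply: Hd => /=; last by rewrite invr_gt0 ltr0n.
  rewrite sub0r normrN ger0_norm//; apply: (@le_lt_trans _ _ n.+1%:R^-1).
    by rewrite lef_pV2 ?posrE ?ltr0n// ler_nat leq_addr.
  by near: n; exact: (near_infty_natSinv_lt (PosNum d0)).
have A := @cvg_comp _ _ _ (fun n => (n.+1 + k)%:R^-1 : R)
  (fun t => \int[mu]_s (chi s * rescale W s t bump)) _ _ _ K (distr_mollify _ tc).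
have ifin : (\int[mu]_x (chi x * V x)%:E)%E \is a fin_num.
  exact: (integrable_fin_num measurableT I).
rewrite -(fineK ifin) in L.
have B := fine_cvg L.
have {}A : (fun n => \int[mu]_x g n x) @ \oo --> W chi := A.
rewrite -(cvg_lim (@Rhausdorff R) A); apply: cvg_lim; first exact: Rhausdorff.
exact: B.
Unshelve. all: by end_near. Qed.

End Mollification.

(** * Primitives and smooth approximations of a segment *)

Section Primitive.
Context {R : realType}.
Implicit Types (f g : R -> R) (x y N : R).

Definition prim f x := \int[mu]_s (f s * \1_(`]-oo, x] : set R) s).

Lemma indic_mfun (A : set R) : measurable A -> measurable_fun setT (\1_A : R -> R).
Proof. by move=> mA; exact: measurable_indic. Qed.

Lemma integrable_mul_indic f (A : set R) : measurable A -> Lebesgue_integrable f ->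
  Lebesgue_integrable (fun s => f s * \1_A s).
Proof.
move=> mA fi; apply: (integrable_bdd_mul _ _ 1 fi (indic_mfun _ mA)) => s.
by rewrite ger0_norm ?indic_nneg// indicE; case: (_ \in _).
Qed.

Lemma primB f x y : Lebesgue_integrable f -> x <= y ->
  prim f y - prim f x = \int[mu]_s (f s * \1_(`]x, y] : set R) s).
Proof.
move=> fi xy; rewrite /prim -RintegralB//; [|exact: integrable_mul_indic..].
apply: eq_Rintegral => s _; rewrite -mulrBr; congr (_ * _).
rewrite !indicE; do 3 (rewrite mem_setE/= in_itv/=).
by have [sx|xs] := leP s x; [rewrite (le_trans sx xy) subrr|rewrite subr0].
Qed.

Lemma prim_lipschitz f N x y : Lebesgue_integrable f -> (forall s, `|f s| <= N) ->
  `|prim f x - prim f y| <= N * `|x - y|.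
Proof.
move=> fi HN; have N0 : 0 <= N := le_trans (normr_ge0 _) (HN 0).
wlog xy : x y / y <= x.
  move=> H; have [h|h] := leP y x; first exact: H.
  by rewrite distrC [`|x - y|]distrC; apply: H; exact: ltW.
rewrite primB// (@ger0_norm _ (x - y)) ?subr_ge0//.
have := osc_bound f 0 N y x (integrable_mfun _ fi) xy N0.
by rewrite mul0r subr0; apply=> s _; rewrite subr0.
Qed.

Lemma prim_continuous_lipschitz f N : (forall x y, `|f x - f y| <= N * `|x - y|) -> continuous f.
Proof.
move=> H x; have N0 : 0 <= N.
  by have := H 1 0; rewrite subr0 normr1 mulr1; exact: le_trans.
apply/cvgrPdist_le => e e0; near=> y; apply: le_trans (H x y) _.
have : `|x - y| <= e / (N + 1).
  near: y; apply: cvgr_dist_le; [exact: cvg_id|by rewrite divr_gt0// ltr_wpDl].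
rewrite ler_pdivlMr ?ltr_wpDl// mulrDr mulr1 => /(le_trans _); apply.
by rewrite mulrC lerDl.
Unshelve. all: by end_near. Qed.

(** A point value speaks of test functions only, whereas a difference quotient is a mean over a
    segment; these functions stand in for the indicator of [0, 1]. *)
Lemma unit_itv_approx (d : R) : 0 < d -> d < 2^-1 -> exists psi : R -> R,
  [/\ test_function psi, csupp 1 psi, forall y, 0 <= psi y <= 1,
      (forall y, d <= y <= 1 - d -> psi y = 1) & (forall y, y <= 0 \/ 1 <= y -> psi y = 0)].
Proof.
move=> d0 d2.
(* Since (1 - 2 d)^2 = 1 - w, dividing 2 y - 1 by the square root of [w] carries the zone where (2 y
   - 1)^2 runs from 1 - w to 1 onto the transition zone from r to r + 1 of [plateau r]. *)
pose w : R := 4 * d * (1 - d).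
have w0 : 0 < w by rewrite !mulr_gt0//; lra.
pose r : R := w^-1 - 1; pose c : R := Num.sqrt w^-1.
have c0 : 0 < c by rewrite sqrtr_gt0 invr_gt0.
have cc : c * c = w^-1 by rewrite -expr2 sqr_sqrtr// invr_ge0 ltW.
have u0 : 0 < w^-1 by rewrite invr_gt0.
have uw : w^-1 * w = 1 by rewrite mulVf// gt_eqF.
have rc : r + 1 = w^-1 by rewrite /r subrK.
pose psi y := plateau r ((y - 2^-1) / (2 * c)^-1).
have sqE y : (y - 2^-1) / (2 * c)^-1 * ((y - 2^-1) / (2 * c)^-1) = w^-1 * ((2 * y - 1) * (2 * y - 1)).
  by rewrite invrK -cc; field.
have z y : y <= 0 \/ 1 <= y -> psi y = 0.
  move=> hy; apply: plateau_eq0; rewrite sqE rc -[leLHS]mulr1 ler_wpM2l ?(ltW u0)//.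
  by case: hy => hy; nra.
have tpsi : test_function psi.
  apply: (test_dil (plateau r) 2^-1); last exact: test_plateau.
  by rewrite invr_eq0 mulf_neq0// ?gt_eqF.
exists psi; split=> // [y y1|y|y /andP[h1 h2]].
- by apply: z; have [h|h] := leP 0 y; [right; rewrite -(ger0_norm h) ltW|left; exact: ltW].
- exact: plateau_itv.
- apply: plateau_eq1; rewrite sqE.
  have : (2 * y - 1) * (2 * y - 1) <= 1 - w by rewrite /w; nra.
  move=> /(ler_wpM2l (ltW u0)) /le_trans; apply.
  by rewrite mulrBr mulr1 uw.
Qed.

Lemma Rintegral_indic_itvcc (y y' : R) : y <= y' ->
  \int[mu]_s (\1_(`[y, y'] : set R) s) = y' - y.
Proof.
move=> yy; rewrite /Rintegral integral_indic//.
have E : lebesgue_measure (`[y, y'] : set R) = (y' - y)%:E.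
  rewrite lebesgue_measure_itv/= lte_fin; case: ltgtP yy => //= -> _.
  by rewrite subrr.
by rewrite -[RHS]/(fine (y' - y)%:E) -E; congr (fine (_ _)); exact: setIT.
Qed.

(** Half-open to match the increments of [prim], for either sign of [h]; in the variable (z - x) / h
    it is the indicator of [0, 1] up to the endpoints. *)
Definition segment_indic x h z : R :=
  if 0 < h then \1_(`]x, (h + x)] : set R) z else \1_(`](h + x), x] : set R) z.

Lemma segment_indic_unit x h z : h != 0 ->
  [/\ 0 <= segment_indic x h z <= 1,
      (0 < (z - x) / h < 1 -> segment_indic x h z = 1) &
      ((z - x) / h < 0 \/ 1 < (z - x) / h -> segment_indic x h z = 0)].
Proof.
rewrite /segment_indic => h0; split.
- by case: ifP => _; rewrite indic_nneg/= indicE; case: (_ \in _).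
- have [hpos|hneg] := ltP 0 h.
    rewrite ltr_pdivlMr// ltr_pdivrMr// => /andP[u1 u2].
    by rewrite indicE mem_set//= in_itv/=; lra.
  have hn : h < 0 by rewrite lt_neqAle h0.
  rewrite ltr_ndivlMr// ltr_ndivrMr// => /andP[u1 u2].
  by rewrite indicE mem_set//= in_itv/=; lra.
- have [hpos|hneg] := ltP 0 h.
    rewrite ltr_pdivrMr// ltr_pdivlMr// => hu.
    by rewrite indicE memNset//= in_itv/= => /andP[u1 u2]; case: hu => hu; lra.
  have hn : h < 0 by rewrite lt_neqAle h0.
  rewrite ltr_ndivrMr// ltr_ndivlMr// => hu.
  by rewrite indicE memNset//= in_itv/= => /andP[u1 u2]; case: hu => hu; lra.
Qed.

End Primitive.

(** * Monotonicity where the means are uniformly bounded *)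

Section BoundedCase.
Context {R : realType}.
Variable W : @functional R.
Hypothesis linW : test_linear W.
Hypothesis contW : test_continuous W.
Variable V : R -> R.
Hypothesis pvV : forall x, point_value W x (V x).
Implicit Types (f phi chi : R -> R) (x y z s t r : R) (m n : nat).

Definition ybump y : R := y * bump y.

Lemma test_ybump : test_function ybump.
Proof. exact: (test_mul id bump smooth_id test_bump). Qed.

Lemma csupp_ybump : csupp 1 ybump.
Proof. by move=> y y1; rewrite /ybump csupp_bump// mulr0. Qed.

Lemma Rintegral_ybump : \int[mu]_y ybump y = 0.
Proof.
have N1 : (- 1 : R) != 0 by rewrite oppr_eq0 oner_eq0.
have iy := test_integrable _ test_ybump.
have := Rintegral_affine ybump 0 _ N1 iy; rewrite normrN1 mul1r.
rewrite (_ : \int[mu]_y dil ybump 0 (- 1) y = - \int[mu]_y ybump y).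
  by move=> /eqP; rewrite -subr_eq0 -opprD oppr_eq0 -mulr2n mulrn_eq0/= => /eqP.
rewrite -[RHS]mulN1r -RintegralZl//; apply: eq_Rintegral => y _.
by rewrite /dil subr0 invrN invr1 mulrN1 /ybump bump_even mulN1r mulNr.
Qed.

(** Transfers the hypothesis on W' to a mean of [W] against y bump(y), which [Phi_derive] recognises
    as a derivative in the scale. *)
Lemma rescale_deriv_hat x t : 0 < t ->
  rescale (deriv_distr W) x t hat = hat_slope / t * rescale W x t ybump.
Proof.
move=> t0; have tn0 : t != 0 by rewrite gt_eqF.
rewrite !rescaleE /deriv_distr gtr0_norm//.
have -> : derive1 (dil hat x t) = fun z => (- hat_slope / t) * dil ybump x t z.
  apply/funext => z; have := derive1n_dil hat x t 1 z (test_smooth _ test_hat).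
  by rewrite derive1n1 => ->; rewrite /dil derive1n1 derive1_hat /ybump expr1; ring.
by rewrite distrZ//; [ring|exact/test_dil/test_ybump].
Qed.

Variables (p1 q1 N t0 : R).
Hypothesis t00 : 0 < t0.
Hypothesis HN : forall x t, p1 <= x <= q1 -> 0 < t < t0 -> `|rescale W x t bump| <= N.

Let N0 : p1 <= q1 -> 0 <= N.
Proof.
move=> pq; apply: le_trans (HN p1 (t0 / 2) _ _); rewrite ?lexx//.
by have := t00; move=> h; rewrite divr_gt0//= ltr_pdivrMr// ltr_pMr// ltr1n.
Qed.

(** Cut to [p1, q1], where [V] is bounded by [N]: the primitive is then Lipschitz on the whole
    line. *)
Let Vb x : R := V x * \1_(`[p1, q1] : set R) x.

Lemma distr_value_integral_itv chi : test_function chi ->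
  (forall x, chi x != 0 -> p1 <= x <= q1) ->
  Lebesgue_integrable (fun x => chi x * V x) /\ W chi = \int[mu]_x (chi x * V x).
Proof.
move=> tc hc; apply: (distr_value_integral W linW contW V pvV chi t0 N) => // x t cx tt.
by apply: HN => //; exact: hc.
Qed.

Let VbE chi : test_function chi -> (forall x, chi x != 0 -> p1 <= x <= q1) ->
  W chi = \int[mu]_x (chi x * Vb x).
Proof.
move=> tc hc; rewrite (distr_value_integral_itv chi tc hc).2; apply: eq_Rintegral => x _.
have [->|cn0] := eqVneq (chi x) 0; first by rewrite !mul0r.
by rewrite /Vb indicE mem_set ?mulr1//= in_itv/= hc.
Qed.

Let V_bounded x : p1 <= x <= q1 -> `|V x| <= N.
Proof. by move=> hx; apply: (value_bounded W V pvV x t0) => // t tt; exact: HN. Qed.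

Let Vb_bounded : p1 <= q1 -> forall x, `|Vb x| <= N.
Proof.
move=> pq x; rewrite /Vb indicE; case: (boolP (x \in _)) => h; last by rewrite mulr0 normr0 N0.
by rewrite mulr1; apply: V_bounded; move: h; rewrite inE/= in_itv.
Qed.

Let Vb_integrable : p1 <= q1 -> Lebesgue_integrable Vb.
Proof.
move=> pq; apply: (integrable_csupp (Num.max `|p1| `|q1|) _ N).
- apply: measurable_funM; [exact: value_mfun W linW contW V pvV|exact: indic_mfun].
- exact: Vb_bounded.
- move=> x hx; rewrite /Vb indicE memNset ?mulr0//= in_itv/= => /andP[h1 h2].
  move: hx; rewrite ltNge => /negP; apply.
  rewrite le_max; have [x0|x0] := leP 0 x.
    by rewrite orbC (ger0_norm x0) (le_trans h2)// ler_norm.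
  rewrite (ltr0_norm x0); apply/orP; left; apply: (@le_trans _ _ (- p1)); first by rewrite lerN2.
  by rewrite -normrN ler_norm.
Qed.

Let F := prim Vb.

(** The difference quotient of [F] is the mean of [V] over a segment ending at [x]. Up to O(N d) it
    is the mean along a test function [psi] close to the indicator of [0, 1], which tends to V(x)
    times the integral of [psi] because the value exists at this very point. *)
Let F_derive x : p1 < x < q1 -> is_derive x (1 : R) F (V x).
Proof.
move=> /andP[px xq]; have pq : p1 <= q1 by rewrite ltW// (lt_trans px).
have VbN := Vb_bounded pq; have iV := Vb_integrable pq; have NN := N0 pq.
have xx : p1 <= x <= q1 by rewrite !ltW.
have H : (fun h : R => h^-1 *: (F (h + x) - F x)) @ 0^' --> V x.
  apply/cvgrPdist_le => e e0.
  (* Two errors of size 2 N d arise below, from replacing the segment by [psi] in the mean and 1 by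
     the integral of [psi]; together they take e / 2. *)
  have [d [d0 d2 dN]] : exists d : R, [/\ 0 < d, d < 2^-1 & N * d * 4 <= e / 2].
    exists (Num.min 4^-1 (e / (8 * (N + 1)))); split.
    - by rewrite lt_min invr_gt0 ltr0n/= divr_gt0// mulr_gt0// ltr_wpDl.
    - by rewrite gt_min; apply/orP; left; lra.
    - have : Num.min 4^-1 (e / (8 * (N + 1))) <= e / (8 * (N + 1)) by rewrite ge_min lexx orbT.
      rewrite ler_pdivlMr ?mulr_gt0 ?ltr_wpDl//.
      set m := Num.min _ _; have m0 : 0 <= m.
        by rewrite le_min invr_ge0 ler0n/= divr_ge0 ?ltW// mulr_gt0// ltr_wpDl.
      by nra.
  have [psi [tpsi cpsi psi01 psi1 psi0]] := unit_itv_approx d d0 d2.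
  (* [psi] and the unit interval differ only on two margins of length [d], by at most 1. *)
  pose B y : R := \1_(`[0, d] : set R) y + \1_(`[1 - d, 1] : set R) y.
  have iB : Lebesgue_integrable B by apply: integrable_add; exact: integrable_indic_itv.
  have IB : \int[mu]_y B y = 2 * d.
    rewrite /B RintegralD//; [|exact: integrable_indic_itv..].
    by rewrite !Rintegral_indic_itvcc//; lra.
  have B0 y : 0 <= B y by rewrite addr_ge0 ?indic_nneg.
  have BB (I : R) u : 0 <= I <= 1 -> (0 < u < 1 -> I = 1) -> (u < 0 \/ 1 < u -> I = 0) ->
      `|I - psi u| <= B u.
    move=> I01 I1 I0; have /andP[s0 s1] := psi01 u; have /andP[i0 i1] := I01.
    have [ud|du] := leP d u.
      have [u1|u1] := leP u (1 - d).
        by rewrite psi1 ?ud// I1 ?subrr ?normr0//; lra.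
      have [u2|u2] := leP u 1; last first.
        by rewrite psi0 ?I0 ?subrr ?normr0//; right => //; exact: ltW.
      have : 1 <= B u.
        by rewrite /B !indicE [u \in `[1 - d, 1]]mem_set ?lerDr//= in_itv/= (ltW u1) u2.
      by apply: le_trans; rewrite ler_norml; apply/andP; split; lra.
    have [u0|u0] := leP 0 u; last first.
      by rewrite psi0 ?I0 ?subrr ?normr0//; left => //; exact: ltW.
    have : 1 <= B u.
      by rewrite /B !indicE [u \in `[0, d]]mem_set ?lerDl//= in_itv/= u0 ltW.
    by apply: le_trans; rewrite ler_norml; apply/andP; split; lra.
  have ipsi := test_integrable _ tpsi.
  have Ipsi : `|1 - \int[mu]_y psi y| <= 2 * d.
    have i01 : Lebesgue_integrable (\1_(`[0, 1] : set R) : R -> R) by exact: integrable_indic_itv.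
    have I01 : \int[mu]_y (\1_(`[0, 1] : set R) y) = 1 :> R.
      by rewrite Rintegral_indic_itvcc// subr0.
    rewrite -[X in `|X - _|]I01 -RintegralB// -IB.
    apply: le_trans (le_normr_Rintegral measurableT (integrable_sub _ _ i01 ipsi)) _.
    apply: le_Rintegral => //; first exact: (integrable_norm (integrable_sub _ _ i01 ipsi)).
    move=> y _; apply: BB.
    - by rewrite indic_nneg/= indicE; case: (_ \in _).
    - by move=> /andP[h1 h2]; rewrite indicE mem_set//= in_itv/= !ltW.
    - move=> h; rewrite indicE memNset//= in_itv/= => /andP[h1 h2].
      by case: h; rewrite ltNge ?h1 ?h2.
  have pvpsi := pvV x psi tpsi.
  near=> h.
  have h0 : h != 0 by near: h; exact: nbhs_dnbhs_neq.
  have nh0 : 0 < `|h| by rewrite normr_gt0.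
  have hp : `|h| <= x - p1 by near: h; apply: dnbhs0_le; lra.
  have hq : `|h| <= q1 - x by near: h; apply: dnbhs0_le; lra.
  have h1 : `|V x * \int[mu]_y psi y - rescale W x h psi| <= e / 2.
    near: h; move/cvgrPdist_le : pvpsi; apply; lra.
  have tdil := test_dil _ x _ h0 tpsi.
  have rE : rescale W x h psi = `|h|^-1 * \int[mu]_z (dil psi x h z * Vb z).
    rewrite rescaleE VbE// => z; rewrite /dil => hz.
    have : `|(z - x) / h| <= 1 by rewrite leNgt; apply: contra hz => /cpsi ->.
    rewrite normrM normfV ler_pdivrMr// mul1r => hz'.
    have := le_trans hz' hp; rewrite ler_distl subKr => /andP[-> _]/=.
    by have := le_trans hz' hq; rewrite ler_distl [x + (q1 - x)]addrC subrK => /andP[].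
  pose I := segment_indic x h.
  have mI : measurable_fun setT I by rewrite /I /segment_indic; case: (0 < h); exact: indic_mfun.
  have I1 z : `|I z| <= 1.
    by have [/andP[i0 i1] _ _] := segment_indic_unit x h z h0; rewrite ger0_norm.
  have iI : Lebesgue_integrable (fun z => Vb z * I z) := integrable_bdd_mul _ _ 1 iV mI I1.
  have qE : h^-1 *: (F (h + x) - F x) = `|h|^-1 * \int[mu]_z (Vb z * I z).
    rewrite /GRing.scale/= /I /segment_indic; have [hpos|hneg] := ltP 0 h.
      by rewrite (gtr0_norm hpos) primB// lerDr ltW.
    have hn : h < 0 by rewrite lt_neqAle h0.
    rewrite -primB//; last by rewrite gerDr.
    by rewrite (ltr0_norm hn) invrN mulNr -mulrN opprB.
  have iW : Lebesgue_integrable (fun z => dil psi x h z * Vb z).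
    have [M _ HM] := test_bounded _ tdil.
    have := integrable_bdd_mul _ _ M iV (continuous_mfun _ (test_continuous_fun _ tdil)) HM.
    by under eq_fun do rewrite mulrC.
  have h2 : `|h^-1 *: (F (h + x) - F x) - rescale W x h psi| <= N * (2 * d).
    rewrite qE rE -mulrBr normrM normfV normr_id mulrC ler_pdivrMr//.
    rewrite -RintegralB//.
    have iD := integrable_sub _ _ iI iW.
    apply: le_trans (le_normr_Rintegral measurableT iD) _.
    have iBd := integrable_affine _ x _ h0 iB.
    rewrite -mulrA [2 * d * _]mulrC -IB -(Rintegral_affine _ x _ h0 iB) -RintegralZl//.
    apply: le_Rintegral => //.
    - exact: (integrable_norm iD).
    - exact: (integrable_cmul _ _ iBd).
    move=> z _; rewrite [dil _ _ _ _ * _]mulrC -mulrBr normrM; apply: ler_pM => //.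
    apply: BB.
    - by have [] := segment_indic_unit x h z h0.
    - by have [] := segment_indic_unit x h z h0.
    - by have [] := segment_indic_unit x h z h0.
  have h3 : `|V x * (1 - \int[mu]_y psi y)| <= N * (2 * d).
    by rewrite normrM; apply: ler_pM => //; exact: V_bounded.
  rewrite (_ : _ - _ = V x * (1 - \int[mu]_y psi y) +
    (V x * \int[mu]_y psi y - rescale W x h psi) -
    (h^-1 *: (F (h + x) - F x) - rescale W x h psi)); last by ring.
  apply: le_trans (ler_normB _ _) _; apply: le_trans (lerD (ler_normD _ _) (lexx _)) _.
  apply: le_trans (lerD (lerD h3 h1) h2) _.
  rewrite (_ : N * (2 * d) + e / 2 + N * (2 * d) = N * d * 4 + e / 2); last by ring.
  by rewrite [leRHS]splitr lerD2r.
have D : derivable F x 1.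
  by apply/cvg_ex; exists (V x); under eq_fun do rewrite scaler1; exact: H.
by split=> //; rewrite -derive1E /derive1; exact/cvg_lim.
Unshelve. all: by end_near. Qed.

Let F_lipschitz : p1 <= q1 -> forall x y, `|F x - F y| <= N * `|x - y|.
Proof.
by move=> pq x y; apply: prim_lipschitz; [exact: Vb_integrable|exact: Vb_bounded].
Qed.

Let F_continuous : p1 <= q1 -> continuous F.
Proof. by move=> pq; apply: prim_continuous_lipschitz; exact: F_lipschitz. Qed.

Let Phi c t := \int[mu]_y (F (c + t * y) * bump y).

Let affine_continuous c t : continuous (fun y : R => c + t * y).
Proof. by move=> y; apply: cvgD; [exact: cvg_cst|apply: cvgMr; exact: cvg_id]. Qed.

Let Phi_integrable c t : p1 <= q1 -> Lebesgue_integrable (fun y => F (c + t * y) * bump y).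
Proof.
move=> pq.
have cf : continuous (fun y => F (c + t * y) * bump y).
  move=> y; apply: cvgM; last exact: test_continuous_fun test_bump y.
  exact: (continuous_comp (affine_continuous c t y) (F_continuous pq _)).
have cs : csupp 1 (fun y => F (c + t * y) * bump y) by move=> y y1; rewrite csupp_bump// mulr0.
have [M HM] := csupp_bounded _ _ cf cs.
exact: (integrable_csupp _ _ _ (continuous_mfun _ cf) HM cs).
Qed.

Let Phi0 c : Phi c 0 = F c.
Proof.
rewrite /Phi; under eq_Rintegral do rewrite mul0r addr0.
by rewrite RintegralZl ?Rintegral_bump ?mulr1//; exact/test_integrable/test_bump.
Qed.

Let Phi_lipschitz c : p1 <= q1 -> forall s t, `|Phi c s - Phi c t| <= N * `|s - t|.
Proof.
move=> pq s t; have i1 := Phi_integrable c s pq; have i2 := Phi_integrable c t pq.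
have ib := test_integrable _ test_bump.
rewrite /Phi -RintegralB//.
have id := integrable_sub _ _ i1 i2.
apply: le_trans (le_normr_Rintegral measurableT id) _.
have -> : N * `|s - t| = \int[mu]_y (N * `|s - t| * bump y).
  by rewrite RintegralZl// Rintegral_bump mulr1.
have ic : Lebesgue_integrable (fun y => N * `|s - t| * bump y) by apply: integrable_cmul.
apply: le_Rintegral; [exact: measurableT|exact: (integrable_norm id)|exact ic|].
move=> y _; rewrite -mulrBl normrM (ger0_norm (bump_ge0 y)).
have [y1|y1] := ltP 1 `|y|; first by rewrite csupp_bump// !mulr0.
rewrite ler_wpM2r ?bump_ge0//; apply: le_trans (F_lipschitz pq _ _) _.
rewrite ler_wpM2l ?N0// (_ : c + s * y - (c + t * y) = (s - t) * y); last by ring.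
by rewrite normrM ler_piMr.
Qed.

(** Differentiation under the integral, dominated by N |y bump(y)|; the resulting integral of [V] is
    [W] on a test function supported in [p1, q1]. *)
Let Phi_derive c t : 0 < t -> p1 < c - t -> c + t < q1 ->
  derivable (Phi c) t 1 /\ derive1 (Phi c) t = rescale W c t ybump.
Proof.
move=> tp pt qt; have tn0 : t != 0 by rewrite gt_eqF.
have pq : p1 <= q1 by lra.
pose t1 := (Num.min (c - p1) (q1 - c)).
have tt1 : t < t1 by rewrite lt_min; apply/andP; split; lra.
have inside s y : 0 < s < t1 -> `|y| <= 1 -> p1 < c + s * y < q1.
  move=> /andP[s0]; rewrite lt_min => /andP[s1 s2]; rewrite ler_norml => /andP[y1 y2].
  have : s * y <= s * 1 by rewrite ler_wpM2l// ltW.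
  have : s * -1 <= s * y by rewrite ler_wpM2l// ltW.
  by rewrite mulr1 mulrN1; lra.
pose f s y := F (c + s * y) * bump y.
have df s y : 0 < s < t1 -> is_derive s (1 : R) (f^~ y) (V (c + s * y) * ybump y).
  move=> hs; rewrite /f; have [y1|y1] := ltP 1 `|y|.
    rewrite csupp_ybump// mulr0 csupp_bump// (_ : (fun _ => _) = cst (0 : R)); last first.
      by apply/funext => u; rewrite mulr0.
    exact: (is_derive_cst (0 : R) s (1 : R)).
  have da : is_derive s (1 : R) (fun s : R => c + s * y) y.
    have := derive_fD (cst c) _ s _ _ (is_derive_cst c s (1 : R))
      (derive_fM id (cst y) s _ _ (is_derive_id s (1 : R)) (is_derive_cst y s (1 : R))).
    by move=> /is_derive_eq; apply; rewrite /= mulr0 add0r mulr1 add0r.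
  have dF := F_derive _ (inside s y hs y1).
  have := derive_fM _ (cst (bump y)) s _ _ (derive_fcomp F _ s _ _ dF da) (is_derive_cst (bump y) s (1 : R)).
  by move=> /is_derive_eq; apply; rewrite /= mulr0 add0r /ybump; ring.
have tI : (`]0, t1[ : set R) t by rewrite /= in_itv/= tp.
have iy := integrable_norm (test_integrable _ test_ybump).
have intf s : (`]0, t1[ : set R) s -> Lebesgue_integrable (f s) by move=> _; exact: Phi_integrable.
have derf s y : (`]0, t1[ : set R) s -> setT y -> derivable (f^~ y) s 1.
  by rewrite /= in_itv/= => hs _; case: (df s y hs).
have ub s y : (`]0, t1[ : set R) s -> setT y -> `|partial1of2 f s y| <= N * `|ybump y|.
  rewrite /= in_itv/= => hs _; rewrite partial1of2E.
  have [_ ->] := df s y hs; rewrite normrM.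
  have [y1|y1] := ltP 1 `|y|; first by rewrite csupp_ybump// normr0 !mulr0.
  by rewrite ler_wpM2r// V_bounded//; have /andP[h1 h2] := inside s y hs y1; rewrite !ltW.
have g0 y : 0 <= N * `|ybump y| by rewrite mulr_ge0// N0.
have iG : Lebesgue_integrable (fun y => N * `|ybump y|) := integrable_cmul _ _ iy.
split; first exact: (derivable_under_integral measurableT tI intf derf g0 iG ub).
have -> : derive1 (Phi c) t = \int[mu]_y partial1of2 f t y.
  exact: (differentiation_under_integral measurableT tI intf derf g0 iG ub).
have ht : 0 < t < t1 by rewrite tp.
pose g y := V (c + t * y) * ybump y.
have -> : \int[mu]_y partial1of2 f t y = \int[mu]_y g y.
  by apply: eq_Rintegral => y _; rewrite partial1of2E; have [_ ->] := df t y ht.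
have ig : Lebesgue_integrable g.
  have [M M0 HM] := test_bounded _ test_ybump.
  apply: (integrable_csupp 1 _ (N * M)).
  - apply: measurable_funM; last exact: (continuous_mfun _ (test_continuous_fun _ test_ybump)).
    apply: measurableT_comp; first exact: (value_mfun W linW contW V pvV).
    exact: (continuous_mfun _ (affine_continuous c t)).
  - move=> y; have [y1|y1] := ltP 1 `|y|.
      by rewrite /g csupp_ybump// mulr0 normr0 mulr_ge0// N0.
    rewrite normrM; apply: ler_pM => //; apply: V_bounded.
    by have /andP[h1 h2] := inside t y ht y1; rewrite !ltW.
  - by move=> y y1; rewrite /g csupp_ybump// mulr0.
have sup z : dil ybump c t z != 0 -> p1 <= z <= q1.
  rewrite /dil => hz; have : `|(z - c) / t| <= 1.
    by rewrite leNgt; apply: contra hz => /csupp_ybump ->.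
  move=> /(inside t _ ht); rewrite mulrC divfK// addrC subrK => /andP[h1 h2].
  by rewrite !ltW.
rewrite rescaleE (distr_value_integral_itv _ (test_dil _ c t tn0 test_ybump) sup).2.
have -> : \int[mu]_z (dil ybump c t z * V z) = \int[mu]_z dil g c t z.
  by apply: eq_Rintegral => z _; rewrite /dil /g [t * _]mulrC divfK// [c + _]addrC subrK mulrC.
by rewrite Rintegral_affine// mulKf// normr_eq0.
Qed.

Lemma derive_sign f x d : is_derive x (1 : R) f d -> d != 0 ->
  exists2 e, 0 < e & forall h, 0 < `|h| < e -> 0 < d * h * (f (x + h) - f x).
Proof.
move=> [df fd] d0.
have H : (fun h : R => h^-1 *: (f (h + x) - f x)) @ 0^' --> d.
  have [_ E] := is_deriveP _ _ _ (DeriveDef df fd); rewrite -E /derive1.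
  apply/cvg_ex; move: df => /cvg_ex[l Hl]; exists l; apply: cvg_trans Hl.
  by apply: near_eq_cvg; apply: nearW => h; rewrite /= scaler1.
move/cvgrPdist_lt : H => /(_ `|d|); rewrite normr_gt0 => /(_ d0)[e /= e0 He].
exists e => // h /andP[h0 he]; have hn0 : h != 0 by rewrite -normr_gt0.
have := He h; rewrite /= sub0r normrN => /(_ he hn0); rewrite /GRing.scale/= [h + x]addrC.
set q := f (x + h) - f x => hq.
have : 0 < d * (h^-1 * q).
  have : `|d - h^-1 * q| ^+ 2 < `|d| ^+ 2 by rewrite ltr_pXn2r ?nnegrE.
  rewrite !real_normK ?num_real// sqrrB => k.
  have : 0 <= (h^-1 * q) ^+ 2 by exact: sqr_ge0.
  by move: k; set u := h^-1 * q; rewrite -mulr_natl; nra.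
have -> : d * h * q = d * (h^-1 * q) * (h * h) by field.
by move=> k; rewrite mulr_gt0// -expr2 exprn_even_gt0.
Qed.

Variable E : set R.
Hypothesis cE : countable E.
Hypothesis pos : forall x, p1 < x < q1 -> ~ E x -> exists e0 t1 : R,
  [/\ 0 < e0, 0 < t1 & forall t, 0 < t < t1 -> e0 <= rescale (deriv_distr W) x t hat].

(* A maximum of [F - lam * id], whose abscissa lies outside [E] for almost every
   slope [lam], contradicts the growth of the mean of [F] along [bump]. *)
Lemma value_mono_bounded p q : p1 < p -> p < q -> q < q1 -> V p <= V q.
Proof.
move=> p1p pq qq1; rewrite leNgt; apply/negP => VqVp.
have pq1 : p1 <= q1 by lra.
(* The countable set V(E) cannot fill ]V q, V p[, which has positive measure. *)
have [lam [lq lp lE]] : exists lam, [/\ V q < lam, lam < V p & forall x, E x -> V x <> lam].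
  apply: contrapT => /forallNP H.
  have sub : (`]V q, V p[ : set R) `<=` V @` E.
    move=> l /=; rewrite in_itv/= => /andP[l1 l2]; apply: contrapT => nl; apply: (H l).
    by split=> // x Ex Vx; apply: nl; exists x.
  have c0 : countable (`]V q, V p[ : set R) := sub_countable (subset_card_le sub) (card_le_trans (card_image_le _ _) cE).
  have := countable_lebesgue_measure0 c0.
  rewrite lebesgue_measure_itv/= lte_fin VqVp -EFinB => /eqP.
  by rewrite eqe subr_eq0 gt_eqF.
pose G z := F z - lam * z.
have cG : continuous G.
  by move=> z; apply: cvgB; [exact: F_continuous|apply: cvgMr; exact: cvg_id].
have dG z : p1 < z < q1 -> is_derive z (1 : R) G (V z - lam).
  move=> hz; have := derive_fD _ _ z _ _ (F_derive _ hz)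
     (derive_fN _ _ _ (derive_fZ id z _ lam (is_derive_id z (1 : R)))).
  by rewrite mulr1.
have [c cI Hc] := EVT_max (ltW pq) (continuous_subspaceT cG).
have {}Hc t : p <= t <= q -> G t <= G c by move=> ht; apply: Hc; rewrite in_itv.
move: cI; rewrite in_itv/= => /andP[pc cq].
have ci : p1 < c < q1 by apply/andP; split; lra.
(* If V(c) > lam, then [c] is not [q], since V(q) < lam, and G exceeds G(c) just to the right;
   symmetrically on the left, where V(p) > lam excludes [p]. *)
have Vc : V c = lam.
  apply/eqP; rewrite -subr_eq0; apply/negPn/negP => d0.
  have [e e0 He] := derive_sign _ _ _ (dG c ci) d0.
  have [dpos|dneg] := ltP 0 (V c - lam).
    have cq' : c < q by rewrite lt_neqAle cq andbT; apply/eqP => E1; rewrite E1 in dpos; lra.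
    pose h := Num.min (e / 2) (q - c).
    have h0 : 0 < h by rewrite lt_min divr_gt0//= subr_gt0.
    have h1 : h <= e / 2 by rewrite ge_min lexx.
    have h2 : h <= q - c by rewrite ge_min lexx orbT.
    have := He h; rewrite gtr0_norm// h0/= => /(_ _); rewrite pmulr_rgt0 ?mulr_gt0// subr_gt0.
    have he : h < e by lra.
    move=> /(_ he); rewrite ltNge Hc//; apply/andP; split; lra.
  have {}dneg : V c - lam < 0 by rewrite lt_neqAle d0.
  have pc' : p < c by rewrite lt_neqAle pc andbT; apply/eqP => E1; rewrite -E1 in dneg; lra.
  pose h := Num.min (e / 2) (c - p).
  have h0 : 0 < h by rewrite lt_min divr_gt0//= subr_gt0.
  have h1 : h <= e / 2 by rewrite ge_min lexx.
  have h2 : h <= c - p by rewrite ge_min lexx orbT.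
  have := He (- h); rewrite normrN gtr0_norm// h0/= => /(_ _); rewrite pmulr_rgt0 ?nmulr_rgt0 ?oppr_lt0// subr_gt0.
  have he : h < e by lra.
  move=> /(_ he); rewrite ltNge Hc//; apply/andP; split; lra.
have nEc : ~ E c by move=> /lE.
have [e0 [t1 [e00 t10 Ht]]] := pos c ci nEc.
have pc' : p < c by rewrite lt_neqAle pc andbT; apply/eqP => E1; move: lp; rewrite E1 Vc ltxx.
have cq' : c < q by rewrite lt_neqAle cq andbT; apply/eqP => E1; move: lq; rewrite -E1 Vc ltxx.
pose t2 := Num.min (t1 / 2) (Num.min (c - p) (q - c)).
have t20 : 0 < t2 by rewrite !lt_min divr_gt0//= !subr_gt0 pc'.
have t2a : t2 <= t1 / 2 by rewrite ge_min lexx.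
have t2b : t2 <= c - p by rewrite !ge_min lexx orbT.
have t2c : t2 <= q - c by rewrite !ge_min lexx !orbT.
have D t : t \in `]0, t2[%R -> derivable (Phi c) t 1 /\ derive1 (Phi c) t = rescale W c t ybump.
  by rewrite in_itv/= => /andP[t0' tt2]; apply: Phi_derive => //; lra.
have inc : Phi c 0 < Phi c t2.
  apply: (@gtr0_derive1_incr _ (Phi c) 0 t2) => //.
  - by move=> t /D[].
  - move=> t ht; have [_ ->] := D t ht; move: ht; rewrite in_itv/= => /andP[tp tt2].
    have : e0 <= rescale (deriv_distr W) c t hat by apply: Ht; rewrite tp/=; lra.
    rewrite rescale_deriv_hat// => k.
    have : 0 < hat_slope / t * rescale W c t ybump by exact: lt_le_trans k.
    by rewrite pmulr_rgt0// divr_gt0// hat_slope_gt0.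
  - apply: continuous_subspaceT; apply: prim_continuous_lipschitz.
    exact: Phi_lipschitz.
move: inc; rewrite Phi0 ltNge => /negP; apply.
have ib := test_integrable _ test_bump; have iy := test_integrable _ test_ybump.
(* Maximality puts F(c + t2 y) below the line F(c) + lam t2 y on the support of [bump]; as [ybump]
   has integral 0, the mean of this line is F(c), against the strict growth of [Phi c]. *)
have -> : F c = \int[mu]_y (F c * bump y + lam * t2 * ybump y).
  rewrite RintegralD//; [|exact: integrable_cmul..].
  by rewrite [X in X + _]RintegralZl// [X in _ + X]RintegralZl// Rintegral_bump Rintegral_ybump mulr1 mulr0 addr0.
apply: le_Rintegral => //; first exact: Phi_integrable.
  by apply: integrable_add; exact: integrable_cmul.
move=> y _; have [y1|y1] := ltP 1 `|y|.
  by rewrite csupp_ybump// csupp_bump// !mulr0 addr0.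
rewrite [leRHS](_ : _ = (F c + lam * (t2 * y)) * bump y); last by rewrite /ybump; ring.
rewrite ler_wpM2r ?bump_ge0//.
have : G (c + t2 * y) <= G c.
  apply: Hc; move: y1; rewrite ler_norml => /andP[y1 y2].
  have : t2 * y <= t2 * 1 by rewrite ler_wpM2l// ltW.
  have : t2 * -1 <= t2 * y by rewrite ler_wpM2l// ltW.
  by rewrite mulr1 mulrN1 => k1 k2; apply/andP; split; lra.
by rewrite /G; lra.
Qed.

End BoundedCase.

(** * Monotonicity of distributions with point values everywhere *)

Section Baire.
Context {R : realType}.
Implicit Types (P : set R) (x y z r : R).

(** If no portion of [P] near [x0] lay in a single [A n], nested closed intervals centred in [P]
    could avoid the sets [A n] one after the other. *)
Lemma baire_closed P (A : nat -> set R) x0 r0 : closed P -> (forall n, closed (A n)) ->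
  (forall x, P x -> exists n, A n x) -> P x0 -> 0 < r0 ->
  exists n x1 r1, [/\ P x1, 0 < r1, (forall y, `|y - x1| <= r1 -> `|y - x0| < r0) &
    forall y, P y -> `|y - x1| <= r1 -> A n y].
Proof.
move=> clP clA PA Px0 r00; apply: contrapT => H.
pose T := {xr : R * R | [/\ P xr.1, 0 < xr.2 & forall y, `|y - xr.1| <= xr.2 -> `|y - x0| < r0]}.
have step (n : nat) (s : T) : {s' : T | [/\ (sval s').2 <= (sval s).2 / 2,
    (forall y, `|y - (sval s').1| <= (sval s').2 -> `|y - (sval s).1| <= (sval s).2) &
    forall y, `|y - (sval s').1| <= (sval s').2 -> ~ A n y]}.
  apply: cid; case: s => -[x r] [/= Px r_0 xr].
  have [y [Py yx nAy]] : exists y, [/\ P y, `|y - x| <= r / 2 & ~ A n y].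
    apply: contrapT => /forallNP Hy; apply: H; exists n, x, (r / 2); split=> //.
    - by rewrite divr_gt0.
    - by move=> y hy; apply: xr; lra.
    - by move=> y Py hy; apply: contrapT => nA; apply: (Hy y).
  have : nbhs y (~` A n) by apply: open_nbhs_nbhs; split=> //; exact: closed_openC.
  move=> [e /= e0 He].
  pose r' := Num.min (e / 2) (r / 2).
  have r'0 : 0 < r' by rewrite lt_min !divr_gt0.
  have r'e : r' <= e / 2 by rewrite ge_min lexx.
  have r'r : r' <= r / 2 by rewrite ge_min lexx orbT.
  have sub z : `|z - y| <= r' -> `|z - x| <= r.
    move=> hz; have -> : z - x = (z - y) + (y - x) by ring.
    by apply: le_trans (ler_normD _ _) _; lra.
  have Hs : [/\ P (y, r').1, 0 < (y, r').2 & forall z, `|z - (y, r').1| <= (y, r').2 -> `|z - x0| < r0].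
    by split=> //= z hz; apply: xr; exact: sub.
  exists (exist _ (y, r') Hs); split=> //= z hz; apply: He; rewrite /= distrC; lra.
have H0 : [/\ P (x0, r0 / 2).1, 0 < (x0, r0 / 2).2 & forall z, `|z - (x0, r0 / 2).1| <= (x0, r0 / 2).2 -> `|z - x0| < r0].
  by split=> //= [|z hz]; [rewrite divr_gt0|lra].
pose s := fix s n : T := if n is n'.+1 then sval (step n' (s n')) else exist _ (x0, r0 / 2) H0.
have sS n : [/\ (sval (s n.+1)).2 <= (sval (s n)).2 / 2,
    (forall y, `|y - (sval (s n.+1)).1| <= (sval (s n.+1)).2 -> `|y - (sval (s n)).1| <= (sval (s n)).2) &
    forall y, `|y - (sval (s n.+1)).1| <= (sval (s n.+1)).2 -> ~ A n y].
  exact: (svalP (step n (s n))).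
pose x n := (sval (s n)).1; pose r n := (sval (s n)).2.
have Px n : P (x n) by case: (svalP (s n)).
have rp n : 0 < r n by case: (svalP (s n)).
have nest n m y : `|y - x (n + m)%N| <= r (n + m)%N -> `|y - x n| <= r n.
  elim: m => [|m IH]; first by rewrite addn0.
  by rewrite addnS => hy; apply: IH; have [_ H2 _] := sS (n + m)%N; exact: H2.
have xx n m : `|x (n + m)%N - x n| <= r n.
  by apply: (nest n m); rewrite subrr normr0 ltW.
have lu n m : x n - r n <= x m + r m.
  have [nm|mn] := leqP n m.
    have := nest n (m - n)%N (x m + r m); rewrite subnKC// addrAC subrr add0r (ger0_norm (ltW (rp m))).
    by move=> /(_ (lexx _)); rewrite ler_distl => /andP[].
  have := nest m (n - m)%N (x n - r n); rewrite subnKC ?(ltnW mn)// addrAC subrr sub0r normrN (ger0_norm (ltW (rp n))).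
  by move=> /(_ (lexx _)); rewrite ler_distl => /andP[].
(* The supremum of the left ends lies in all the nested intervals, and in [P] because their radii at
   least halve at each step. *)
pose L := [set x n - r n | n in [set: nat]].
have Lub n : ubound L (x n + r n) by move=> _ [m _ <-].
have L0 : L !=set0 by exists (x 0%N - r 0%N), 0%N.
pose z := sup L.
have zb n : `|z - x n| <= r n.
  rewrite ler_distl; apply/andP; split.
    by apply: ub_le_sup; [exists (x 0%N + r 0%N); exact: Lub|exists n].
  by apply: ge_sup => //; exact: Lub.
have rb n : r n <= r 0%N / 2 ^+ n.
  elim: n => [|n IH]; first by rewrite expr0 divr1.
  have [h _ _] := sS n; apply: (le_trans h).
  by rewrite exprSr invfM mulrA ler_wpM2r.
have Pz : P z.
  have -> : P = closure P by exact/closure_id.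
  move=> B [e /= e0 He]; near \oo => n; exists (x n); split=> //; apply: He => /=.
  apply: le_lt_trans (zb n) _; apply: le_lt_trans (rb n) _.
  have : 1 / 2 ^+ n < e / r 0%N.
    by near: n; exact: (near_infty_natSinv_expn_lt (PosNum (divr_gt0 e0 (rp 0%N)))).
  by rewrite mul1r ltr_pdivlMr// mulrC.
have [n Az] := PA z Pz.
by have [_ _ H3] := sS n; exact: (H3 z (zb n.+1)).
Unshelve. all: by end_near. Qed.

End Baire.

(** * From bounded means to all of ]a, b[ by Baire's theorem *)

Section Monotonicity.
Context {R : realType}.
Variable W : @functional R.
Hypothesis linW : test_linear W.
Hypothesis contW : test_continuous W.
Variable V : R -> R.
Hypothesis pvV : forall x, point_value W x (V x).
Variables (a b : R) (E : set R).
Hypothesis cE : countable E.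
Hypothesis pos : forall x, a < x < b -> ~ E x -> exists e0 t1 : R,
  [/\ 0 < e0, 0 < t1 & forall t, 0 < t < t1 -> e0 <= rescale (deriv_distr W) x t hat].
Implicit Types (f phi chi : R -> R) (x y z s t r : R) (m n : nat).

(** One index bounds the means and, through t < 1/(n + 1), the scales; the condition weakens as [n]
    grows. *)
Let bnd n x := forall t, 0 < t -> t * n.+1%:R < 1 -> `|rescale W x t bump| <= n%:R.

Let bndW n m x : (n <= m)%N -> bnd n x -> bnd m x.
Proof.
move=> nm bn t t0 tm; apply: (@le_trans _ _ n%:R); last by rewrite ler_nat.
by apply: bn => //; apply: le_lt_trans tm; rewrite ler_pM2l// ler_nat.
Qed.

Let omega : set R := [set x | exists n, \forall y \near x, bnd n y].

Let omega_open : open omega.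
Proof.
rewrite openE => x [n Hn]; rewrite /interior.
have := near_join Hn.
by apply: filterS => y Hy; exists n.
Qed.

Let omega_segment p q : (forall x, p <= x <= q -> omega x) ->
  exists n, forall x, p <= x <= q -> bnd n x.
Proof.
move=> H.
have cv := (compact_near_coveringP _).1 (@segment_compact R p q).
have [|n _ Hn] := cv nat \oo (fun n => bnd n) _.
  move=> x /=; rewrite in_itv/= => hx; have [n Hn] := H x hx.
  exists ([set y | bnd n y], [set m | (n <= m)%N]); first by split=> //; exists n.
  by move=> [y m] /= [by_ nm]; exact: bndW by_.
by exists n => x hx; apply: (Hn n (leqnn n)); rewrite /= in_itv.
Qed.

(** With c = 2 or -2 the kernel of scale [t] lives at distance between t and 3 t from [x], on one
    side: the value at an end of a gap is a limit of means taken strictly inside the gap. *)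
Let shifted_cvg x c : rescale W (x + c * t) t bump @[t --> 0^'+] --> V x.
Proof.
have tb := test_shift _ c test_bump.
have := pvV x _ tb.
have -> : \int[mu]_y bump (y - c) = 1.
  rewrite (_ : (fun y => bump (y - c)) = dil bump c 1); last by apply/funext => y; rewrite /dil divr1.
  by rewrite Rintegral_dil_bump ?oner_neq0// normr1.
rewrite mulr1 => H.
have : rescale W x t (fun y => bump (y - c)) @[t --> 0^'+] --> V x.
  exact: cvg_dnbhs_at_right H.
apply: cvg_trans; apply: near_eq_cvg; near=> t.
by rewrite !rescaleE dil_shift//; near: t; exact: nbhs_right_neq.
Unshelve. all: by end_near. Qed.

Section Component.
Variables (e g : R).
Hypotheses (ae : a <= e) (gb : g <= b).
Hypothesis eg : forall x, e < x < g -> omega x.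

Let bounded_inside p q : e < p -> q < g -> exists N t0 : R, 0 < t0 /\
  forall x t, p <= x <= q -> 0 < t < t0 -> `|rescale W x t bump| <= N.
Proof.
move=> ep qg; have [|n Hn] := omega_segment p q.
  by move=> x /andP[px xq]; apply: eg; rewrite (lt_le_trans ep px) (le_lt_trans xq qg).
exists n%:R, n.+1%:R^-1; split=> // x t hx /andP[t0 tn]; apply: (Hn x hx t t0).
by rewrite -ltr_pdivlMr// mul1r.
Qed.

Let value_mono p q : e < p -> p < q -> q < g -> V p <= V q.
Proof.
move=> ep pq qg.
have [||N [t0 [t00 HN]]] := bounded_inside ((e + p) / 2) ((q + g) / 2); [lra|lra|].
apply: (value_mono_bounded W linW contW V pvV ((e + p) / 2) ((q + g) / 2) N t0 t00 HN E cE) => //; [|lra|lra].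
by move=> x /andP[h1 h2]; apply: pos; have := ae; have := gb; move=> k1 k2; apply/andP; split; lra.
Qed.

(** Inside the gap a mean is an integral of values against a nonnegative kernel of total mass 1. *)
Let rescale_between y t A B : 0 < t -> e < y - t -> y + t < g ->
  (forall z, y - t <= z <= y + t -> A <= V z <= B) -> A <= rescale W y t bump <= B.
Proof.
move=> t0 ey yg HAB; have tn0 : t != 0 by rewrite gt_eqF.
have [N [t1 [t10 HN]]] := bounded_inside (y - t) (y + t) ey yg.
have td := test_dil _ y _ tn0 test_bump; have id := test_integrable _ td.
have [|I E1] := distr_value_integral_itv W linW contW V pvV (y - t) (y + t) N t1 t10 HN _ td.
  move=> z; rewrite /dil => hz; have : `|(z - y) / t| <= 1.
    by rewrite leNgt; apply: contra hz => /csupp_bump ->.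
  by rewrite normrM normfV (gtr0_norm t0) ler_pdivrMr// mul1r ler_distl.
rewrite rescaleE E1 gtr0_norm//.
have Id c : \int[mu]_z (c * dil bump y t z) = c * t.
  by rewrite RintegralZl// Rintegral_dil_bump// gtr0_norm.
have supp z : dil bump y t z = 0 \/ A <= V z <= B.
  rewrite /dil; have [h|h] := ltP 1 `|(z - y) / t|; first by left; rewrite csupp_bump.
  right; apply: HAB; move: h.
  by rewrite normrM normfV (gtr0_norm t0) ler_pdivrMr// mul1r ler_distl.
have dge z : 0 <= dil bump y t z by exact: bump_ge0.
rewrite mulrC ler_pdivlMr// ler_pdivrMr// -!Id; apply/andP; split.
  apply: le_Rintegral; [exact: measurableT|exact: integrable_cmul|exact I|].
  move=> z _; rewrite mulrC; have [->|/andP[h1 h2]] := supp z; first by rewrite !mul0r.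
  by rewrite ler_wpM2l.
apply: le_Rintegral; [exact: measurableT|exact I|exact: integrable_cmul|].
move=> z _; rewrite [leRHS]mulrC; have [->|/andP[h1 h2]] := supp z; first by rewrite !mul0r.
by rewrite ler_wpM2l.
Qed.

Let value_left p : e < p < g -> V e <= V p.
Proof.
move=> /andP[ep pg]; have := shifted_cvg e 2; move=> /cvgr_to_le; apply; near=> t.
have t0 : 0 < t by near: t; exact: nbhs_right_gt.
have tp : t < (p - e) / 3 by near: t; apply: nbhs_right_lt; rewrite divr_gt0// subr_gt0.
(* Only the left inequality is used; V(p) serves as the upper bound required by [rescale_between],
   and e + t / 2 is a point of the gap to the left of the support. *)
suff /andP[] : V (e + t / 2) <= rescale W (e + 2 * t) t bump <= V p by [].
apply: rescale_between => //; [lra|lra|].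
move=> z /andP[z1 z2]; apply/andP; split; first by apply: value_mono; lra.
by apply: value_mono => //; lra.
Unshelve. all: by end_near. Qed.

Let value_right p : e < p < g -> V p <= V g.
Proof.
move=> /andP[ep pg]; have := shifted_cvg g (- 2); move=> /cvgr_to_ge; apply; near=> t.
have t0 : 0 < t by near: t; exact: nbhs_right_gt.
have tp : t < (g - p) / 3 by near: t; apply: nbhs_right_lt; rewrite divr_gt0// subr_gt0.
suff /andP[] : V p <= rescale W (g + - 2 * t) t bump <= V (g - t / 2) by [].
apply: rescale_between => //; [lra|lra|].
move=> z /andP[z1 z2]; apply/andP; split; last by apply: value_mono; lra.
by apply: value_mono => //; lra.
Unshelve. all: by end_near. Qed.

Lemma component_rescale y t : 0 < t -> e < y - t -> y + t < g ->
  V e <= rescale W y t bump <= V g.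
Proof.
move=> t0 ey yg; apply: rescale_between => // z /andP[z1 z2].
by rewrite value_left ?value_right//; apply/andP; split; lra.
Qed.

Lemma component_value : e < g -> V e <= V g.
Proof.
move=> eg'; have h : e < (e + g) / 2 < g by apply/andP; split; lra.
exact: le_trans (value_left _ h) (value_right _ h).
Qed.

End Component.

Lemma closed_gap_left (P : set R) lo u : closed P -> lo < u -> ~ P u -> exists e,
  [/\ lo <= e, e < u, e = lo \/ P e & forall z, e < z <= u -> ~ P z].
Proof.
move=> clP lu nPu.
(* With [lo] thrown in, the supremum exists even when [P] misses the interval, and it is then [lo]
   itself: hence the alternative in the conclusion. *)
pose S := [set z | z = lo \/ P z /\ lo <= z <= u].
have S0 : S !=set0 by exists lo; left.
have Su : ubound S u by move=> z [->|[_ /andP[]//]]; exact: ltW.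
have clS : closed S.
  have -> : S = [set lo] `|` (P `&` `[lo, u]).
    apply/seteqP; split=> z /=; first by move=> [->|[Pz hz]]; [left|right; rewrite in_itv].
    by move=> [->|[Pz]]; [left|rewrite in_itv/= => hz; right].
  apply: closedU; first exact: closed_eq.
  by apply: closedI => //; exact: itv_closed.
have Ssup : S (sup S).
  by have := closure_sup S0 (ex_intro _ u Su); rewrite -(closure_id S).1.
exists (sup S); split.
- by apply: ub_le_sup; [exists u|left].
- rewrite lt_neqAle ge_sup// andbT; apply/eqP => Eu.
  by case: Ssup => [Elo|[Ps _]]; [move: lu; rewrite -Eu Elo ltxx|apply: nPu; rewrite -Eu].
- by case: Ssup => [->|[Ps _]]; [left|right].
- move=> z /andP[z1 z2] Pz; move: (z1); rewrite ltNge => /negP; apply.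
  apply: ub_le_sup; first by exists u.
  right; split=> //; rewrite z2 andbT; apply: le_trans (ltW z1) => //.
  by apply: ub_le_sup; [exists u|left].
Qed.

Lemma closed_gap_right (P : set R) v hi : closed P -> v < hi -> ~ P v -> exists g,
  [/\ g <= hi, v < g, g = hi \/ P g & forall z, v <= z < g -> ~ P z].
Proof.
move=> clP vh nPv.
have [|||e [he eu eP eg]] := closed_gap_left [set - x | x in P] (- hi) (- v).
- exact: closedN.
- by rewrite ltrN2.
- by move=> [x Px /oppr_inj xv]; apply: nPv; rewrite -xv.
exists (- e); split.
- by rewrite lerNl.
- by rewrite ltrNr.
- by case: eP => [->|[x Px <-]]; [left|right]; rewrite opprK.
- move=> z /andP[z1 z2] Pz; apply: (eg (- z)); last by exists z.
  by rewrite ltrNr z2 lerN2.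
Qed.

Let omega_itv x0 : a < x0 < b -> omega x0.
Proof.
move=> /andP[ax0 x0b]; apply: contrapT => nx0.
pose P := ~` omega; have clP : closed P := open_closedC omega_open.
(* The shifts |s| <= 1 let a point of the closed set control every mean whose centre is within [t]
   of it. *)
pose A n : set R := [set x | forall s t, 0 < t -> t * n.+1%:R < 1 -> `|s| <= 1 ->
  `|rescale W (x + s * t) t bump| <= n%:R].
have clA n : closed (A n).
  move=> x clx s t t0 tn s1; rewrite leNgt; apply/negP => hn.
  have ct : continuous (fun y => `|rescale W (y + s * t) t bump|).
    move=> y; apply: cvg_norm; apply: cvgMr.
    have cl : {for y, continuous (fun y : R => y + s * t)} by apply: cvgD; [exact: cvg_id|exact: cvg_cst].
    have tn0 : t != 0 by rewrite gt_eqF.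
    exact: (continuous_comp cl (distr_dil_continuous _ linW contW bump t tn0 test_bump (y + s * t))).
  have : nbhs x [set y | n%:R < `|rescale W (y + s * t) t bump|].
    exact: (ct x _ (lt_nbhsr hn)).
  move=> /clx [y [Ay /=]]; rewrite ltNge => /negP; apply; exact: Ay.
have PA x : P x -> exists n, A n x.
  move=> _; have [n Hn] := rescale_shift_bounded W linW contW bump x (V x) test_bump (pvV x).
  by exists n => s t t0 tn s1; apply: Hn.
pose r0 := Num.min (x0 - a) (b - x0).
have r00 : 0 < r0 by rewrite lt_min !subr_gt0 ax0.
have r0a : r0 <= x0 - a by rewrite ge_min lexx.
have r0b : r0 <= b - x0 by rewrite ge_min lexx orbT.
have [n [x1 [r1 [Px1 r10 sub HA]]]] := baire_closed P A x0 r0 clP clA PA nx0 r00.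
pose lo := x1 - r1; pose hi := x1 + r1.
have alo : a <= lo.
  have := sub lo; rewrite /lo addrAC subrr sub0r normrN (gtr0_norm r10) => /(_ (lexx _)).
  rewrite ltr_distl => /andP[h _]; lra.
have hib : hi <= b.
  have := sub hi; rewrite /hi addrAC subrr add0r (gtr0_norm r10) => /(_ (lexx _)).
  rewrite ltr_distl => /andP[_ h]; lra.
have n10 : 0 < (n.+1%:R^-1 : R) by rewrite invr_gt0.
have VA c : P c -> `|c - x1| <= r1 -> `|V c| <= n%:R.
  move=> Pc hc; apply: (value_bounded W V pvV c n.+1%:R^-1 n%:R n10) => t /andP[t0 tn].
  have := HA c Pc hc 0 t t0; rewrite mul0r addr0 normr0; apply => //.
  by rewrite -ltr_pdivlMr// mul1r.
have r4 : 0 < r1 / 4 by rewrite divr_gt0.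
(* [m] must also bound the values at [lo] and [hi], where a gap may be cut off, and make the scales
   so small that [y - t, y + t] stays inside ]lo, hi[. *)
have [m [nm Vlo Vhi rm]] : exists m : nat, [/\ (n <= m)%N, `|V lo| <= m%:R, `|V hi| <= m%:R & m.+1%:R^-1 < r1 / 4].
  near \oo => m; exists m; split; near: m.
  - exact: nbhs_infty_ge.
  - exact: nbhs_infty_ger.
  - exact: nbhs_infty_ger.
  - exact: (near_infty_natSinv_lt (PosNum r4)).
apply: Px1; exists m.
have : nbhs x1 (ball x1 (r1 / 2)) by apply: nbhsx_ballx; rewrite divr_gt0.
apply: filterS => y; rewrite /ball/= ltr_distlC => /andP[y1 y2] t t0 tm.
have tr : t < r1 / 4 by apply: lt_trans rm; rewrite -[ltRHS]mul1r ltr_pdivlMr.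
have nmR : (n%:R : R) <= m%:R by rewrite ler_nat.
(* Either [y - t, y + t] meets [P] at some [c], and the mean is the one at [c] shifted by (y - c) /
   t; or it lies in a gap of [P], and the mean is squeezed between the values at the ends of the
   gap. *)
have [[c [Pc yc]]|nc] := pselect (exists c, P c /\ `|y - c| <= t).
  have cx : `|c - x1| <= r1.
    by move: yc; rewrite ler_distl => /andP[h1 h2]; rewrite ler_distl; apply/andP; split; lra.
  apply: le_trans nmR.
  have := HA c Pc cx ((y - c) / t) t t0; rewrite divfK ?gt_eqF// [c + _]addrC subrK; apply.
    by apply: le_lt_trans tm; rewrite ler_pM2l// ler_nat.
  by rewrite normrM normfV (gtr0_norm t0) ler_pdivrMr// mul1r.
have nP z : y - t <= z <= y + t -> ~ P z.
  by move=> hz Pz; apply: nc; exists z; split=> //; rewrite distrC ler_distl.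
have [||e [loe eu eP eg]] := closed_gap_left P lo (y - t) clP.
- by rewrite /lo; lra.
- by apply: nP; rewrite lexx/=; lra.
have [||g [ghi vg gP gg]] := closed_gap_right P (y + t) hi clP.
- by rewrite /hi; lra.
- by apply: nP; rewrite lexx andbT; lra.
have Ve : `|V e| <= m%:R.
  case: eP => [->//|Pe]; apply: le_trans nmR; apply: VA => //.
  by move: loe; rewrite /lo => k; rewrite ler_distl; apply/andP; split; lra.
have Vg : `|V g| <= m%:R.
  case: gP => [->//|Pg]; apply: le_trans nmR; apply: VA => //.
  by move: ghi; rewrite /hi => k; rewrite ler_distl; apply/andP; split; lra.
have om z : e < z < g -> omega z.
  move=> /andP[ez zg]; apply: contrapT => Pz.
  have [zu|uz] := leP z (y - t); first by apply: (eg z) => //; rewrite ez.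
  have [vz|zv] := leP (y + t) z; first by apply: (gg z) => //; rewrite vz.
  by apply: (nP z) => //; rewrite !ltW.
have /andP[h1 h2] := component_rescale e g (le_trans alo loe) (le_trans ghi hib) om y t t0 eu vg.
move: Ve Vg; rewrite !ler_norml => /andP[k1 k2] /andP[k3 k4].
by rewrite (le_trans k1 h1) (le_trans h2 k4).
Unshelve. all: by end_near. Qed.

Theorem value_mono_endpoints : a < b -> V a <= V b.
Proof. by move=> ab; apply: (component_value a b) => // x; exact: omega_itv. Qed.

End Monotonicity.

(** * Integrable functions as distributions *)

Section Duality.
Context {R : realType}.
Implicit Types (g u v U V : @functional R) (phi chi : R -> R) (a b r x : R).

(** The value chosen by [get] is unique: a plateau equal to 1 on both compact sets is an admissible
    cutoff for two candidates at once. *)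
Lemma smooth_extP g phi (K : set R) (v : R) : compact K ->
  (forall chi, test_function chi -> (forall x, K x -> chi x = 1) ->
    g (fun x => chi x * phi x) = v) ->
  smooth_ext g phi = v.
Proof.
move=> cK Hv; rewrite /smooth_ext; apply: get_unique; first by exists K.
move=> w [L cL Hw].
have [M [_ HM]] := compact_bounded cK; have [N [_ HN]] := compact_bounded cL.
pose B := 1 + Num.max `|M| `|N|; have B0 : 0 <= B by rewrite addr_ge0// le_max normr_ge0.
have plat (y : R) : `|y| <= B -> plateau (B * B) y = 1.
  move=> yB; apply: plateau_eq1; rewrite (le_trans (ler_norm _))//.
  by rewrite normrM ler_pM.
have MB : M < B by apply: (le_lt_trans (ler_norm M)); rewrite /B ltr_pwDl// le_max lexx.
have NB : N < B by apply: (le_lt_trans (ler_norm N)); rewrite /B ltr_pwDl// le_max lexx orbT.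
rewrite -(Hv _ (test_plateau (B * B))); first rewrite -(Hw _ (test_plateau (B * B)))//.
- by move=> x Lx; apply: plat; exact: HN Lx.
- by move=> x Kx; apply: plat; exact: HM Kx.
Qed.

Lemma smooth_ext_test g phi : test_function phi -> smooth_ext g phi = g phi.
Proof.
move=> tf; have [r _ cr] := test_csupp _ tf.
apply: (smooth_extP g phi `[- r, r]); first exact: segment_compact.
move=> chi _ Hc; congr g; apply/funext => x.
have [xr|xr] := lerP `|x| r; last by rewrite cr// mulr0.
by rewrite Hc ?mul1r//= in_itv/= -ler_norml.
Qed.

Lemma smooth_extN g phi : smooth_ext (fun chi => - g chi) phi = - smooth_ext g phi.
Proof.
have [[v [K cK HK]]|nex] := pselect (exists v : R, exists2 K : set R, compact K &
    forall chi, test_function chi -> (forall x, K x -> chi x = 1) ->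
      g (fun x => chi x * phi x) = v).
  rewrite (smooth_extP g phi K v)//; apply: (smooth_extP _ phi K) => // chi tc Hc.
  by rewrite HK.
(* Without an admissible value both sides come from the default value 0 of [get], which is its own
   opposite. *)
rewrite /smooth_ext (getPN (P := [set v | _])); last first.
  move=> v [K cK HK]; apply: nex; exists (- v), K => // chi tc Hc.
  by rewrite -(HK chi tc Hc) opprK.
rewrite (getPN (P := [set v | _])) ?oppr0// => v Hv; by apply: nex; exists v.
Qed.

Lemma rescale_ext_test g phi x t : t != 0 -> test_function phi ->
  rescale (smooth_ext g) x t phi = rescale g x t phi.
Proof. by move=> t0 tf; rewrite !rescaleE smooth_ext_test//; exact: test_dil. Qed.

Lemma lower_valueN g phi x :
  lower_value (fun chi => - g chi) phi x = (- upper_value g phi x)%E.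
Proof.
rewrite /lower_value /upper_value -limf_einfN; congr limf_einf; apply/funext => t.
by rewrite /rescale smooth_extN mulrN EFinN.
Qed.

Lemma upper_valueN g phi x :
  upper_value (fun chi => - g chi) phi x = (- lower_value g phi x)%E.
Proof.
rewrite /lower_value /upper_value -limf_esupN; congr limf_esup; apply/funext => t.
by rewrite /rescale smooth_extN mulrN EFinN.
Qed.

Lemma distributionN g : Defs.distribution g -> Defs.distribution (fun chi => - g chi).
Proof.
move=> [ling contg]; split; first by move=> c phi chi tf tc; rewrite ling// opprD mulrN.
by move=> K /contg[N [C HC]]; exists N, C => phi tf sf; rewrite normrN; exact: HC.
Qed.

Lemma EprimeN a b g : Eprime a b g -> Eprime a b (fun chi => - g chi).
Proof.
move=> [dg sg]; split; first exact: distributionN.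
move=> x Hx; apply: sg => V oV Vx; have [phi [tf sf gf]] := Hx V oV Vx.
by exists phi; split => // g0; apply: gf; rewrite g0 oppr0.
Qed.

Lemma point_valueN g x c : point_value g x c -> point_value (fun chi => - g chi) x (- c).
Proof.
move=> H phi tf; rewrite mulNr.
rewrite (_ : (fun _ => _) = fun e => - rescale g x e phi); first exact: (cvgN (H phi tf)).
by apply/funext => e; rewrite /rescale mulrN.
Qed.

Lemma lojasiewicz_primitiveN a b v V : lojasiewicz_primitive a b v V ->
  lojasiewicz_primitive a b (fun chi => - v chi) (fun chi => - V chi).
Proof.
move=> [Ev [dV pV] VV p0]; split.
- exact: EprimeN.
- split; first exact: distributionN.
  by move=> x; have [c /point_valueN] := pV x; exists (- c).
- by move=> phi tf; rewrite /deriv_distr -(VV phi tf).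
- by rewrite -oppr0; exact: point_valueN.
Qed.

Lemma minor_pairN a b f v V : minor_pair a b f v V ->
  major_pair a b (fun x => - f x)%E (fun chi => - v chi) (fun chi => - V chi).
Proof.
move=> [pV [E [Z [cE nZ H0 H1]]]]; split; first exact: lojasiewicz_primitiveN.
exists E, Z; split => // x phi Hx Hf; rewrite lower_valueN.
- by rewrite leeN2; exact: H0.
- by rewrite lteNr; exact: H1.
Qed.

Lemma major_pairN a b f u U : major_pair a b (fun x => - f x)%E u U ->
  minor_pair a b f (fun chi => - u chi) (fun chi => - U chi).
Proof.
move=> [pV [E [Z [cE nZ H0 H1]]]]; split; first exact: lojasiewicz_primitiveN.
exists E, Z; split => // x phi Hx Hf; rewrite upper_valueN.
- by rewrite leeNl; exact: H0.
- by rewrite lteNl; exact: H1.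
Qed.

Lemma lower_dist_integralN a b f :
  lower_dist_integral a b f = (- upper_dist_integral a b (fun x => - f x))%E.
Proof.
rewrite /upper_dist_integral /ereal_inf oppeK; congr ereal_sup.
apply/seteqP; split.
- move=> _ [c [v [V [mV pV]]] <-]; exists (- c)%:E; last by rewrite EFinN oppeK.
  exists (- c) => //; exists (fun chi => - v chi), (fun chi => - V chi).
  by split; [exact: minor_pairN|exact: point_valueN].
- move=> _ [_ [c [u [U [mU pU]]] <-] <-]; rewrite -EFinN; exists (- c) => //.
  exists (fun chi => - u chi), (fun chi => - U chi).
  by split; [exact: major_pairN|exact: point_valueN].
Qed.

End Duality.

(** * Primitives of integrable functions and integration by parts *)

Section IntegrablePrimitive.
Context {R : realType}.
Implicit Types (f h k phi : R -> R) (x y s : R).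

Lemma Rintegral_mul_indic h (A : set R) : measurable A ->
  \int[mu]_s (h s * \1_A s) = \int[mu]_(s in A) h s.
Proof.
move=> mA; rewrite [RHS]/Rintegral integral_mkcond /Rintegral; congr fine.
apply: eq_integral => s _; rewrite patchE indicE; case: (s \in A) => /=.
  by rewrite mulr1.
by rewrite mulr0.
Qed.

Lemma le_normr_Rintegral_indic h (A : set R) : measurable A -> Lebesgue_integrable h ->
  `|\int[mu]_s (h s * \1_A s)| <= \int[mu]_(s in A) `|h s|.
Proof.
move=> mA ih; rewrite Rintegral_mul_indic//; apply: le_normr_Rintegral => //.
exact: integrableS ih.
Qed.

Lemma prim_continuous h : Lebesgue_integrable h -> continuous (prim h).
Proof.
move=> ih x; apply/cvgrPdist_le => e e0.
have [d [d0 Hd]] := integral_normr_continuous ih e0.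
have K y z : y <= z -> z - y < d -> `|prim h z - prim h y| <= e.
  move=> yz zyd; rewrite primB//.
  apply: le_trans (le_normr_Rintegral_indic _ _ _ ih) _; first exact: measurable_itv.
  have lt_d : (lebesgue_measure (`]y, z]%classic : set R) < d%:E)%E.
    by rewrite lebesgue_measure_itv/=; case: ifP => _; rewrite -?EFinB lte_fin.
  by apply/ltW/Hd => //; exact: measurable_itv.
near=> y; have xy : `|x - y| < d.
  by near: y; apply: cvgr_dist_lt.
have [yx|xy'] := leP y x.
  by apply: K => //; apply: le_lt_trans xy; exact: ler_norm.
rewrite distrC; apply: K; first exact: ltW.
by apply: le_lt_trans xy; rewrite distrC; exact: ler_norm.
Unshelve. all: by end_near. Qed.

Lemma Rintegral_derive1_above phi s : test_function phi ->
  \int[mu]_x (derive1 phi x * \1_(`[s, +oo[ : set R) x) = - phi s.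
Proof.
move=> tf; have [r r0 cr] := test_csupp _ tf.
pose B := `|s| + r + 1.
have sB : s < B by have := ler_norm s; rewrite /B; lra.
have rB : r < `|B| by have := normr_ge0 s; have := ler_norm B; rewrite /B; lra.
transitivity (\int[mu]_(x in `[s, B]) derive1 phi x).
  rewrite -[RHS]Rintegral_mul_indic//; apply: eq_Rintegral => x _.
  have [xB|Bx] := leP x B.
    by rewrite !indicE !mem_setE !in_itv/= xB.
  rewrite (csupp_derive1 r phi cr) ?mul0r//.
  by rewrite (lt_le_trans _ (ler_norm x))// (lt_trans _ Bx)// /B; have := normr_ge0 s; lra.
have dphi x : derivable phi x 1 := test_smooth _ tf 0%N x.
have cphi := test_continuous_fun _ tf.
rewrite /Rintegral (@continuous_FTC2 _ _ phi _ _ sB).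
- by rewrite -EFinB/= (cr B rB) sub0r.
- by apply: continuous_subspaceT; exact: (test_continuous_fun _ (test_derive1 _ tf)).
- split; first by move=> x _; exact: dphi.
  + by apply: cvg_at_right_filter; exact: cphi.
  + by apply: cvg_at_left_filter; exact: cphi.
- by [].
Qed.

Let below (z : R * R) : R := \1_[set z : R * R | z.2 <= z.1] z.

Let below_mfun : measurable_fun setT below.
Proof.
apply: measurable_indic; rewrite -[X in measurable X]setTI.
have /(_ measurableT [set true] I) := @measurable_fun_ler _ _ R setT
  (fun z : R * R => z.2) (fun z : R * R => z.1) measurable_snd measurable_fst.
exact.
Qed.

(** Fubini for h(s) k(x) on the half-plane s <= x, dominated by the integrable product |h(s)|
    |k(x)|. *)
Lemma Rintegral_prim h k : Lebesgue_integrable h -> Lebesgue_integrable k ->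
  \int[mu]_x (prim h x * k x) =
  \int[mu]_s (h s * \int[mu]_x (k x * \1_(`[s, +oo[ : set R) x)).
Proof.
move=> ih ik; pose F (z : R * R) := (h z.2 * k z.1 * below z)%:E.
have mF : measurable_fun setT F.
  apply/measurable_EFinP; apply: measurable_funM below_mfun; apply: measurable_funM.
    exact: (measurableT_comp (integrable_mfun _ ih) measurable_snd).
  exact: (measurableT_comp (integrable_mfun _ ik) measurable_fst).
have belowE x s : below (x, s) = \1_(`]-oo, x] : set R) s.
  by rewrite /below !indicE [in RHS]mem_setE [in LHS]mem_setE in_itv.
have belowE' x s : below (x, s) = \1_(`[s, +oo[ : set R) x.
  by rewrite /below !indicE [in RHS]mem_setE [in LHS]mem_setE in_itv/= andbT.
have F1 x : (\int[mu]_s F (x, s))%E = (prim h x * k x)%:E.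
  have i1 : Lebesgue_integrable (fun s => h s * \1_(`]-oo, x] : set R) s).
    exact: integrable_mul_indic.
  under eq_integral do rewrite /F /= belowE mulrAC EFinM muleC.
  by rewrite (integralZl measurableT i1) muleC EFinM /prim /Rintegral fineK//;
    exact: integrable_fin_num i1.
have F2 s : (\int[mu]_x F (x, s))%E =
    (h s * \int[mu]_x (k x * \1_(`[s, +oo[ : set R) x))%:E.
  have i1 : Lebesgue_integrable (fun x => k x * \1_(`[s, +oo[ : set R) x).
    exact: integrable_mul_indic.
  under eq_integral do rewrite /F /= belowE' -mulrA EFinM.
  by rewrite (integralZl measurableT i1) EFinM /Rintegral fineK//;
    exact: integrable_fin_num i1.
have iF : (lebesgue_measure \x lebesgue_measure)%E.-integrable setT F.
  apply: (integrable12ltyP (@lebesgue_measure R) (@lebesgue_measure R) mF).2.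
  have /integrableP[_ hfin] := ih; have /integrableP[mk kfin] := ik.
  have mh := integrable_mfun _ ih.
  apply: (@le_lt_trans _ _ (\int[mu]_x
     ((\int[mu]_s `|(h s)%:E|) * `|(k x)%:E|))%E).
    apply: ge0_le_integral => //.
    - by move=> x _; exact: integral_ge0.
    - have := @measurable_fun_fubini_tonelli_F _ _ _ _ R (@lebesgue_measure R) (abse \o F).
      apply; last by move=> z; exact: abse_ge0.
      exact: (measurableT_comp (@abse_measurable R setT) mF).
    - apply: measurable_funeM; exact: measurableT_comp.
    - move=> x _; rewrite muleC -ge0_integralZl//; last by do 2 apply: measurableT_comp => //.
      apply: ge0_le_integral => //.
      + by apply: measurableT_comp => //; apply: (measurableT_comp mF); exact: measurable_pair1.
      + by apply: measurable_funeM; do 2 apply: measurableT_comp => //.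
      + move=> s _; rewrite /F/= -EFinM lee_fin !normrM [leRHS]mulrC.
        rewrite ler_piMr ?mulr_ge0//.
        by rewrite belowE indicE; case: (_ \in _); rewrite ?normr1 ?normr0 ?lexx ?ler01.
  rewrite ge0_integralZl//; last 2 first.
  - exact: measurableT_comp.
  - exact: integral_ge0.
  apply: lte_mul_pinfty => //; first exact: integral_ge0.
  by rewrite ge0_fin_numE//; exact: integral_ge0.
rewrite /Rintegral; congr fine.
transitivity (\int[mu]_x \int[mu]_s F (x, s))%E.
  by apply: eq_integral => x _; rewrite F1.
rewrite (Fubini iF); apply: eq_integral => s _; exact: F2.
Qed.

End IntegrablePrimitive.

(** * Distributions given by functions *)

Section FunctionDistributions.
Context {R : realType}.
Implicit Types (f h phi chi : R -> R) (x y r a b : R).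

Definition fun_distr f : functional :=
  fun phi => \int[mu]_x (f x * phi x).

Definition locally_L1 f := forall r,
  Lebesgue_integrable (fun x => f x * \1_(`[- r, r] : set R) x).

Lemma integrable_locally_L1 h : Lebesgue_integrable h -> locally_L1 h.
Proof. by move=> ih r; exact: integrable_mul_indic. Qed.

Lemma continuous_locally_L1 f : continuous f -> locally_L1 f.
Proof.
move=> cf r.
have [M HM] : exists M, forall x, `|f x * \1_(`[- r, r] : set R) x| <= M.
  have /compact_bounded[M [_ HM]] : compact (f @` `[- r, r]).
    by apply: continuous_compact; [exact: continuous_subspaceT|exact: segment_compact].
  exists (Num.max 0 (M + 1)) => x; rewrite indicE; case: (boolP (x \in _)) => [|_].
    rewrite inE => xr; rewrite mulr1 le_max; apply/orP; right.
    by apply: HM; [rewrite ltrDl|exists x].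
  by rewrite mulr0 normr0 le_max lexx.
apply: (integrable_csupp r _ M) => //.
  apply: measurable_funM; first exact: continuous_mfun.
  by apply: indic_mfun; exact: measurable_itv.
move=> x rx; rewrite indicE memNset ?mulr0//= in_itv/= -ler_norml.
by apply/negP; rewrite -ltNge.
Qed.

Lemma fun_distr_indic f r phi : csupp r phi -> forall x,
  f x * phi x = f x * \1_(`[- r, r] : set R) x * phi x.
Proof.
move=> cr x; have [xr|xr] := leP `|x| r; last by rewrite cr// !mulr0.
by rewrite indicE mem_set ?mulr1//= in_itv/= -ler_norml.
Qed.

Lemma fun_distr_integrable f phi : locally_L1 f -> test_function phi ->
  Lebesgue_integrable (fun x => f x * phi x).
Proof.
move=> lf tf; have [r _ cr] := test_csupp _ tf; have [M M0 HM] := test_bounded _ tf.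
rewrite (funext (fun_distr_indic f r phi cr)).
exact: (integrable_bdd_mul _ _ M (lf r) (continuous_mfun _ (test_continuous_fun _ tf))).
Qed.

Lemma fun_distr_distribution f : locally_L1 f -> Defs.distribution (fun_distr f).
Proof.
move=> lf; split.
  move=> c phi chi tf tc; rewrite /fun_distr.
  have i1 := fun_distr_integrable _ _ lf tf; have i2 := fun_distr_integrable _ _ lf tc.
  rewrite -RintegralZl// -RintegralD//; last exact: integrable_cmul.
  by apply: eq_Rintegral => x _; ring.
move=> K /compact_bounded[M [_ HM]].
pose r := `|M| + 1.
have Kr x : K x -> `|x| <= r.
  by apply: HM; rewrite /r; have := ler_norm M; lra.
exists 0%N, (\int[mu]_x `|f x * \1_(`[- r, r] : set R) x|) => phi tf sf.
have cr : csupp r phi.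
  move=> x rx; apply: contrapT => /eqP phx.
  have Kx : K x by apply: sf; apply: subset_closure; exact: phx.
  by have := Kr x Kx; rewrite leNgt rx.
rewrite big_ord_recl big_ord0 addr0 derive1n0.
have [B B0 HB] := test_bounded _ tf.
have ub x : `|phi x| <= sup (range (fun x => `|phi x|)).
  apply: ub_le_sup; last by exists x.
  by exists B => _ [y _ <-].
have sup0 := le_trans (normr_ge0 _) (ub 0).
have im := fun_distr_integrable _ _ lf tf.
apply: (le_trans (le_normr_Rintegral measurableT im)).
rewrite -RintegralZr//; last exact: integrable_norm (lf r).
apply: le_Rintegral => //.
- exact: integrable_norm im.
- under eq_fun do rewrite mulrC.
  by apply: integrable_cmul; exact: integrable_norm (lf r).
- by move=> x _; rewrite (fun_distr_indic f r phi cr) normrM ler_wpM2l.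
Qed.

Lemma fun_distr_Eprime h a b : Lebesgue_integrable h -> (forall x, ~ a < x <= b -> h x = 0) ->
  Eprime a b (fun_distr h).
Proof.
move=> ih h0; split; first exact/fun_distr_distribution/integrable_locally_L1.
move=> x Hx; apply: contrapT => nx.
have [|//|phi [tf sf]] := Hx (~` `[a, b]%classic).
  by apply: closed_openC; exact: itv_closed.
apply; rewrite /fun_distr -[RHS](Rintegral_cst0 (R := R)); apply: eq_Rintegral => y _.
have [yab|yab] := pselect (a < y <= b); last by rewrite h0 ?mul0r.
rewrite [phi y](_ : _ = 0) ?mulr0//; apply: contrapT => /eqP phy.
have Sy : fsupport phi y by apply: subset_closure; exact: phy.
apply: (sf y Sy).
rewrite /= in_itv/=.
by case/andP: yab => /ltW -> ->.
Qed.

Lemma fun_distr_point_value f x : continuous f -> point_value (fun_distr f) x (f x).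
Proof.
move=> cf phi tf; have [r r0 cr] := test_csupp _ tf.
have ip := test_integrable _ tf.
pose I := \int[mu]_y `|phi y|.
have I0 : 0 <= I by apply: Rintegral_ge0.
apply/cvgrPdist_le => e e0.
have d0 : 0 < e / (I + 1) by rewrite divr_gt0// ltr_wpDl.
have /cvgrPdist_le/(_ _ d0)[d /= dp Hd] := cf x.
near=> t.
have t0 : t != 0 by near: t; exact: nbhs_dnbhs_neq.
have tr : r * `|t| < d.
  rewrite mulrC -ltr_pdivlMr//; near: t.
  apply: (@dnbhs0_lt R R); by rewrite divr_gt0.
have td := test_dil phi x t t0 tf.
have id' := test_integrable _ td.
rewrite rescaleE /fun_distr.
have -> : f x * \int[mu]_y phi y =
    `|t|^-1 * \int[mu]_y (f x * dil phi x t y).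
  rewrite RintegralZl// Rintegral_affine//; field.
  by rewrite normr_eq0.
have i1 := fun_distr_integrable f _ (continuous_locally_L1 _ cf) td.
have i2 : Lebesgue_integrable (fun y => f x * dil phi x t y) by exact: integrable_cmul.
rewrite -mulrBr -RintegralB// normrM normfV normr_id.
apply: (@le_trans _ _ (`|t|^-1 * \int[mu]_y (e / (I + 1) * `|dil phi x t y|))).
  rewrite ler_pM2l ?invr_gt0 ?normr_gt0//.
  have i3 := integrable_sub _ _ i2 i1.
  apply: (le_trans (le_normr_Rintegral measurableT i3)).
  apply: le_Rintegral => //.
  - exact: integrable_norm i3.
  - by apply: integrable_cmul; exact: integrable_norm id'.
  - move=> y _; rewrite -mulrBl normrM.
    have [yd|yd] := ltP (`|x - y|) d; first by rewrite ler_wpM2r//; exact: Hd.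
    rewrite [dil phi x t y](_ : _ = 0) ?normr0 ?mulr0//.
    apply: cr; rewrite normrM normfV ltr_pdivlMr ?normr_gt0//.
    by rewrite distrC; exact: lt_le_trans yd.
have -> : \int[mu]_y (e / (I + 1) * `|dil phi x t y|) = e / (I + 1) * (`|t| * I).
  rewrite RintegralZl//; last exact: integrable_norm id'.
  by rewrite -(Rintegral_affine (fun y => `|phi y|) x t t0)//; exact: integrable_norm ip.
rewrite [leLHS](_ : _ = e * (I / (I + 1))); last first.
  by field; rewrite normr_eq0 t0 gt_eqF// ltr_wpDl.
rewrite ler_piMr ?(ltW e0)//.
by rewrite ler_pdivrMr ?mul1r ?lerDl// ltr_wpDl.
Unshelve. all: by end_near. Qed.

(** The support condition is open at [a], so the integrand defining [prim h a] vanishes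
    identically. *)
Lemma prim_left h a b : (forall x, ~ a < x <= b -> h x = 0) -> prim h a = 0.
Proof.
move=> h0; rewrite /prim -[RHS](Rintegral_cst0 (R := R)); apply: eq_Rintegral => s _.
have [sa|sa] := ltP a s; last by rewrite h0 ?mul0r// ltNge sa.
by rewrite indicE memNset ?mulr0//= in_itv/= leNgt sa.
Qed.

Lemma prim_right h a b : (forall x, ~ a < x <= b -> h x = 0) ->
  prim h b = \int[mu]_s h s.
Proof.
move=> h0; rewrite /prim; apply: eq_Rintegral => s _.
have [sb|sb] := leP s b; first by rewrite indicE mem_set ?mulr1//= in_itv/= sb.
by rewrite h0 ?mul0r// (leNgt s) sb andbF.
Qed.

Lemma fun_distr_lojasiewicz f : continuous f -> lojasiewicz (fun_distr f).
Proof.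
move=> cf; split; first exact/fun_distr_distribution/continuous_locally_L1.
by move=> x; exists (f x); exact: fun_distr_point_value.
Qed.

Lemma deriv_fun_distr_prim h : Lebesgue_integrable h ->
  distr_eq (deriv_distr (fun_distr (prim h))) (fun_distr h).
Proof.
move=> ih phi tf; have td := test_derive1 _ tf.
rewrite /deriv_distr /fun_distr Rintegral_prim//; last exact: test_integrable.
under eq_Rintegral do rewrite Rintegral_derive1_above// mulrN -mulN1r.
rewrite RintegralZl// ?mulN1r ?opprK//.
exact: (fun_distr_integrable _ _ (integrable_locally_L1 _ ih) tf).
Qed.

Lemma fun_distr_primitive h a b : Lebesgue_integrable h ->
  (forall x, ~ a < x <= b -> h x = 0) ->
  lojasiewicz_primitive a b (fun_distr h) (fun_distr (prim h)).
Proof.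
move=> ih h0; split.
- exact: fun_distr_Eprime.
- exact/fun_distr_lojasiewicz/prim_continuous.
- exact: deriv_fun_distr_prim.
- by rewrite -(prim_left h a b h0); exact/fun_distr_point_value/prim_continuous.
Qed.

Lemma smooth_ext_fun_distr h a b phi : (forall x, ~ a < x <= b -> h x = 0) ->
  smooth_ext (fun_distr h) phi = \int[mu]_x (h x * phi x).
Proof.
move=> h0; apply: (smooth_extP _ _ `[a, b]); first exact: segment_compact.
move=> chi tc Hc; apply: eq_Rintegral => x _.
have [xab|xab] := pselect (a < x <= b); last by rewrite h0 ?mul0r.
rewrite Hc ?mul1r//= in_itv/=.
by case/andP: xab => /ltW -> ->.
Qed.

End FunctionDistributions.

(** * Lower values at Lebesgue points *)

Section LowerValue.
Context {R : realType}.
Implicit Types (f h phi : R -> R) (g : @functional R) (x t c e r M : R).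

Lemma lower_value_ge g phi x c :
  (forall e, 0 < e -> exists2 t1, 0 < t1 &
    forall t, 0 < t < t1 -> c - e <= rescale (smooth_ext g) x t phi) ->
  (c%:E <= lower_value g phi x)%E.
Proof.
move=> H; apply/lee_subgt0Pr => e e0; have [t1 t10 Ht] := H e e0.
rewrite /lower_value limf_einfE; apply: ereal_sup_ge.
exists (ereal_inf [set (rescale (smooth_ext g) x t phi)%:E | t in `]0, t1[%classic]).
  exists `]0, t1[%classic => //.
  by near=> t; rewrite /= in_itv/=; apply/andP; split; near: t;
    [exact: nbhs_right_gt|exact: nbhs_right_lt].
apply: le_ereal_inf_tmp => _ [t /= tt <-]; rewrite -EFinB lee_fin; apply: Ht.
by move: tt; rewrite in_itv.
Unshelve. all: by end_near. Qed.

Lemma lower_value_gt g phi x c : (c%:E < lower_value g phi x)%E ->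
  exists2 t1, 0 < t1 & forall t, 0 < t < t1 -> c <= rescale (smooth_ext g) x t phi.
Proof.
rewrite /lower_value limf_einfE => /ereal_sup_gt[_ [A [d /= d0 Hd] <-]] cA.
exists d => // t /andP[t0 td].
have At : A t by apply: Hd => //=; rewrite sub0r normrN gtr0_norm.
rewrite -lee_fin; apply: (le_trans (ltW cA)); apply: ereal_inf_lbound.
by exists t.
Qed.

Lemma T0_integrable phi : T0 phi -> Lebesgue_integrable phi.
Proof.
move=> [sf f0 i1 _]; apply/integrableP; split.
  apply/measurable_EFinP; exact: (continuous_mfun _ (smooth_continuous _ sf)).
under eq_integral => x _ do rewrite /= ger0_norm//.
by rewrite i1 ltry.
Qed.

Lemma T0_Rintegral phi : T0 phi -> \int[mu]_x phi x = 1.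
Proof. by move=> [_ _ i1 _]; rewrite /Rintegral i1. Qed.

(** Continuity bounds [phi] on a segment; outside it the decay condition for m = 0 has a negative
    exponent, and |x|^alpha <= 1 there. *)
Lemma T0_bounded phi : T0 phi -> exists2 M, 0 < M & forall x, phi x <= M.
Proof.
move=> [sf f0 _ [alpha al /(_ 0%N) /eqO_exP[k k0 [N HN]]]].
have cf := smooth_continuous _ sf.
pose r := Num.max 1 (`|N| + 1).
have /compact_bounded[M [_ HM]] : compact (phi @` `[- r, r]).
  by apply: continuous_compact; [exact: continuous_subspaceT|exact: segment_compact].
exists (Num.max k (M + 1)); first by rewrite lt_max k0.
move=> x; rewrite le_max; have [xr|rx] := leP `|x| r; apply/orP; [right|left].
  apply: le_trans (ler_norm _) _; apply: HM; first by rewrite ltrDl.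
  by exists x => //=; rewrite in_itv/= -ler_norml.
have Nx : N < `|x|.
  apply: le_lt_trans (ler_norm N) _; apply: lt_trans rx.
  by rewrite lt_max ltrDl ltr01 orbT.
have := HN x Nx; rewrite derive1n0 (ger0_norm (f0 x)) => /le_trans; apply.
rewrite ger0_norm ?powR_ge0// ger_pMr// subr0.
rewrite -(@powRr0 R `|x|) ler_powR//; last by rewrite ltW// (lt_trans al)// ltrN10.
by apply: ltW; apply: le_lt_trans rx; rewrite le_max lexx.
Qed.

Lemma measurable_outer (K : R) : measurable [set y : R | K <= `|y|].
Proof.
rewrite -[X in measurable X]setTI.
have /(_ measurableT [set true] I) := @measurable_fun_ler _ _ R setT
  (cst K) (fun z : R => `|z|) (measurable_cst _) (@normr_measurable R setT).
exact.
Qed.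

Lemma T0_tail phi e : T0 phi -> 0 < e -> exists2 K, 0 < K &
  \int[mu]_y (phi y * \1_[set y | K <= `|y|] y) <= e.
Proof.
move=> Tf e0; have [_ f0 i1 _] := Tf; have ip := T0_integrable _ Tf.
have mp := integrable_mfun _ ip.
pose F (n : nat) : set R := `[- n%:R, n%:R].
have mF n : measurable (F n) by exact: measurable_itv.
have bF : \bigcup_i F i = setT.
  apply/seteqP; split => // y _; exists (Num.bound `|y|) => //=.
  by rewrite /F/= in_itv/= -ler_norml ltW// archi_boundP.
have : (\int[mu]_(y in F n) (phi y)%:E)%E @[n --> \oo] -->
    (\int[mu]_(y in \bigcup_i F i) (phi y)%:E)%E.
  apply: ge0_nondecreasing_set_cvg_integral => //.
  - move=> m n mn; apply/subsetPset => y; rewrite /F/= !in_itv/= -!ler_norml.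
    by move=> /le_trans; apply; rewrite ler_nat.
  - by move=> n; apply: measurable_funTS; apply/measurable_EFinP.
  - by move=> n y _; rewrite /= lee_fin.
rewrite bF i1 => /fine_cvgP[_ /cvgrPdist_le/(_ e e0)].
move=> [n _ /(_ n (leqnn n))] /= Hn; exists n.+1%:R => //.
have iFn : Lebesgue_integrable (fun y => phi y * \1_(F n) y).
  exact: integrable_mul_indic.
have mK := measurable_outer n.+1%:R.
have : 1 - \int[mu]_y (phi y * \1_(F n) y) <= e.
  by apply: le_trans (ler_norm _) _; rewrite Rintegral_mul_indic.
rewrite -[X in X - _](T0_Rintegral _ Tf) -RintegralB//; apply: le_trans.
apply: le_Rintegral => //.
- exact: (integrable_mul_indic _ _ mK ip).
- exact: (integrable_sub _ _ ip iFn).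
- move=> y _; rewrite !indicE; have [yn|yn] := leP `|y| n%:R.
    rewrite memNset ?mulr0; last by rewrite /= leNgt (le_lt_trans yn)// ltr_nat.
    by rewrite subr_ge0 ler_piMr//; case: (_ \in _).
  rewrite [y \in F n]memNset ?mulr0 ?subr0; last by rewrite /F/= in_itv/= -ler_norml leNgt yn.
  by rewrite ler_piMr//; case: (_ \in _).
Qed.

Lemma lebesgue_pt_avg h x : Lebesgue_integrable h -> lebesgue_pt h x ->
  forall e, 0 < e -> exists2 r0, 0 < r0 & forall r, 0 < r < r0 ->
    \int[mu]_z (`|h z - h x| * \1_(ball x r : set R) z) <= e * r.
Proof.
move=> ih hx e e0.
(* The ball of radius [r] has measure 2 r, so a mean deviation of at most e / 2 gives an integral of
   at most e r. *)
have e20 : 0 < e / 2 by rewrite divr_gt0.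
have /fine_cvgP[[d1 /= d10 Hfin] /cvgrPdist_le/(_ _ e20)[d /= d0 Hd]] := hx.
exists (Num.min d d1); first by rewrite lt_min d0.
move=> r /andP[r0]; rewrite lt_min => /andP[rd rd1].
have br : `|0 - r| < d by rewrite sub0r normrN gtr0_norm.
have br1 : `|0 - r| < d1 by rewrite sub0r normrN gtr0_norm.
have := Hfin r br1 r0; have := Hd r br r0.
have mb : measurable (ball x r) by exact: measurable_ball.
rewrite Rintegral_mul_indic//.
rewrite /= /davg /iavg (lebesgue_measure_ball _ (ltW r0)) inver.
have r2 : r *+ 2 == 0 = false by rewrite mulrn_eq0/= gt_eqF.
rewrite r2 sub0r normrN => Hle Hf.
have J0 : (0 <= \int[mu]_(y in ball x r) `|((h y - h x)%:E)|)%E by exact: integral_ge0.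
have r20 : 0 < (r *+ 2)^-1 by rewrite invr_gt0 mulrn_wgt0.
move: Hle Hf J0; rewrite /Rintegral; case: (integral _ _ _) => [J| |]//.
- rewrite -EFinM /= => Hle _ _; have := le_trans (ler_norm _) Hle.
  rewrite mulrC ler_pdivrMr ?mulrn_wgt0// => /le_trans; apply.
  by rewrite -mulr_natr le_eqVlt; apply/orP; left; apply/eqP; field.
- by rewrite gt0_muley ?lte_fin.
Qed.

Lemma rescale_fun_distr h a b phi x t : (forall z, ~ a < z <= b -> h z = 0) ->
  rescale (smooth_ext (fun_distr h)) x t phi =
  `|t|^-1 * \int[mu]_z (h z * dil phi x t z).
Proof. by move=> h0; rewrite rescaleE (smooth_ext_fun_distr h a b). Qed.

Lemma dil_mul_integrable h phi x t : Lebesgue_integrable h -> T0 phi -> t != 0 ->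
  Lebesgue_integrable (fun z => h z * dil phi x t z).
Proof.
move=> ih Tf t0; have [M _ HM] := T0_bounded _ Tf; have [_ f0 _ _] := Tf.
apply: (integrable_bdd_mul _ _ M ih).
  exact: (integrable_mfun _ (integrable_affine _ x t t0 (T0_integrable _ Tf))).
by move=> z; rewrite ger0_norm; [exact: HM|exact: f0].
Qed.

Lemma rescale_fun_distr_ge h a b M phi x t : Lebesgue_integrable h ->
  (forall z, ~ a < z <= b -> h z = 0) -> (forall z, - M <= h z) -> T0 phi -> 0 < t ->
  - M <= rescale (smooth_ext (fun_distr h)) x t phi.
Proof.
move=> ih h0 hM Tf t0; have tn0 : t != 0 by rewrite gt_eqF.
have [_ f0 _ _] := Tf; have ip := T0_integrable _ Tf.
have id' := integrable_affine _ x t tn0 ip.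
rewrite (rescale_fun_distr h a b)// gtr0_norm// ler_pdivlMl//.
rewrite [leLHS](_ : _ = \int[mu]_z (- M * dil phi x t z)).
  apply: le_Rintegral => //.
  - exact: (integrable_cmul (- M) _ id').
  - exact: dil_mul_integrable.
  - by move=> z _; rewrite ler_wpM2r//; exact: f0.
by rewrite RintegralZl// Rintegral_affine// T0_Rintegral// mulr1 gtr0_norm// mulrC.
Qed.

(** Kernels in [T0] may have unbounded support, and a Lebesgue point controls only the part at
    distance K t; on the rest the lower bound of [h] meets the small tail of [phi]. *)
Lemma lower_value_lebesgue_pt h a b M phi x : Lebesgue_integrable h ->
  (forall z, ~ a < z <= b -> h z = 0) -> (forall z, - M <= h z) -> T0 phi ->
  lebesgue_pt h x -> ((h x)%:E <= lower_value (fun_distr h) phi x)%E.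
Proof.
move=> ih h0 hM Tf hx; apply: lower_value_ge => e e0.
have [_ f0 _ _] := Tf; have ip := T0_integrable _ Tf.
have [S S0 HS] := T0_bounded _ Tf.
pose A := `|M| + `|h x| + 1; have A0 : 0 < A by rewrite ltr_wpDl// addr_ge0.
(* Near [x] the kernel is at most [S], at a cost of S (e / (2 S K)) K t; farther away h - h(x) >=
   -A, at a cost of A t e / (2 A). Each loss is t e / 2. *)
have [K K0 HK] := T0_tail _ (e / (2 * A)) Tf (divr_gt0 e0 (mulr_gt0 (ltr0n _ 2) A0)).
have [r0 r00 Hr] := lebesgue_pt_avg _ _ ih hx _ (divr_gt0 e0 (mulr_gt0 (ltr0n _ 2) (mulr_gt0 S0 K0))).
exists (r0 / K); first exact: divr_gt0.
move=> t /andP[t0]; rewrite ltr_pdivlMr// => tK.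
have tn0 : t != 0 by rewrite gt_eqF.
have {Hr} := Hr (K * t); rewrite mulr_gt0//= mulrC => /(_ tK).
set B := ball x (t * K) => Hr.
have id' := integrable_affine _ x t tn0 ip.
have ihd := dil_mul_integrable _ _ x _ ih Tf tn0.
pose tail y := phi y * \1_[set y | K <= `|y|] y.
have mK := measurable_outer K.
have it : Lebesgue_integrable tail by exact: (integrable_mul_indic _ _ mK ip).
have idt := integrable_affine _ x t tn0 it.
have mB : measurable B by exact: measurable_ball.
have iB : Lebesgue_integrable (fun z => `|h z - h x| * \1_B z).
  have i1 : Lebesgue_integrable (\1_B : R -> R).
    apply: (integrable_csupp (`|x| + t * K) _ 1 (indic_mfun _ mB)).
      by move=> z; rewrite indicE; case: (_ \in _); rewrite ?normr1 ?normr0.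
    move=> z zx; rewrite indicE memNset// /B /ball/= => xz.
    by have := ler_distD x z 0; rewrite !subr0 distrC; move: xz zx; lra.
  have i2 := integrable_sub _ _ (integrable_mul_indic _ _ mB ih) (integrable_cmul (h x) _ i1).
  have := integrable_norm i2; apply: eq_integrable => // z _ /=.
  by rewrite -mulrBl normrM indicE; case: (_ \in _); rewrite ?normr1 ?normr0.
have key z : h x * dil phi x t z - S * (`|h z - h x| * \1_B z) - A * dil tail x t z <=
    h z * dil phi x t z.
  have d0 : 0 <= dil phi x t z := f0 _; have dS : dil phi x t z <= S := HS _.
  rewrite /dil /tail -/(dil phi x t z) !indicE.
  have [zB|zB] := ltP (`|x - z|) (t * K).
    rewrite mem_set// mulr1 memNset ?mulr0 ?subr0; last first.
      rewrite /= normrM normfV (gtr0_norm t0) distrC ler_pdivlMr// mulrC leNgt zB//.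
    rewrite lerBlDl -lerBlDr -mulrBl.
    apply: le_trans (ler_norm _) _; rewrite normrM distrC mulrC ler_wpM2r//.
    by rewrite ger0_norm.
  rewrite memNset ?mulr0 ?subr0; last by rewrite /B/ball/=; apply/negP; rewrite -leNgt.
  rewrite mem_set ?mulr1; last first.
    by rewrite /= normrM normfV (gtr0_norm t0) distrC ler_pdivlMr// mulrC.
  rewrite -mulrBl ler_wpM2r// /A; have := hM z; have := ler_norm M; have := ler_norm (h x); lra.
have i1 := integrable_cmul (h x) _ id'; have i2 := integrable_cmul S _ iB.
have i3 := integrable_cmul A _ idt; have i12 := integrable_sub _ _ i1 i2.
have := le_Rintegral measurableT (integrable_sub _ _ i12 i3) ihd (fun z _ => key z).
rewrite RintegralB// RintegralB// RintegralZl// RintegralZl// RintegralZl//.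
rewrite Rintegral_affine// Rintegral_affine// T0_Rintegral// mulr1 (gtr0_norm t0) => Hk.
rewrite (rescale_fun_distr h a b)// gtr0_norm// ler_pdivlMl//.
apply: le_trans Hk.
have h1 : S * \int[mu]_z (`|h z - h x| * \1_B z) <= t * (e / 2).
  rewrite [leRHS](_ : _ = S * (e / (2 * (S * K)) * (t * K))); last first.
    by field; rewrite !gt_eqF.
  by rewrite ler_pM2l.
have h2 : A * (t * \int[mu]_y tail y) <= t * (e / 2).
  rewrite [leRHS](_ : _ = A * (t * (e / (2 * A)))); last by field; rewrite gt_eqF.
  by rewrite ler_pM2l// ler_pM2l.
rewrite [leLHS](_ : _ = h x * t - t * (e / 2) - t * (e / 2)); last by field.
by rewrite lerB// lerB.
Qed.

End LowerValue.

(** * Comparison with the Lebesgue integral *)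

Section BorelRepresentative.
Context {R : realType}.
Implicit Types (A N : set R) (f g : R -> R) (a b : R).

Notation Lebesgue_measurable := ((@wlength R idfun)^*%mu).-cara.-measurable.
Notation cmu := (@completed_lebesgue_measure R).

Lemma Lebesgue_measurableE A : Lebesgue_measurable A ->
  exists B N, [/\ measurable B, (@lebesgue_measure R).-negligible N & A = B `|` N].
Proof.
rewrite -completed_caratheodory_measurable g_sigma_completed_algebra_genE.
by move=> [B mB [N nN <-]]; exists B, N.
Qed.

Lemma null_setS (M N : set (measurableTypeR R)) : M `<=` N ->
  (@lebesgue_measure R).-negligible N -> (@lebesgue_measure R).-negligible M.
Proof. exact: negligibleS. Qed.

Lemma null_setU (M N : set (measurableTypeR R)) : (@lebesgue_measure R).-negligible M ->
  (@lebesgue_measure R).-negligible N -> (@lebesgue_measure R).-negligible (M `|` N).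
Proof. exact: negligibleU. Qed.

Lemma null_set_bigcup (F : (set (measurableTypeR R))^nat) :
  (forall n, (@lebesgue_measure R).-negligible (F n)) ->
  (@lebesgue_measure R).-negligible (\bigcup_n F n).
Proof. exact: negligible_bigcup. Qed.

Lemma completed_negligible N : cmu.-negligible N -> (@lebesgue_measure R).-negligible N.
Proof.
move=> [A [/Lebesgue_measurableE[B [N' [mB nN' ->]]] A0 NA]].
refine (@null_setS N (B `|` N') NA _); apply: null_setU => //; exists B; split => //.
apply/eqP; rewrite eq_le measure_ge0 andbT.
rewrite -A0; apply: (le_outer_measure ((@wlength R idfun)^*)%mu).
exact: subsetUl.
Qed.

Lemma ereal_sup_rat (r : R) :
  ereal_sup [set (ratr q : R)%:E | q in [set q : rat | ratr q < r]] = r%:E.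
Proof.
apply/eqP; rewrite eq_le; apply/andP; split.
  by apply: ge_ereal_sup => _ [q /= qr <-]; rewrite lee_fin ltW.
apply/lee_subgt0Pr => e e0.
have [|q] := @rat_in_itvoo R (r - e) r; first by rewrite ltrBlDr ltrDl.
rewrite in_itv/= => /andP[rq qr]; apply: (@le_trans _ _ (ratr q)%:E).
  by rewrite -EFinB lee_fin ltW.
by apply: ereal_sup_ubound; exists q.
Qed.

(** f(x) is the supremum of the rationals below it. Replacing each set {q < f} by its Borel part
    gives a supremum whose superlevel sets are countable unions of Borel sets, and which differs
    from [f] only on countably many null sets. *)
Lemma borel_representative f : (forall c : R, Lebesgue_measurable [set x | c < f x]) ->
  exists2 g, measurable_fun setT g &
    (@lebesgue_measure R).-negligible [set x | f x <> g x].
Proof.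
move=> mf.
have /choice[BN HBN] (q : rat) : exists BN : set R * set R, [/\ measurable BN.1,
    (@lebesgue_measure R).-negligible BN.2 & [set x | ratr q < f x] = BN.1 `|` BN.2].
  by have [B [N H]] := Lebesgue_measurableE _ (mf (ratr q)); exists (B, N).
pose g0 (x : R) := ereal_sup [set (ratr q : R)%:E | q in [set q : rat | (BN q).1 x]].
have mg0 : measurable_fun setT g0.
  apply: (measurability _ (ErealGenOInfty.measurableE R)).
  move=> _ [_ [r ->] <-]; rewrite setTI.
  rewrite (_ : _ @^-1` _ = \bigcup_(q : rat) (if r < ratr q then (BN q).1 else set0)).
    apply: bigcupT_measurable_rat => q; case: ifP => _; last exact: measurable0.
    by case: (HBN q).
  apply/seteqP; split => x /=.
    rewrite in_itv/= andbT => /ereal_sup_gt[_ [q /= Bx <-]]; rewrite lte_fin => rq.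
    by exists q => //; rewrite rq.
  move=> [q _]; case: ifP => // rq Bx; rewrite in_itv/= andbT.
  apply: (@lt_le_trans _ _ (ratr q)%:E); first by rewrite lte_fin.
  by apply: ereal_sup_ubound; exists q.
(* [g0] agrees with [f] off the null sets but may be infinite on them. *)
exists (fine \o g0); first exact: measurableT_comp.
pose F n := if unpickle n is Some q then (BN q).2 else set0.
apply: (@null_setS _ (\bigcup_n F n)); last first.
  apply: null_set_bigcup => n; rewrite /F; case: (unpickle n) => [q|].
    by case: (HBN q).
  exact: negligible_set0.
move=> x /= fgx; apply: contrapT => nF; apply: fgx.
rewrite /g0 (_ : [set q : rat | (BN q).1 x] = [set q : rat | ratr q < f x]).
  by rewrite ereal_sup_rat.
apply/seteqP; split => q /= Hq; have [_ _ E] := HBN q.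
  by have : [set x | ratr q < f x] x by rewrite E; left.
have : [set x | ratr q < f x] x by [].
rewrite E => -[Bx|Nx]; first exact: Bx.
exfalso; apply: nF; exists (pickle q); first exact: I.
by rewrite /F pickleK; exact: Nx.
Qed.

Lemma measurable_completed (D : set R) (f : R -> \bar R) : measurable D ->
  measurable_fun D f ->
  @measurable_fun _ _ (caratheodory_type ((@wlength R idfun)^*)%mu) _ D f.
Proof.
by move=> mD mf _ Y mY; apply: sub_caratheodory; exact: mf.
Qed.

(** The identity, measurable from the completed to the Borel structure, pushes [cmu] forward to
    Lebesgue measure. *)
Lemma ge0_integral_completed (D : set R) (f : R -> \bar R) : measurable D ->
  measurable_fun D f -> (forall x, D x -> 0 <= f x)%E ->
  (\int[cmu]_(x in D) f x = \int[mu]_(x in D) f x)%E.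
Proof.
move=> mD mf f0.
pose i : caratheodory_type ((@wlength R idfun)^*)%mu -> measurableTypeR R := id.
have mi : measurable_fun setT i.
  by move=> _ Y mY; rewrite setTI; exact: sub_caratheodory.
have := @ge0_integral_pushforward _ _ _ _ R i mi cmu D f mD mf.
move=> <-; last by move=> x; rewrite inE; exact: f0.
exact: eq_measure_integral.
Qed.

Lemma integral_completed (D : set R) (f : R -> \bar R) : measurable D ->
  measurable_fun D f ->
  (\int[cmu]_(x in D) f x = \int[mu]_(x in D) f x)%E.
Proof.
move=> mD mf; rewrite integralE [RHS]integralE; congr (_ - _)%E.
  apply: ge0_integral_completed => //; exact: measurable_funepos.
apply: ge0_integral_completed => //; exact: measurable_funeneg.
Qed.

Lemma integrable_borel_representative a b (f : R -> \bar R) : a < b ->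
  cmu.-integrable `[a, b] f -> exists g Z,
  [/\ Lebesgue_integrable g, (forall x, ~ a < x <= b -> g x = 0),
      (@lebesgue_measure R).-negligible Z,
      (forall x, (`[a, b] `\` Z) x -> f x = (g x)%:E) &
      (\int[cmu]_(x in `[a, b]) f x)%E = (\int[mu]_x g x)%:E].
Proof.
move=> ab fi; have /integrableP[mf fin] := fi.
have mD : measurable (`[a, b] : set R) by exact: measurable_itv.
have mDc : Lebesgue_measurable `[a, b] by exact: sub_caratheodory.
have [|g1 mg1 nZ1] := borel_representative (fun x => fine ((f \_ `[a, b]) x)).
  move=> c; have mf' : @measurable_fun _ _ (caratheodory_type ((@wlength R idfun)^*)%mu) _
     setT (fine \o (f \_ `[a, b])).
    apply: (@measurableT_comp _ _ _ _ _ _ fine); first exact: fine_measurable.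
    exact: (measurable_restrictT _ mDc).1.
  have := mf' measurableT `]c, +oo[%classic (measurable_itv _).
  rewrite setTI; congr Lebesgue_measurable; apply/seteqP; split => x /=; rewrite in_itv/= andbT//.
pose g x := g1 x * \1_(`]a, b] : set R) x.
have mg : measurable_fun setT g.
  by apply: measurable_funM => //; apply: indic_mfun; exact: measurable_itv.
have g0 x : ~ a < x <= b -> g x = 0.
  by move=> xab; rewrite /g indicE memNset ?mulr0//= in_itv.
(* The point [a] is exceptional because [g] is cut down to ]a, b], and the infinite values of [f]
   because [fine] forgets them. *)
pose Z := [set x | fine ((f \_ `[a, b]) x) <> g1 x] `|` [set a] `|`
  ~` [set x : R | `[a, b]%classic x -> f x \is a fin_num].
have nZ : (@lebesgue_measure R).-negligible Z.
  apply: null_setU.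
    apply: null_setU => //; exists [set a]; split => //; exact: lebesgue_measure_set1.
  apply: completed_negligible; exact: integrable_ae fi.
have fg x : (`[a, b] `\` Z) x -> f x = (g x)%:E.
  move=> [xab nz]; have fx : f x \is a fin_num.
    by apply: contrapT => nfx; apply: nz; right => /(_ xab).
  have xa : x != a by apply/eqP => xa; apply: nz; left; right.
  have -> : g x = fine (f x).
    rewrite /g -(_ : fine ((f \_ `[a, b]) x) = g1 x); last first.
      by apply: contrapT => H; apply: nz; left; left.
    rewrite patchE mem_set// indicE mem_set ?mulr1//=.
    by move: xab; rewrite /= !in_itv/= lt_neqAle eq_sym xa.
  by rewrite fineK.
have aeq : ae_eq cmu `[a, b] f (EFin \o g).
  have [A [mA A0 ZA]] := nZ.
  exists A; split => //; first exact: sub_caratheodory.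
  move=> x /= H; apply: ZA; apply: contrapT => nZx; apply: H => xab.
  exact: fg.
have mgE : measurable_fun (`[a, b] : set R) (EFin \o g) by exact/measurable_funTS/measurable_EFinP.
have mgEc := measurable_completed _ _ mD mgE.
have gD (h : R -> \bar R) : (forall x, ~ a < x <= b -> h x = 0%E) ->
    (\int[mu]_(x in `[a, b]) h x = \int[mu]_x h x)%E.
  move=> h0; rewrite integral_mkcond; apply: eq_integral => x _; rewrite patchE.
  case: ifPn => //; rewrite notin_setE/= in_itv/= => xab; rewrite h0//.
  by move=> /andP[ax xb]; apply: xab; rewrite (ltW ax) xb.
have ig : Lebesgue_integrable g.
  apply/integrableP; split; first exact/measurable_EFinP.
  rewrite -(gD (fun x => `|(g x)%:E|)%E); last by move=> x /g0 ->; rewrite abse0.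
  have mag : measurable_fun (`[a, b] : set R) (fun x => `|(g x)%:E|%E).
    exact: (@measurableT_comp _ _ _ _ _ _ abse).
  rewrite -ge0_integral_completed//.
  apply: le_lt_trans fin; rewrite le_eqVlt; apply/orP; left; apply/eqP.
  apply: ae_eq_integral.
  - exact: mDc.
  - exact: (measurable_completed _ _ mD mag).
  - exact: (@measurableT_comp _ _ _ _ _ _ abse).
  - exact: (ae_eq_sym (ae_eq_abse aeq)).
exists g, Z; split; [exact: ig|exact: g0|exact: nZ|exact: fg|].
rewrite (ae_eq_integral _ _ mDc mf mgEc aeq) integral_completed// gD.
  by rewrite /Rintegral fineK//; exact: integrable_fin_num ig.
by move=> x /g0 /= ->.
Qed.

End BorelRepresentative.

(** * Truncations and weights for null sets *)

Section Truncation.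
Context {R : realType}.
Implicit Types (g h psi : R -> R) (Z : set R) (e t x K M : R).

Lemma integrable_max h M : Lebesgue_integrable h -> 0 <= M ->
  Lebesgue_integrable (fun x => Num.max (h x) (- M)).
Proof.
move=> ih M0; apply: (le_integrable measurableT _ _ (integrable_norm ih)).
  by apply/measurable_EFinP/measurable_maxr => //; exact: integrable_mfun.
move=> x _; rewrite /= lee_fin normr_id; have [hM|//] := leP (h x) (- M).
by rewrite normrN (ger0_norm M0) -normrN (le_trans _ (ler_norm _))// lerNr.
Qed.

Lemma truncation_integral h e : Lebesgue_integrable h -> 0 < e -> exists2 M, 0 <= M &
  \int[mu]_x Num.max (h x) (- M) <= \int[mu]_x h x + e.
Proof.
move=> ih e0.
have : (\int[mu]_x (Num.max (h x) (- n%:R))%:E)%E @[n --> \oo] -->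
    (\int[mu]_x (h x)%:E)%E.
  have := @dominated_cvg _ _ R lebesgue_measure setT measurableT
    (fun n x => (Num.max (h x) (- n%:R))%:E) (fun x => (h x)%:E) (fun x => `|h x|%:E).
  apply.
  - by move=> n; apply/measurable_EFinP/measurable_maxr => //; exact: integrable_mfun.
  - move=> x _; apply: cvg_near_cst; near=> n; apply/eqP; rewrite eqe.
    rewrite max_l// lerNl; apply: le_trans (ler_norm _) _; rewrite normrN.
    by near: n; exact: nbhs_infty_ger.
  - by [].
  - exact: integrable_norm ih.
  - move=> n x _; rewrite /= lee_fin; have [hM|//] := leP (h x) (- n%:R).
    by rewrite normrN (ger0_norm (ler0n _ _)) -normrN (le_trans _ (ler_norm _))// lerNr.
have ifin := integrable_fin_num measurableT ih.
rewrite -(fineK ifin) => /fine_cvgP[_ /cvgrPdist_le/(_ e e0)][n _ /(_ n (leqnn n))] /= H.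
exists n%:R => //; rewrite -lerBlDl.
by apply: le_trans H; rewrite distrC ler_norm.
Unshelve. all: by end_near. Qed.

Lemma open_neighborhoods_null Z e : (@lebesgue_measure R).-negligible Z -> 0 < e ->
  exists U : set R, [/\ open U, Z `<=` U & (lebesgue_measure U <= e%:E)%E].
Proof.
move=> [A [mA A0 ZA]] e0.
have {}A0 : lebesgue_measure (A : set R) = 0%E := A0.
have Afin : (lebesgue_measure (A : set R) < +oo)%E by rewrite A0.
have [U [oU AU Ue]] := lebesgue_regularity_outer mA Afin e0.
exists U; split => //; first exact: subset_trans AU.
have A0' : (lebesgue_measure (A : set R) <= 0)%E by rewrite A0.
have mUA : measurable (U `\` A) by apply: measurableD => //; exact: open_measurable.
have := @measureU2 _ _ R lebesgue_measure (U `\` A) A mUA mA.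
rewrite (setUC (U `\` A)) setDUK// => /le_trans; apply.
by rewrite -[leRHS]adde0; apply: leeD => //; exact: ltW.
Qed.

(* An integrable weight of small mass whose means blow up on [Z] absorbs the
   points at which a major pair is not controlled by [f]. *)
Lemma null_set_weight Z e : (@lebesgue_measure R).-negligible Z -> 0 < e ->
  exists psi, [/\ Lebesgue_integrable psi, forall x, 0 <= psi x,
    \int[mu]_x psi x <= e &
    forall x K, Z x -> exists2 t1, 0 < t1 & forall t, 0 < t < t1 ->
      K <= rescale (fun_distr psi) x t hat].
Proof.
move=> nZ e0.
(* The measures e / 2^(n+1) add up to [e], which bounds the integral of the sum of the
   indicators. *)
have /choice[G HG] (n : nat) : exists U : set R,
    [/\ open U, Z `<=` U & (lebesgue_measure U <= (e / (2 ^ n.+1)%:R)%:E)%E].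
  by apply: open_neighborhoods_null => //; rewrite divr_gt0.
have mG n : measurable (G n) by have [/open_measurable] := HG n.
pose Psi (x : R) : \bar R := (\sum_(0 <= n <oo) (\1_(G n) x)%:E)%E.
have one0 n x : (0 <= (\1_(G n) x : R)%:E)%E by rewrite lee_fin; exact: indic_nneg.
have Psi0 x : (0 <= Psi x)%E by apply: nneseries_ge0.
have mPsi : measurable_fun setT Psi.
  apply: ge0_emeasurable_sum => // n _.
  by apply/measurable_EFinP; exact: indic_mfun.
have Psie : (\int[mu]_x Psi x <= e%:E)%E.
  rewrite integral_nneseries//; last first.
    by move=> n; apply/measurable_EFinP; exact: indic_mfun.
  apply: le_trans (epsilon_trick0 xpredT (ltW e0)).
  apply: lee_nneseries => n _; first by move=> _; exact: integral_ge0.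
  rewrite integral_indic//; last exact: mG.
  by have [_ _ Gn] := HG n; rewrite (_ : _ `&` _ = G n)//; exact: setIT.
have iPsi : lebesgue_measure.-integrable setT Psi.
  apply/integrableP; split => //.
  under eq_integral do rewrite gee0_abs//.
  by apply: le_lt_trans Psie _; exact: ltry.
have Psifin := integrable_ae measurableT iPsi.
pose psi x := fine (Psi x).
have psi0 x : 0 <= psi x by exact: fine_ge0.
have mpsi : measurable_fun setT (EFin \o psi).
  by apply/measurable_EFinP; exact: (measurableT_comp (@fine_measurable R setT measurableT) mPsi).
have psiE : (\int[mu]_x (psi x)%:E = \int[mu]_x Psi x)%E.
  apply: ae_eq_integral => //.
  by apply: filterS Psifin => x /(_ I) fx _; rewrite /= fineK.
have ipsi : Lebesgue_integrable psi.
  apply/integrableP; split => //.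
  under eq_integral do rewrite /= ger0_norm//.
  by rewrite psiE; apply: le_lt_trans Psie _; exact: ltry.
exists psi; split => //.
  by rewrite /Rintegral psiE -lee_fin fineK//; exact: integrable_fin_num iPsi.
move=> x K Zx; pose n := Num.bound `|K|.
have Kn : K <= n%:R.
  by apply: le_trans (ler_norm K) _; rewrite ltW// archi_boundP.
(* [x] lies in every G i, so a whole interval about it lies in the first [n] of them, and there
   [Psi] is at least [n]. *)
have [d d0 Hd] : exists2 d, 0 < d & forall z, `|x - z| < d -> forall i, (i < n)%N -> G i z.
  elim: n {Kn} => [|n [d d0 Hd]]; first by exists 1.
  have [oG ZG _] := HG n.
  have [d' /= d'0 Hd'] := oG x (ZG x Zx).
  exists (Num.min d d'); first by rewrite lt_min d0.
  move=> z; rewrite lt_min => /andP[zd zd'] i.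
  by rewrite ltnS leq_eqVlt => /orP[/eqP ->|/Hd]; [exact: Hd'|exact].
exists d => // t /andP[t0 td]; have tn0 : t != 0 by rewrite gt_eqF.
have th := test_dil _ x _ tn0 test_hat.
have id' := test_integrable _ th.
have ipd := fun_distr_integrable _ _ (integrable_locally_L1 _ ipsi) th.
apply: (le_trans Kn); rewrite rescaleE gtr0_norm// ler_pdivlMl//.
have -> : t * n%:R = \int[mu]_z (n%:R * dil hat x t z).
  rewrite RintegralZl// Rintegral_affine//; last exact/test_integrable/test_hat.
  by rewrite Rintegral_hat mulr1 gtr0_norm// mulrC.
have inh := integrable_cmul n%:R _ id'.
have dh0 z : 0 <= dil hat x t z by exact: hat_ge0.
rewrite /fun_distr /Rintegral; apply: fine_le.
- exact: integrable_fin_num inh.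
- exact: integrable_fin_num ipd.
(* [psi] is 0 where [Psi] is infinite, in particular on [Z], so the comparison with [n] holds only
   almost everywhere. *)
apply: ae_ge0_le_integral => //.
- by move=> z _; rewrite lee_fin mulr_ge0.
- by apply/measurable_EFinP; exact: (integrable_mfun _ inh).
- by move=> z _; rewrite lee_fin mulr_ge0.
- by apply/measurable_EFinP; exact: (integrable_mfun _ ipd).
apply: (filterS _ Psifin) => z /(_ I) fz _; rewrite lee_fin.
have [zt|zt] := leP `|x - z| t; last first.
  rewrite (_ : dil hat x t z = 0) ?mulr0//; apply: csupp_hat.
  by rewrite normrM normfV (gtr0_norm t0) ltr_pdivlMr// mul1r distrC.
rewrite ler_wpM2r// -lee_fin fineK//.
apply: le_trans (nneseries_lim_ge n _) => //.
rewrite big_mkord (eq_bigr (fun=> 1%E)); last first.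
  by move=> i _; rewrite indicE mem_set//; apply: Hd; [exact: le_lt_trans td|].
by rewrite sumEFin lee_fin sumr_const card_ord.
Qed.

End Truncation.

(** * Major pairs against the Lebesgue integral *)

Section Comparison.
Context {R : realType}.
Implicit Types (f : R -> \bar R) (g h : R -> R) (u U : @functional R) (Z : set R)
  (a b c x : R).

Lemma point_value_unique U x c d : point_value U x c -> point_value U x d -> c = d.
Proof.
move=> /(_ _ test_hat) Hc /(_ _ test_hat); rewrite Rintegral_hat !mulr1 in Hc *.
exact: (cvg_unique (@Rhausdorff R) Hc).
Qed.

Lemma point_valueD u U c d x : point_value u x c -> point_value U x d ->
  point_value (fun phi => u phi + U phi) x (c + d).
Proof.
move=> Hc Hd phi tf; rewrite mulrDl.
rewrite (_ : (fun _ => _) = fun s => rescale u x s phi + rescale U x s phi).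
  by apply: cvgD; [exact: Hc|exact: Hd].
by apply/funext => s; rewrite /rescale mulrDr.
Qed.

Lemma sum_sup_mono phi (N N' : nat) : test_function phi -> (N <= N')%N ->
  0 <= \sum_(m < N.+1) sup (range (fun x => `|derive1n m phi x|)) <=
  \sum_(m < N'.+1) sup (range (fun x => `|derive1n m phi x|)).
Proof.
move=> tf NN; pose F m := sup (range (fun x => `|derive1n m phi x|)).
have F0 m : 0 <= F m.
  have [B B0 HB] := test_bounded _ (test_derive1n _ m tf).
  apply: le_trans (normr_ge0 (derive1n m phi 0)) _; apply: ub_le_sup; last by exists 0.
  by exists B => _ [y _ <-].
rewrite sumr_ge0/=; last by move=> i _; exact: F0.
rewrite -(big_mkord xpredT F) -(big_mkord xpredT F).
by rewrite (@big_cat_nat _ _ _ N.+1 0 N'.+1)//= lerDl sumr_ge0.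
Qed.

Lemma distributionD u U : Defs.distribution u -> Defs.distribution U ->
  Defs.distribution (fun phi => u phi + U phi).
Proof.
move=> [linu contu] [linU contU]; split.
  by move=> c phi chi tf tc; rewrite linu// linU//; ring.
move=> K cK; have [N1 [C1 H1]] := contu K cK; have [N2 [C2 H2]] := contU K cK.
exists (maxn N1 N2), (`|C1| + `|C2|) => phi tf sf.
apply: le_trans (ler_normD _ _) _; rewrite mulrDl lerD//.
  have /andP[S0 S1] := sum_sup_mono phi _ _ tf (leq_maxl N1 N2).
  apply: le_trans (H1 _ tf sf) _; apply: le_trans (ler_wpM2r S0 (ler_norm _)) _.
  by rewrite ler_wpM2l.
have /andP[S0 S1] := sum_sup_mono phi _ _ tf (leq_maxr N1 N2).
apply: le_trans (H2 _ tf sf) _; apply: le_trans (ler_wpM2r S0 (ler_norm _)) _.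
by rewrite ler_wpM2l.
Qed.

Lemma not_lebesgue_pt_negligible h : Lebesgue_integrable h ->
  (@lebesgue_measure R).-negligible (~` lebesgue_pt h).
Proof.
by move=> ih; apply: lebesgue_differentiation; apply: open_integrable_locally => //; exact: openT.
Qed.

(** The bound -M keeps all lower values finite, so the countable set is empty; the null set collects
    [Z] and the points that are not Lebesgue points of [h]. *)
Lemma truncation_major_pair a b f g Z M : Lebesgue_integrable g ->
  (forall x, ~ a < x <= b -> g x = 0) -> (@lebesgue_measure R).-negligible Z ->
  (forall x, (`[a, b] `\` Z) x -> f x = (g x)%:E) -> 0 <= M ->
  let h x := Num.max (g x) (- M) in
  major_pair a b f (fun_distr h) (fun_distr (prim h)) /\
  point_value (fun_distr (prim h)) b (\int[mu]_x h x).
Proof.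
move=> ig g0 nZ fg M0 h.
have h0 x : ~ a < x <= b -> h x = 0.
  by move=> xab; rewrite /h g0// max_l// oppr_le0.
have hM x : - M <= h x by rewrite /h le_max lexx orbT.
have ih : Lebesgue_integrable h by exact: integrable_max.
split; last first.
  by rewrite -(prim_right h a b h0); exact/fun_distr_point_value/prim_continuous.
split; first exact: fun_distr_primitive.
exists set0, (Z `|` ~` lebesgue_pt h); split.
- exact: countable0.
- by apply: null_setU nZ _; exact: not_lebesgue_pt_negligible.
- move=> x phi [xab nx] Tf.
  have xZ : ~ Z x by move=> Zx; apply: nx; left.
  have hx : lebesgue_pt h x by apply: contrapT => nh; apply: nx; right.
  rewrite fg//; apply: le_trans (lower_value_lebesgue_pt h a b M phi x ih h0 hM Tf hx).
  by rewrite lee_fin le_max lexx.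
- move=> x phi _ [Tf _]; apply: (@lt_le_trans _ _ (- M)%:E); first exact: ltNyr.
  apply: lower_value_ge => e e0; exists 1 => // t /andP[t0 _].
  apply: le_trans (rescale_fun_distr_ge h a b M phi x t ih h0 hM Tf t0).
  by rewrite gerBl ltW.
Qed.

Lemma major_pair_integral_le a b f g Z u U beta : a < b -> Lebesgue_integrable g ->
  (forall x, ~ a < x <= b -> g x = 0) -> (@lebesgue_measure R).-negligible Z ->
  (forall x, (`[a, b] `\` Z) x -> f x = (g x)%:E) ->
  major_pair a b f u U -> point_value U b beta ->
  \int[mu]_x g x <= beta.
Proof.
move=> ab ig g0 nZ fg [[_ [[linU contU] pvU] dU Ua]] [E [Z' [cE nZ' fu uE]]] Ub.
have [V pvV] := choice pvU.
have Va : V a = 0 := point_value_unique _ _ _ _ (pvV a) Ua.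
have Vb : V b = beta := point_value_unique _ _ _ _ (pvV b) Ub.
(* The losses are [e] for the truncation, [e] for the mass of [psi], and e (b - a) for the constant
   added to the density. *)
suff H e : 0 < e -> \int[mu]_x g x <= beta + e * (2 + (b - a)).
  apply/ler_addgt0Pr => e e0; apply: le_trans (H (e / (2 + (b - a))) _) _.
    by rewrite divr_gt0// ltr_pwDl// subr_ge0 ltW.
  by rewrite divfK// gt_eqF// ltr_pwDl// subr_ge0 ltW.
move=> e0; pose I := \1_(`]a, b] : set R) : R -> R.
have mI : measurable (`]a, b] : set R) by exact: measurable_itv.
have iI : Lebesgue_integrable I.
  apply: (integrable_csupp (`|a| + `|b|) _ 1 (indic_mfun _ mI)).
    by move=> z; rewrite /I indicE; case: (_ \in _); rewrite ?normr1 ?normr0.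
  move=> z zab; rewrite /I indicE memNset//= in_itv/= => /andP[az zb].
  have [z0|z0] := ltP 0 z.
    move: zab; rewrite (gtr0_norm z0) ltNge => /negP; apply; apply: (le_trans zb).
    by rewrite (le_trans (ler_norm b))// lerDr.
  move: zab; rewrite (ler0_norm z0) ltNge => /negP; apply; apply: (@le_trans _ _ (- a)).
    by rewrite lerN2 ltW.
  by rewrite (le_trans (ler_norm (- a)))// normrN lerDl.
have II : \int[mu]_x I x = b - a := Rintegral_indic_itv _ _ (ltW ab).
have igN := integrable_cmul (- 1) _ ig.
have [M M0 HM] := truncation_integral _ e igN e0.
(* This is - min(g, M): its means stay above -M and cannot offset the divergence of those of
   [psi]. *)
pose h1 x := Num.max (- 1 * g x) (- M).
(* The added term gives g + h2 >= e on ]a, b], a margin that survives passing from lower limits to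
   small [t]. *)
pose h2 x := h1 x + e * I x.
have ih1 : Lebesgue_integrable h1 by exact: integrable_max.
have ih2 : Lebesgue_integrable h2 by apply: integrable_add => //; exact: integrable_cmul.
have h20 x : ~ a < x <= b -> h2 x = 0.
  move=> xab; rewrite /h2 /h1 /I g0// mulr0 max_l ?oppr_le0// indicE memNset ?mulr0 ?addr0//.
have h2M x : - M <= h2 x.
  rewrite /h2 ler_wpDr//; first by rewrite mulr_ge0 ?(ltW e0)//; exact: indic_nneg.
  by rewrite /h1 le_max lexx orbT.
pose bad := Z `|` Z' `|` ~` lebesgue_pt h2.
have nbad : (@lebesgue_measure R).-negligible bad.
  by apply: null_setU (not_lebesgue_pt_negligible _ ih2); exact: null_setU.
have [psi [ipsi psi0 psie Hpsi]] := null_set_weight _ _ nbad e0.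
pose h x := h2 x + psi x.
have ih : Lebesgue_integrable h by exact: integrable_add.
have cH := prim_continuous _ ih.
pose W : @functional R := fun phi => U phi + fun_distr (prim h) phi.
have [linW contW] : Defs.distribution W.
  by apply: distributionD => //; exact/fun_distr_distribution/continuous_locally_L1.
have pvW x : point_value W x (V x + prim h x).
  by apply: point_valueD => //; exact: fun_distr_point_value.
have pos x : a < x < b -> ~ E x -> exists e0 t1 : R,
    [/\ 0 < e0, 0 < t1 & forall t, 0 < t < t1 -> e0 <= rescale (deriv_distr W) x t hat].
  move=> /andP[ax xb] nEx.
  have xab : `[a, b]%classic x by rewrite /= in_itv/= !ltW.
  have Wt t : 0 < t -> rescale (deriv_distr W) x t hat =
      rescale (smooth_ext u) x t hat + rescale (smooth_ext (fun_distr h2)) x t hat +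
      rescale (fun_distr psi) x t hat.
    move=> t0; have tn0 : t != 0 by rewrite gt_eqF.
    have th := test_dil _ x _ tn0 test_hat.
    rewrite !rescale_ext_test//; [|exact: test_hat..].
    rewrite !rescaleE -!mulrDr; congr (_ * _).
    rewrite -(dU _ th) /deriv_distr /W opprD -addrA; congr (_ + _).
    transitivity (fun_distr h (dil hat x t)).
      by rewrite -(deriv_fun_distr_prim _ ih _ th).
    rewrite /fun_distr -RintegralD//.
    - by apply: eq_Rintegral => z _; rewrite /h mulrDl.
    - exact: (fun_distr_integrable _ _ (integrable_locally_L1 _ ih2) th).
    - exact: (fun_distr_integrable _ _ (integrable_locally_L1 _ ipsi) th).
  have psit t : 0 < t -> 0 <= rescale (fun_distr psi) x t hat.
    move=> t0; rewrite rescaleE mulr_ge0//; apply: Rintegral_ge0 => z _.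
    by rewrite mulr_ge0//; exact: hat_ge0.
  have [Thx T1hx] := @T1_hat R.
  have [xbad|xgood] := pselect (bad x).
    have [c Hc] : exists c : R, (c%:E < lower_value u hat x)%E.
      have := uE x hat (conj xab nEx) (@T1_hat R).
      case: (lower_value u hat x) => [r _| _|//]; first by exists (r - 1); rewrite lte_fin gtrBl.
      by exists 0; exact: ltry.
    have [t1 t10 Ht1] := lower_value_gt _ _ _ _ Hc.
    (* The means of [u] are only known to be at least some [c], and those of [h2] at least -M; this
       level brings the sum to 1. *)
    have [t2 t20 Ht2] := Hpsi x (1 - c + M) xbad.
    exists 1, (Num.min t1 t2); split => //; first by rewrite lt_min t10.
    move=> t /andP[t0]; rewrite lt_min => /andP[tt1 tt2]; rewrite Wt//.
    have H1 := Ht1 t; rewrite t0 tt1 in H1; have {}H1 := H1 isT.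
    have H2 := Ht2 t; rewrite t0 tt2 in H2; have {}H2 := H2 isT.
    have H3 := rescale_fun_distr_ge h2 a b M hat x t ih2 h20 h2M Thx t0.
    by move: H1 H2 H3; lra.
  (* At a good point the lower values of [u] and [h2] add up to at least [e]; giving up e / 4 in
     each leaves e / 2. *)
  have e40 : 0 < e / 4 by rewrite divr_gt0.
  have xZ : ~ Z x by move=> Zx; apply: xgood; left; left.
  have xZ' : ~ Z' x by move=> Zx; apply: xgood; left; right.
  have hx : lebesgue_pt h2 x by apply: contrapT => nh; apply: xgood; right.
  have := fu x hat (conj xab xZ') Thx; rewrite fg// => Hu.
  have Hug : ((g x - e / 4)%:E < lower_value u hat x)%E.
    by apply: lt_le_trans Hu; rewrite lte_fin gtrBl.
  have Hh : ((h2 x - e / 4)%:E < lower_value (fun_distr h2) hat x)%E.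
    apply: lt_le_trans (lower_value_lebesgue_pt h2 a b M hat x ih2 h20 h2M Thx hx).
    by rewrite lte_fin gtrBl.
  have [t1 t10 Ht1] := lower_value_gt _ _ _ _ Hug.
  have [t2 t20 Ht2] := lower_value_gt _ _ _ _ Hh.
  exists (e / 2), (Num.min t1 t2); split; [by rewrite divr_gt0|by rewrite lt_min t10|].
  move=> t /andP[t0]; rewrite lt_min => /andP[tt1 tt2]; rewrite Wt//.
  have H1 := Ht1 t; rewrite t0 tt1 in H1; have {}H1 := H1 isT.
  have H2 := Ht2 t; rewrite t0 tt2 in H2; have {}H2 := H2 isT.
  have H3 := psit t t0.
  have H4 : e - g x <= h2 x.
    rewrite /h2 /I indicE mem_set ?mulr1; last by rewrite /= in_itv/= ax ltW.
    by rewrite addrC lerD2r /h1 mulN1r le_max lexx.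
  rewrite (_ : e / 2 = (g x - e / 4) + (e - g x - e / 4) + 0); last by field.
  by rewrite !lerD// (le_trans _ H2)// lerD2r.
have := value_mono_endpoints W linW contW _ pvW a b E cE pos ab.
have hD : \int[mu]_s (h s * \1_(`]a, b] : set R) s) <=
    \int[mu]_s h1 s + e * \int[mu]_s I s + \int[mu]_s psi s.
  rewrite -RintegralZl// -RintegralD//; last exact: integrable_cmul.
  rewrite -RintegralD//; apply: le_Rintegral => //.
  - exact: integrable_mul_indic.
  - move=> s _; rewrite -/(h2 s) -/(h s); have [sab|sab] := pselect (a < s <= b).
      by rewrite indicE mem_set ?mulr1//= in_itv.
    rewrite indicE memNset ?mulr0; last by rewrite /= in_itv.
    by rewrite /h h20// add0r.
have V1 := primB h a b ih (ltW ab).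
move: hD; rewrite II; move: HM psie; rewrite RintegralZl// mulN1r => HM psie hD.
rewrite Va Vb; move: V1 HM psie hD; rewrite /h1.
set A := \int[_]_s (_ * _); set B := \int[_]_x Num.max _ _.
by lra.
Qed.

End Comparison.

Section UpperIntegral.
Context {R : realType}.
Implicit Types (a b : R) (f : R -> \bar R).

Lemma exists_major_pair a b f : a < b ->
  (@completed_lebesgue_measure R).-integrable `[a, b] f ->
  exists u U, major_pair a b f u U.
Proof.
move=> ab fi.
have [g [Z [ig g0 nZ fg _]]] := integrable_borel_representative a b f ab fi.
have [mp _] := truncation_major_pair a b f g Z 0 ig g0 nZ fg (lexx 0).
by eexists; eexists; exact: mp.
Qed.

Lemma upper_dist_integralE a b f : a < b ->
  (@completed_lebesgue_measure R).-integrable `[a, b] f ->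
  upper_dist_integral a b f =
    (\int[@completed_lebesgue_measure R]_(x in `[a, b]) f x)%E.
Proof.
move=> ab fi.
have [g [Z [ig g0 nZ fg ->]]] := integrable_borel_representative a b f ab fi.
apply/eqP; rewrite eq_le; apply/andP; split.
  apply/lee_addgt0Pr => e e0; have [M M0 HM] := truncation_integral g e ig e0.
  have [mp pv] := truncation_major_pair a b f g Z M ig g0 nZ fg M0.
  apply: (@le_trans _ _ (\int[mu]_x Num.max (g x) (- M))%:E); last first.
    by rewrite -EFinD lee_fin.
  apply: ereal_inf_lbound; eexists; last reflexivity.
  by eexists; eexists; split; [exact: mp|exact: pv].
apply: le_ereal_inf_tmp => _ [beta [u [U [mp pv]]] <-]; rewrite lee_fin.
exact: (major_pair_integral_le a b f g Z u U beta ab ig g0 nZ fg mp pv).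
Qed.

End UpperIntegral.

Theorem theorem6p1 (R : realType) (a b : R) (ab : a < b) (f : R -> \bar R)
    (intf : (@completed_lebesgue_measure R).-integrable `[a, b] f) :
  dist_integrable a b f /\
  dist_integral a b f =
    (\int[@completed_lebesgue_measure R]_(x in `[a, b]) f x)%E.
Proof.
have intNf := integrableN intf.
have upper := upper_dist_integralE a b f ab intf.
split; last exact: upper.
split; first exact: exists_major_pair.
- have [u [U mp]] := exists_major_pair a b _ ab intNf.
  by do 2 eexists; exact: major_pairN mp.
- have mab : ((@wlength R idfun)^*%mu).-cara.-measurable (`[a, b]%classic : set R).
    exact: sub_caratheodory.
  rewrite lower_dist_integralN upper (upper_dist_integralE a b _ ab intNf).
  rewrite integralN ?oppeK//; exact: integrable_add_def mab _ intf.
Qed.
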